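(* There is a randomized approximation algorithm for DAG Edge Deletion with parameter $k$ (DED($k$)) with approximation ratio $0.549(k+1)$. In particular, given a feasible solution $x$ to the linear program $$\min \sum_{e\in A} c_e x_e \quad \text{s.t.} \quad \sum_{e\in P} x_e \ge 1 \ \text{ for all paths } P \text{ with } k \text{ edges},\qquad x_e \ge 0 \ \text{ for all } e\in A,$$ there is a randomized algorithm producing a DED($k$) solution of expected cost at most $0.549(k+1)\cdot c(x)$, where $c(x)=\sum_{e\in A} c_e x_e$ is the cost of the LP solution. Therefore, the integrality gap of this linear program is at most $0.549(k+1)$.
   Context: In the DAG Edge Deletion problem DED($k$), we are given a directed acyclic graph $G=(V,A)$ with nonnegative edge costs $c_e$ and a parameter $k$ (which may depend on $n$), and the goal is to delete a minimum-cost set of edges so that the resulting graph has no directed path with $k$ edges. The natural LP relaxation has a variable $x_e$ for each edge (the fractional amount by which $e$ is cut), minimizes $\sum_e c_e x_e$, and requires every path with $k$ edges to have total $x$-value at least $1$, with $x\ge 0$; it can be solved in polynomial time via a separation oracle since the graph is a DAG. *)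

(* Defs.v *)
From HB Require Import structures.
From mathcomp Require Import all_boot all_order all_algebra.
From mathcomp Require Import all_classical all_reals all_analysis.

Set Implicit Arguments.
Unset Strict Implicit.
Unset Printing Implicit Defensive.

Import Order.TTheory GRing.Theory Num.Theory.
Local Open Scope ring_scope.

Notation edge n := ('I_n * 'I_n)%type.

Definition adj (n : nat) (E : {set edge n}) : rel 'I_n :=
  [rel u v | (u, v) \in E].

(* [cost] is only meaningful on [arcs]; its values elsewhere are never used. *)
Record dag (F : realFieldType) := Dag {
  nverts : nat;
  arcs : {set edge nverts};
  cost : edge nverts -> F;
  arcs_acyclic : forall p : seq 'I_nverts, cycle (adj arcs) p -> p = [::];
  cost_ge0 : forall e, e \in arcs -> 0 <= cost e }.

(* The directed path with vertices [v :: p] has [size p] edges. *)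
Definition dipath (n : nat) (E : {set edge n}) (v : 'I_n) (p : seq 'I_n) : bool :=
  path (adj E) v p && uniq (v :: p).

Definition path_edges (n : nat) (v : 'I_n) (p : seq 'I_n) : seq (edge n) :=
  zip (v :: p) p.

Section DED.
Variables (F : realFieldType) (G : dag F) (k : nat).

Definition ded_solution (S : {set edge (nverts G)}) : bool :=
  (S \subset arcs G) &&
  [forall v, forall p : k.-tuple 'I_(nverts G), ~~ dipath (arcs G :\: S) v p].

Definition set_cost (S : {set edge (nverts G)}) : F := \sum_(e in S) cost e.

(* For [0 < k] the set of all arcs is a solution, so that the starting value
   of the iterated minimum is attained. *)
Definition ded_opt : F :=
  \big[Num.min/set_cost (arcs G)]_(S : {set edge (nverts G)} | ded_solution S)
    set_cost S.

Definition lp_feasible (x : edge (nverts G) -> F) : Prop :=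
  (forall v p, size p = k -> dipath (arcs G) v p ->
     1 <= \sum_(e <- path_edges v p) x e) /\
  (forall e, e \in arcs G -> 0 <= x e).

Definition lp_cost (x : edge (nverts G) -> F) : F :=
  \sum_(e in arcs G) cost e * x e.

Definition is_distr (T : finType) (mu : T -> F) : Prop :=
  (forall t, 0 <= mu t) /\ \sum_t mu t = 1.

End DED.

Definition lp_opt (R : realType) (G : dag R) (k : nat) : R :=
  inf [set lp_cost x | x in [set x | lp_feasible (G := G) k x]]%classic.

(* Instances whose two optima vanish have ratio 1; an instance for which only
   the LP optimum vanishes has ratio +oo. *)
Definition gap_ratio (R : realType) (opt lp : R) : \bar R :=
  if lp == 0 then (if opt == 0 then 1%E else +oo%E) else (opt / lp)%:E.

Definition integrality_gap (R : realType) (k : nat) : \bar R :=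
  ereal_sup [set gap_ratio (ded_opt G k) (lp_opt G k) | G in [set: dag R]]%classic.

(* Memory of a random-access machine: infinite arrays of rationals, where [s a i] is cell
   [i] of array [a].  Every operation is charged the number of bits of the numbers it
   handles, so that polynomial cost coincides with polynomial time on a Turing
   machine. *)
Definition store : Type := nat -> nat -> rat.

Definition nat_bits (m : nat) : nat := (trunc_log 2 m).+1.

Definition rat_bits (q : rat) : nat :=
  (nat_bits `|numq q| + nat_bits `|denq q|)%N.

Inductive binop := OpAdd | OpSub | OpMul | OpDiv.

Inductive expr :=
  | Cst of rat
  | Get of nat & expr
  | Bin of binop & expr & expr.

(* [Assign a i e] stores [e] in cell [i] of array [a]; [If] and [While] test
   whether their guard is positive. *)
Inductive cmd :=
  | Skip
  | Assign of nat & expr & expr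
  | Seq of cmd & cmd
  | If of expr & cmd & cmd
  | While of expr & cmd.

Definition binop_sem (o : binop) (p q : rat) : rat :=
  match o with
  | OpAdd => p + q
  | OpSub => p - q
  | OpMul => p * q
  | OpDiv => p / q
  end.

(* Negative indices denote cell 0, other ones are rounded down. *)
Definition address (q : rat) : nat := Num.truncn q.

Fixpoint eval_expr (s : store) (e : expr) : rat :=
  match e with
  | Cst q => q
  | Get a i => s a (address (eval_expr s i))
  | Bin o e1 e2 => binop_sem o (eval_expr s e1) (eval_expr s e2)
  end.

Fixpoint eval_cost (s : store) (e : expr) : nat :=
  (rat_bits (eval_expr s e) +
   match e with
   | Cst _ => 0
   | Get _ i => eval_cost s i
   | Bin _ e1 e2 => eval_cost s e1 + eval_cost s e2
   end)%N.

Definition update (s : store) (a i : nat) (q : rat) : store :=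
  fun b j => if (b == a) && (j == i) then q else s b j.

(* [exec c s s' t]: started in [s], [c] halts in [s'] with total cost [t]. *)
Inductive exec : cmd -> store -> store -> nat -> Prop :=
  | exec_skip s : exec Skip s s 1
  | exec_assign s a i e :
      exec (Assign a i e) s (update s a (address (eval_expr s i)) (eval_expr s e))
        (eval_cost s i + eval_cost s e).+1
  | exec_seq c1 c2 s1 s2 s3 t1 t2 :
      exec c1 s1 s2 t1 -> exec c2 s2 s3 t2 ->
      exec (Seq c1 c2) s1 s3 (t1 + t2).+1
  | exec_if e c1 c2 s s' t :
      exec (if 0 < eval_expr s e then c1 else c2) s s' t ->
      exec (If e c1 c2) s s' (eval_cost s e + t).+1
  | exec_while_stop e c s :
      ~~ (0 < eval_expr s e) -> exec (While e c) s s (eval_cost s e).+1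
  | exec_while_step e c s1 s2 s3 t1 t2 :
      0 < eval_expr s1 e -> exec c s1 s2 t1 -> exec (While e c) s2 s3 t2 ->
      exec (While e c) s1 s3 (eval_cost s1 e + t1 + t2).+1.

(* Row-major list of the values of [f] on the arcs, with 0 off the arcs. *)
Definition arc_table (G : dag rat) (f : edge (nverts G) -> rat) : seq rat :=
  [seq (if (u, v) \in arcs G then f (u, v) else 0)
    | u <- enum 'I_(nverts G), v <- enum 'I_(nverts G)].

(* [y] is the additional input (an LP solution, or nothing) and [w] the random
   bits.  Array 5, which receives the output, is initially zero, as is all the
   remaining memory. *)
Definition input (G : dag rat) (k : nat) (y : seq rat) (w : seq bool) : store :=
  fun a i =>
    match a with
    | 0 => nth 0 [:: (nverts G)%:R; k%:R] i
    | 1 => nth 0 (arc_table (G := G) (fun=> 1)) i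
    | 2 => nth 0 (arc_table (@cost _ G)) i
    | 3 => nth 0 y i
    | 4 => (nth false w i)%:R
    | _ => 0
    end.

Definition input_size (G : dag rat) (k : nat) (y : seq rat) : nat :=
  (nverts G ^ 2 + nat_bits k + \sum_(e in arcs G) rat_bits (cost e)
   + \sum_(q <- y) rat_bits q)%N.

Definition output (n : nat) (s : store) : {set edge n} :=
  [set e : edge n | s 5%N (e.1 * n + e.2)%N != 0].

(* On every string of [T] random bits, [prog] halts with cost at most [T] and
   outputs a DED(k) solution, and the expected cost of this solution is at
   most [B]. *)
Definition rand_solves (prog : cmd) (T : nat) (G : dag rat) (k : nat)
    (y : seq rat) (B : rat) : Prop :=
  exists out : T.-tuple bool -> {set edge (nverts G)},
    [/\ forall w : T.-tuple bool, exists s t,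
          [/\ exec prog (input G k y w) s t, (t <= T)%N & output _ s = out w],
        forall w, ded_solution k (out w)
      & (\sum_(w : T.-tuple bool) set_cost (out w)) / 2 ^+ T <= B].

(* As usual for probabilistic machines, a single polynomial bounds both the
   running time and the number of random bits. *)
Definition poly_time (d m : nat) : nat := (m ^ d + d)%N.

Definition approx_ratio (F : realFieldType) (k : nat) : F :=
  549%:R / 1000%:R * k.+1%:R.

(* Main.v *)
Require Import Defs.
From Stdlib Require Import NArith.
From HB Require Import structures.
From mathcomp Require Import all_boot all_order all_algebra.
From mathcomp Require Import all_classical all_reals all_analysis.
From mathcomp Require Import zify ring lra.

Set Implicit Arguments.
Unset Strict Implicit.
Unset Printing Implicit Defensive.

Import Order.TTheory GRing.Theory Num.Theory.
Local Open Scope ring_scope.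

(** Round a feasible [x] with independent random labels in [[0, 1)], cutting the arc [(u, v)]
    when [(k+1) x(u,v) > 1 + label v - label u].  Along an uncut path with [k] arcs the label
    differences telescope to less than 1, so that its [x]-length is less than 1: every such
    path is cut.  For a suitable label distribution, an arc is cut with probability at
    most [(1123/2048) (k+1) x(u,v)], and [1123/2048 < 0.549].

    If [x] is not given, the LP is first solved up to a factor 1.001 by multiplicative weights:
    repeatedly find a shortest walk with [k] arcs for the current arc weights and multiply
    the weights on it by [1 + f / cost].  Rescaling the weights by the shortest length gives a
    feasible [x]; as long as all of them are too expensive compared with an integral
    optimum, a logarithmic potential drops by a constant per step, and [O(n^4)] steps exhaust it. *)

(** * Heights of rationals *)

(** The labels are multiples of 1/80 given by a table of 256 equally likely entries. Eight random
    bits per vertex therefore produce them exactly, and the bound on the cut probability becomes a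
    finite computation. Only the expected cost depends on the distribution, and only through pairs
    of labels; feasibility holds for every string of bits.

    In the LP solver the obstacle is bit size, since every operation is charged for the numbers it
    handles. The factor [1 + f / cost] depends on the costs and on the current walk, but not on the
    weights. Hence a weight gains at most a fixed polynomial number of bits per step and stays
    polynomially long without rounding. Nor may the number of steps depend on the magnitudes of the
    costs, which forces a second term into the potential. Arcs of cost zero cannot start with weight
    1/cost; they are cut completely, for free, and walks through them are priced out by a huge
    length. Logarithms occur only in the analysis, over the reals; the program computes with exact
    rationals. *)

(* Unlike [rat_bits], the height is submultiplicative for all four operations,
   so that bit sizes just add up. *)
Definition height (q : rat) : nat := (`|numq q| + `|denq q|)%N.

Lemma height_frac (a b : int) : b != 0 ->
  (height (a%:~R / b%:~R) <= `|a| + `|b|)%N.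
Proof.
case: divqP => [_ /eqP //|k x k0 _]; rewrite /height !abszM -mulnDr.
by rewrite leq_pmull // absz_gt0.
Qed.

(** Expanding the product of the two heights gives four terms, which together bound the numerator
    and the denominator of the cross-multiplied sum; reducing that fraction only decreases them. *)
Lemma heightD p q : (height (p + q) <= height p * height q)%N.
Proof.
rewrite -{1}(divq_num_den p) -{1}(divq_num_den q) addf_div ?intr_eq0 ?denq_eq0 //.
rewrite -!intrM -intrD; apply: leq_trans (height_frac _ _) _.
  by rewrite mulf_neq0 // denq_eq0.
rewrite /height mulnDl !mulnDr.
have h (a b : int) : (`|(a + b)%R| <= `|a| + `|b|)%N by lia.
have := h (numq p * denq q) (numq q * denq p); rewrite !abszM => {}h.
by rewrite (mulnC (absz (numq q))) in h *; lia.
Qed.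

Lemma heightM p q : (height (p * q) <= height p * height q)%N.
Proof.
rewrite -{1}(divq_num_den p) -{1}(divq_num_den q) mulf_div -!intrM.
apply: leq_trans (height_frac _ _) _; first by rewrite mulf_neq0 // denq_eq0.
by rewrite /height mulnDl !mulnDr !abszM; lia.
Qed.

Lemma heightN q : height (- q) = height q.
Proof. by rewrite /height numqN denqN abszN. Qed.

Lemma heightV q : (height q^-1 <= height q)%N.
Proof.
have [->|q0] := eqVneq q 0; first by rewrite invr0.
rewrite -{1}(divq_num_den q) invf_div; apply: leq_trans (height_frac _ _) _.
  by rewrite numq_eq0.
by rewrite /height addnC.
Qed.

Lemma height_nat m : height m%:R = m.+1.
Proof. by rewrite /height -[m%:R]/(m%:~R) numq_int denq_int addn1. Qed.

Lemma height_binop o p q : (height (binop_sem o p q) <= height p * height q)%N.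
Proof.
case: o => /=; [exact: heightD| |exact: heightM|].
  by rewrite -(heightN q); apply: heightD.
apply: leq_trans (heightM _ _) _; exact: leq_mul (leqnn _) (heightV _).
Qed.

Lemma ltn_nat_bits m : (m < 2 ^ nat_bits m)%N.
Proof. exact: trunc_log_ltn. Qed.

Lemma nat_bits_leq m b : (m <= 2 ^ b)%N -> (nat_bits m <= b.+1)%N.
Proof. by move=> /(leq_trunc_log 2); rewrite trunc_expnK. Qed.

Lemma height_bits q : (height q <= 2 ^ rat_bits q)%N.
Proof.
rewrite /height expnD; have := ltn_nat_bits `|numq q|.
have := ltn_nat_bits `|denq q|; rewrite /nat_bits !expnS.
move: (2 ^ _)%N (2 ^ _)%N => a b ha hb.
have [a0 b0] : (0 < a /\ 0 < b)%N by lia.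
nia.
Qed.

Lemma rat_bits_leq q b : (height q <= 2 ^ b)%N -> (rat_bits q <= 2 * b + 2)%N.
Proof.
rewrite /height /rat_bits => h.
have := @nat_bits_leq `|numq q| b; have := @nat_bits_leq `|denq q| b.
by lia.
Qed.

Definition fits (b : nat) (q : rat) : bool := (height q <= 2 ^ b)%N.

Lemma fitsW b b' q : (b <= b')%N -> fits b q -> fits b' q.
Proof. by rewrite /fits => h /leq_trans->//; rewrite leq_exp2l. Qed.

Lemma fits_binop o b1 b2 p q : fits b1 p -> fits b2 q -> fits (b1 + b2) (binop_sem o p q).
Proof.
rewrite /fits expnD => h1 h2; apply: leq_trans (height_binop _ _ _) _.
exact: leq_mul.
Qed.

Lemma fits_add b1 b2 p q : fits b1 p -> fits b2 q -> fits (b1 + b2) (p + q).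
Proof. exact: (@fits_binop OpAdd). Qed.
Lemma fits_sub b1 b2 p q : fits b1 p -> fits b2 q -> fits (b1 + b2) (p - q).
Proof. exact: (@fits_binop OpSub). Qed.
Lemma fits_mul b1 b2 p q : fits b1 p -> fits b2 q -> fits (b1 + b2) (p * q).
Proof. exact: (@fits_binop OpMul). Qed.
Lemma fits_div b1 b2 p q : fits b1 p -> fits b2 q -> fits (b1 + b2) (p / q).
Proof. exact: (@fits_binop OpDiv). Qed.

Lemma fits_nat b m : (m < 2 ^ b)%N -> fits b m%:R.
Proof. by rewrite /fits height_nat. Qed.

Lemma fits_natS b m : (m <= b)%N -> fits b m%:R.
Proof. by move=> h; apply: fits_nat; apply: leq_ltn_trans h (ltn_expl _ _). Qed.

Lemma fits_bits q : fits (rat_bits q) q.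
Proof. exact: height_bits. Qed.

Lemma fits0 b : fits b 0.
Proof. exact: (@fits_nat b 0 (expn_gt0 2 b)). Qed.

(** * Reasoning about programs *)

(** Counts leaves, with constants weighted by their size. If every cell fits in [L] bits, the value
    fits in [expr_weight e * L.+1] bits. A read counts once whatever its index expression, since the
    index does not enter the size of the value. *)
Fixpoint expr_weight (e : expr) : nat :=
  match e with
  | Cst q => rat_bits q
  | Get _ _ => 1
  | Bin _ e1 e2 => expr_weight e1 + expr_weight e2
  end.

Fixpoint expr_charge (e : expr) : nat :=
  (2 * expr_weight e + 2 +
   match e with
   | Cst _ => 0
   | Get _ i => expr_charge i
   | Bin _ e1 e2 => expr_charge e1 + expr_charge e2
   end)%N.

Definition bounded (L : nat) (s : store) := forall a i, fits L (s a i).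

Lemma fits_eval L s e : bounded L s -> fits (expr_weight e * L.+1) (eval_expr s e).
Proof.
move=> bs; elim: e => [q|a i _|o e1 IH1 e2 IH2] /=.
- by apply: fitsW (fits_bits q); rewrite leq_pmulr.
- by apply: fitsW (bs _ _); rewrite mul1n.
- by rewrite mulnDl; apply: fits_binop.
Qed.

Lemma eval_cost_leq L s e : bounded L s -> (eval_cost s e <= expr_charge e * L.+1)%N.
Proof.
move=> bs.
have own e' : (rat_bits (eval_expr s e') <= (2 * expr_weight e' + 2) * L.+1)%N.
  by apply: leq_trans (rat_bits_leq (fits_eval e' bs)) _; nia.
elim: e => [q|a i IH|o e1 IH1 e2 IH2].
- by rewrite /eval_cost addn0 /expr_charge addn0; exact: own (Cst q).
- by rewrite -[expr_charge _]/(2 * 1 + 2 + expr_charge i)%N mulnDl;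
    apply: leq_add IH; exact: own (Get a i).
- rewrite -[expr_charge _]/(2 * expr_weight (Bin o e1 e2) + 2 +
    (expr_charge e1 + expr_charge e2))%N mulnDl.
  by apply: leq_add; [exact: own (Bin o e1 e2)|rewrite mulnDl leq_add].
Qed.

(** Bounds any single elementary step inside [c], in units of [L.+1]. It is a sum over the program
    text, so it does not depend on how often a loop runs. *)
Fixpoint cmd_charge (c : cmd) : nat :=
  match c with
  | Skip => 1
  | Assign _ i e => (expr_charge i + expr_charge e).+1
  | Seq c1 c2 => (cmd_charge c1 + cmd_charge c2).+1
  | If e c1 c2 => (expr_charge e + cmd_charge c1 + cmd_charge c2).+1
  | While e c => (expr_charge e + cmd_charge c).+1
  end%N.

Fixpoint writes (c : cmd) : seq nat :=
  match c with
  | Skip => [::]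
  | Assign a _ _ => [:: a]
  | Seq c1 c2 => writes c1 ++ writes c2
  | If _ c1 c2 => writes c1 ++ writes c2
  | While _ c => writes c
  end.

Fixpoint reads (e : expr) : seq nat :=
  match e with
  | Cst _ => [::]
  | Get a i => a :: reads i
  | Bin _ e1 e2 => reads e1 ++ reads e2
  end.

(** The frame condition: only the arrays in [X] may change. *)
Definition agree (X : seq nat) (s s' : store) := forall a, a \notin X -> s' a =1 s a.

Lemma agree_trans X s1 s2 s3 : agree X s1 s2 -> agree X s2 s3 -> agree X s1 s3.
Proof. by move=> h1 h2 a aX i; rewrite h2 ?h1. Qed.

Lemma agreeW X Y s s' : {subset X <= Y} -> agree X s s' -> agree Y s s'.
Proof. by move=> h H a aY; apply: H; apply: contra aY; apply: h. Qed.

Lemma agree_update X a i q s : a \in X -> agree X s (update s a i q).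
Proof.
by move=> aX b bX j; rewrite /update; case: eqP => // ba; rewrite ba aX in bX.
Qed.

Lemma eval_agree X s s' e : agree X s s' -> all (fun a => a \notin X) (reads e) ->
  eval_expr s' e = eval_expr s e.
Proof.
move=> ag; elim: e => [q|a i IH|o e1 IH1 e2 IH2] //=.
- by case/andP=> aX /IH->; rewrite ag.
- by rewrite all_cat => /andP[/IH1-> /IH2->].
Qed.

(* [m] bounds the number of elementary steps; each costs at most
   [cmd_charge c * L.+1] as long as all cells fit in [L] bits. *)
Definition runs (L : nat) (c : cmd) (m : nat) (s : store) (Q : store -> Prop) :=
  bounded L s -> exists s' t,
    [/\ exec c s s' t, (t <= m * (cmd_charge c * L.+1))%N, bounded L s',
        agree (writes c) s s' & Q s'].

Lemma runsW L c m m' s (Q Q' : store -> Prop) :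
  runs L c m s Q -> (m <= m')%N ->
  (forall s', agree (writes c) s s' -> bounded L s' -> Q s' -> Q' s') -> runs L c m' s Q'.
Proof.
move=> H mm' QQ' bs; have [s' [t [ex tm bs' ag q]]] := H bs.
exists s', t; split=> //; last exact: QQ'.
by apply: leq_trans tm _; rewrite leq_mul2r mm' orbT.
Qed.

Lemma runs_skip L s (Q : store -> Prop) : Q s -> runs L Skip 1 s Q.
Proof. by move=> q bs; exists s, 1%N; split=> //; exact: exec_skip. Qed.

Lemma runs_assign L s a i e (Q : store -> Prop) :
  fits L (eval_expr s e) ->
  Q (update s a (address (eval_expr s i)) (eval_expr s e)) ->
  runs L (Assign a i e) 1 s Q.
Proof.
move=> fe q bs; exists (update s a (address (eval_expr s i)) (eval_expr s e)).
exists (eval_cost s i + eval_cost s e).+1; split=> //.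
- exact: exec_assign.
- rewrite mul1n /= mulSn mulnDl -addn1 addnC.
  by apply: leq_add => //; apply: leq_add; exact: eval_cost_leq.
- by move=> b j; rewrite /update; case: ifP.
- by apply: agree_update; rewrite inE.
Qed.

Lemma runs_seq L c1 c2 m1 m2 s Q :
  runs L c1 m1 s (fun s1 => runs L c2 m2 s1 Q) -> runs L (Seq c1 c2) (m1 + m2 + 1) s Q.
Proof.
move=> H bs; have [s1 [t1 [ex1 tm1 bs1 ag1 q1]]] := H bs.
have [s2 [t2 [ex2 tm2 bs2 ag2 q2]]] := q1 bs1.
exists s2, (t1 + t2).+1; split=> //.
- exact: exec_seq ex1 ex2.
- rewrite /=; move: (cmd_charge c1) (cmd_charge c2) tm1 tm2 => x y.
  have : (m1 * (x * L.+1) <= m1 * ((x + y).+1 * L.+1))%N.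
    by rewrite leq_mul2l leq_mul2r; lia.
  have : (m2 * (y * L.+1) <= m2 * ((x + y).+1 * L.+1))%N.
    by rewrite leq_mul2l leq_mul2r; lia.
  have : (0 < (x + y).+1 * L.+1)%N by [].
  move: (_ * L.+1)%N => z; rewrite !mulnDl; lia.
- apply: (@agree_trans _ _ s1); [apply: agreeW ag1|apply: agreeW ag2] => a /=;
    by rewrite mem_cat => ->; rewrite ?orbT.
Qed.

Lemma runs_if L e c1 c2 m s Q :
  (0 < eval_expr s e -> runs L c1 m s Q) ->
  (eval_expr s e <= 0 -> runs L c2 m s Q) -> runs L (If e c1 c2) (m + 1) s Q.
Proof.
move=> H1 H2 bs; have ce := eval_cost_leq e bs.
have [s' [t [ex tm bs' ag q]]] : exists s' t,
    [/\ exec (if 0 < eval_expr s e then c1 else c2) s s' t,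
       (t <= m * ((cmd_charge c1 + cmd_charge c2) * L.+1))%N, bounded L s',
        agree (writes c1 ++ writes c2) s s' & Q s'].
  case: ltP => he; [have := H1 he bs|have := H2 he bs] => -[s' [t [ex tm bs' ag q]]];
    exists s', t; split=> //.
  - by apply: leq_trans tm _; rewrite leq_mul2l leq_mul2r leq_addr !orbT.
  - by apply: agreeW ag => a; rewrite mem_cat => ->.
  - by apply: leq_trans tm _; rewrite leq_mul2l leq_mul2r leq_addl !orbT.
  - by apply: agreeW ag => a; rewrite mem_cat => ->; rewrite orbT.
exists s', (eval_cost s e + t).+1; split=> //; first exact: exec_if.
by rewrite /=; move: tm ce; nia.
Qed.

Definition For (a : nat) (lim : expr) (body : cmd) : cmd :=
  Seq (Assign a (Cst 0) (Cst 0))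
    (While (Bin OpSub lim (Get a (Cst 0)))
       (Seq body (Assign a (Cst 0) (Bin OpAdd (Get a (Cst 0)) (Cst 1))))).

Lemma address_nat m : address m%:R = m.
Proof. by rewrite /address natrK. Qed.

Lemma address0 : address 0 = 0%N. Proof. exact: (address_nat 0). Qed.

(** The limit is evaluated again in every round, hence the condition on the arrays it reads.
    [N <= L] keeps the counter within [L] bits. The three extra steps per round pay for the guard
    and the increment. *)
Lemma runs_for L a lim body N m s (I : nat -> store -> Prop) :
  a \notin writes body -> all (fun b => b \notin a :: writes body) (reads lim) ->
  eval_expr s lim = N%:R -> (N <= L)%N ->
  I 0%N (update s a 0%N 0) ->
  (forall i s1, (i < N)%N -> agree (a :: writes body) s s1 -> s1 a 0%N = i%:R ->
     bounded L s1 -> I i s1 ->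
     runs L body m s1 (fun s2 => I i.+1 (update s2 a 0%N i.+1%:R))) ->
  runs L (For a lim body) (N * (m + 3) + 3) s (I N).
Proof.
move=> aw rl lN NL I0 IS.
set W := a :: writes body.
have -> : (N * (m + 3) + 3 = 1 + (N * (m + 3) + 1) + 1)%N by lia.
apply: runs_seq; apply: runs_assign; first exact: fits0.
rewrite [eval_expr s _]/= address0.
set wh := While _ _.
(* Induction on the number of rounds still to come, because [exec] unfolds a loop from its front. *)
suff main j : (j <= N)%N -> forall s1, agree W s s1 -> s1 a 0%N = (N - j)%:R -> I (N - j)%N s1 ->
    runs L wh (j * (m + 3) + 1) s1 (I N).
  apply: (main N) => //; rewrite ?subnn //; last by rewrite /update !eqxx.
  by apply: agree_update; rewrite inE eqxx.
elim: j => [|j IH] jN s1 ag sa Is bs.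
  exists s1, (eval_cost s1 (Bin OpSub lim (Get a (Cst 0)))).+1; split=> //.
  - apply: exec_while_stop; rewrite /= (eval_agree ag rl) lN address0 sa subn0.
    by rewrite subrr ltxx.
  - rewrite add0n mul1n [cmd_charge wh]/= mulSn.
    have := eval_cost_leq (Bin OpSub lim (Get a (Cst 0))) bs.
    by rewrite mulnDl; move: (eval_cost _ _) (expr_charge _ * L.+1)%N; lia.
  - by rewrite subn0 in Is.
have ij : (N - j.+1 < N)%N by lia.
have [s2 [t2 [ex2 tm2 bs2 ag2 I2]]] := IS _ s1 ij ag sa bs Is bs.
have s2a : s2 a 0%N = (N - j.+1)%:R by rewrite ag2.
have e2 : (N - j.+1)%:R + 1 = (N - j)%:R :> rat.
  by rewrite -(natrD _ _ 1); congr (_%:R); lia.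
have s3E : update s2 a (address (eval_expr s2 (Cst 0)))
     (eval_expr s2 (Bin OpAdd (Get a (Cst 0)) (Cst 1))) = update s2 a 0%N (N - j)%:R.
  by rewrite /= address0 s2a e2.
have ij' : ((N - j.+1).+1 = N - j)%N by lia.
rewrite ij' in I2.
have ag12 : agree W s1 s2 by apply: agreeW ag2 => b; rewrite inE => ->; rewrite orbT.
have ag3 : agree W s (update s2 a 0%N (N - j)%:R).
  apply: agree_trans ag _; apply: agree_trans ag12 _.
  by apply: agree_update; rewrite inE eqxx.
have bs3 : bounded L (update s2 a 0%N (N - j)%:R).
  move=> b i; rewrite /update; case: ifP => // _; apply: fits_natS; lia.
have [s4 [t4 [ex4 tm4 bs4 ag4 I4]]] := IH (ltnW jN) _ ag3
  (ltac:(by rewrite /update !eqxx)) I2 bs3.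
have exinc := exec_assign s2 a (Cst 0) (Bin OpAdd (Get a (Cst 0)) (Cst 1)).
rewrite s3E in exinc.
exists s4; eexists; split; last by [].
- apply: exec_while_step (exec_seq ex2 exinc) ex4.
  rewrite /= (eval_agree ag rl) lN address0 sa subr_gt0 ltr_nat; lia.
- have chE : cmd_charge wh = (expr_charge (Bin OpSub lim (Get a (Cst 0))) + (cmd_charge body +
    (expr_charge (Cst 0) + expr_charge (Bin OpAdd (Get a (Cst 0)) (Cst 1))).+1).+1).+1 by [].
  have := eval_cost_leq (Bin OpSub lim (Get a (Cst 0))) bs.
  have := eval_cost_leq (Cst 0) bs2.
  have := eval_cost_leq (Bin OpAdd (Get a (Cst 0)) (Cst 1)) bs2.
  move: tm2 tm4; rewrite chE; move: (cmd_charge body).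
  move: (expr_charge (Bin OpSub _ _)) (expr_charge (Bin OpAdd _ _)) (expr_charge (Cst 0)).
  move: (eval_cost s1 _) (eval_cost s2 (Bin _ _ _)) (eval_cost s2 (Cst 0)) => x1 x2 x3 y1 y2 y3 y4.
  set Z := ((y1 + _).+1 * L.+1)%N => h2 h4 e1' e3' e5'.
  have yZ : (m * (y4 * L.+1) <= m * Z)%N by rewrite leq_mul2l leq_mul2r; lia.
  have : (y1 * L.+1 + y2 * L.+1 + y3 * L.+1 + 3 <= 3 * Z)%N by rewrite /Z; nia.
  have -> : ((j.+1 * (m + 3) + 1) * Z = (j * (m + 3) + 1) * Z + m * Z + 3 * Z)%N.
    by clearbody Z; nia.
  by clearbody Z; move: ((_ + 1) * Z)%N h4 => z; lia.
- exact: bs4.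
- apply: agree_trans ag4; apply: (@agree_trans _ _ s2).
    by apply: agreeW ag2 => b /=; rewrite mem_cat => ->.
  by apply: agree_update; rewrite /= mem_cat inE eqxx orbT.
Qed.

Lemma polynomial_bound (A D : nat) :
  exists d, forall m, (A * m.+1 ^ D <= poly_time d m)%N.
Proof.
(* For [m = 0] and [m = 1] the additive constant must do: it exceeds [A] and [A * 2 ^ D]. For
   [m >= 2], [A <= m ^ A] and [m + 1 <= m ^ 2]. *)
exists (A * 2 ^ D + A + 2 * D)%N => -[|[|m]]; rewrite /poly_time.
- by rewrite exp1n muln1; lia.
- by rewrite exp1n; lia.
- apply: leq_trans (leq_addr _ _); rewrite 2!expnD.
  apply: leq_mul; last by case: D => // D; rewrite expnM leq_exp2r // -mulnn; nia.
  apply: leq_trans (_ : m.+2 ^ A <= _)%N; last by rewrite leq_pmull // expn_gt0.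
  exact: ltnW (ltn_expl A _).
Qed.

(** * The label distribution *)

(* A symmetric distribution on [{0, ..., 79}], given by multiplicities out of
   256; it was found numerically, by minimizing the constant in
   [label_pair_count]. *)
Definition label_weights : seq nat :=
  let h := [:: 18; 12; 10; 8; 4; 5; 3; 2; 2; 0; 3; 1; 1; 2; 2; 0; 3; 2; 2; 1; 2; 2; 2; 3; 0;
    3; 2; 2; 3; 3; 1; 3; 2; 1; 4; 3; 3; 2; 2; 4]%N in h ++ rev h.

Definition label_table : seq nat :=
  flatten [seq nseq (nth 0 label_weights j) j | j <- iota 0 80]%N.

Definition label (i : nat) : nat := nth 0%N label_table i.

Lemma size_label_table : size label_table = 256%N.
Proof. by vm_compute. Qed.

Lemma label_lt i : (label i < 80)%N.
Proof.
have [it|it] := ltnP i (size label_table); last by rewrite /label nth_default.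
have : all (fun l => l < 80)%N label_table by vm_compute.
by move/all_nthP; apply.
Qed.

Lemma label_table_lt l : l \in label_table -> (l < 80)%N.
Proof. by case/(nthP 0%N) => i _ <-; exact: label_lt. Qed.

Lemma sum_label_table (V : nmodType) (g : nat -> V) :
  \sum_(l <- label_table) g l = \sum_(j <- iota 0 80) g j *+ nth 0%N label_weights j.
Proof.
rewrite /label_table big_flatten big_map; apply: eq_bigr => j _.
by elim: (nth _ _ _) => [|m IH]; rewrite ?big_nil // big_cons IH mulrS.
Qed.

Definition label_cumN : seq N :=
  Eval vm_compute in [seq N.of_nat (sumn (take t label_weights)) | t <- iota 0 80].

(** The double sum of [label_pair_count] grouped by the first label [i], which is paired with the
    labels below [d + i - 79]. Binary numbers keep the evaluation fast; the default 256 is the total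
    weight, correct for thresholds beyond the table. *)
Definition label_pairsN (d : nat) : N :=
  foldr (fun i acc => N.add (N.mul (N.of_nat (nth 0%N label_weights i))
    (nth 256%num label_cumN (d + i - 79))) acc) N0 (iota 0 80).

(** Labels differ by at most 79, so that at [d = 159] all pairs count: larger [d] would add
    nothing. *)
Lemma label_pairsNP : all (fun d => N.leb (N.mul 5%num (label_pairsN d))
    (N.mul 2246%num (N.of_nat d))) (iota 0 160).
Proof. by vm_compute. Qed.

Lemma N_of_natK m : nat_of_bin (N.of_nat m) = m.
Proof. by lia. Qed.

Lemma sum_weights_below t :
  (\sum_(j <- iota 0 80) (j < t) * nth 0 label_weights j)%N = sumn (take t label_weights).
Proof.
have -> : iota 0 80 = iota 0 (size label_weights) by [].
elim/last_ind: label_weights => [|w a IH] in t *; first by rewrite big_nil.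
rewrite size_rcons -addn1 iotaD add0n big_cat big_seq1 /= nth_rcons ltnn eqxx.
rewrite (eq_big_seq (fun j => (j < t) * nth 0 w j)%N); last first.
  by move=> j; rewrite mem_iota add0n nth_rcons => /andP[_ ->].
rewrite IH -cats1 take_cat; case: ltnP => h.
  rewrite ltnNge (ltnW h) (take_oversize (ltnW h)) sumn_cat.
  by case: (t - size w)%N (subn_gt0 (size w) t) => [|r]; rewrite h //= addn0 mul1n.
have -> : (t - size w = 0)%N by lia.
by rewrite addn0; case: ltnP => // h'; rewrite cats0 take_oversize.
Qed.

Lemma label_cumNE t : nat_of_bin (nth 256%num label_cumN t) = sumn (take t label_weights).
Proof.
have [tl|tl] := ltnP t 80; last first.
  by rewrite nth_default // take_oversize //; vm_compute.
have -> : label_cumN = [seq N.of_nat (sumn (take t label_weights)) | t <- iota 0 80].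
  by vm_compute.
by rewrite (nth_map 0%N) ?size_iota // nth_iota // add0n N_of_natK.
Qed.

(** Everything that is needed of the distribution. Divided by the 256 * 256 pairs, the bound is
    (2246 * 80 / (5 * 65536)) (d / 80) = (1123 / 2048) (d / 80), which is where 1123/2048 comes
    from. *)
Lemma label_pair_count d : (d < 160)%N ->
  (5 * \sum_(a <- label_table) \sum_(b <- label_table) (80 + b <= d + a)
     <= 2246 * d)%N.
Proof.
move=> d160; have /allP/(_ d) := label_pairsNP.
rewrite mem_iota => /(_ d160) /N.leb_le h.
have addE x y : nat_of_bin (N.add x y) = (nat_of_bin x + nat_of_bin y)%N by lia.
have mulE x y : nat_of_bin (N.mul x y) = (nat_of_bin x * nat_of_bin y)%N by lia.
have -> : (\sum_(a <- label_table) \sum_(b <- label_table) (80 + b <= d + a))%N =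
    nat_of_bin (label_pairsN d).
  transitivity (\sum_(a <- iota 0 80) sumn (take (d + a - 79) label_weights) *
     nth 0 label_weights a)%N.
    rewrite (@sum_label_table nat); apply: eq_bigr => a _.
    rewrite -sum_weights_below (@sum_label_table nat).
    have nE (c m : nat) : c *+ m = (c * m)%N.
      by elim: m => [|m IH]; rewrite ?muln0 // mulrS IH mulnS.
    rewrite nE; congr (_ * _)%N; apply: eq_bigr => b _; rewrite nE.
    have -> : (80 + b <= d + a)%N = (b < d + a - 79)%N by lia.
    by [].
  rewrite /label_pairsN; elim: (iota 0 80) => [|a s IH]; first by rewrite big_nil.
  by rewrite big_cons /= addE mulE -IH label_cumNE N_of_natK mulnC.
have : (nat_of_bin (5 * label_pairsN d)%num <= nat_of_bin (2246 * N.of_nat d)%num)%N.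
  by move: h; lia.
by rewrite !mulE N_of_natK.
Qed.

Opaque label_table.

(** * Pairs of independent labels from random bits *)

Definition bits_val (s : seq bool) : nat := foldl (fun acc (b : bool) => 2 * acc + b)%N 0%N s.

Lemma bits_val_rcons s b : bits_val (rcons s b) = (2 * bits_val s + b)%N.
Proof. by rewrite /bits_val -cats1 foldl_cat. Qed.

Lemma bits_val_lt s : (bits_val s < 2 ^ size s)%N.
Proof.
elim/last_ind: s => // s b IH; rewrite bits_val_rcons size_rcons expnS.
by case: b; lia.
Qed.

Lemma bits_val_inj s1 s2 : size s1 = size s2 -> bits_val s1 = bits_val s2 -> s1 = s2.
Proof.
elim/last_ind: s1 s2 => [|s1 b1 IH] s2; first by case: s2.
case/lastP: s2 => [|s2 b2]; rewrite ?size_rcons // => -[ss].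
rewrite !bits_val_rcons => e.
have eb : b1 = b2 by case: b1 b2 e => -[]; lia.
by rewrite eb (IH s2) //; move: e; rewrite eb; lia.
Qed.

Lemma sum_bits_val (V : nmodType) j (g : nat -> V) :
  \sum_(a : j.-tuple bool) g (bits_val a) = \sum_(i < 2 ^ j) g i.
Proof.
pose h (a : j.-tuple bool) : 'I_(2 ^ j) :=
  Ordinal (ltac:(by have := bits_val_lt a; rewrite size_tuple) : (bits_val a < 2 ^ j)%N).
have hI : injective h.
  move=> a b /(congr1 val) /= e; apply: val_inj; apply: bits_val_inj e.
  by rewrite !size_tuple.
have hB : bijective h by apply: inj_card_bij hI _; rewrite card_tuple card_bool card_ord.
by rewrite (reindex h) //; apply: onW_bij.
Qed.

Section Bytes.
Variable T : nat.
Implicit Types (w : T.-tuple bool) (a b : 8.-tuple bool) (u v : nat).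

Definition byte w v : 8.-tuple bool := [tuple nth false w (8 * v + i) | i < 8].

Definition xor_tuple j (a b : j.-tuple bool) : j.-tuple bool :=
  [tuple tnth a i (+) tnth b i | i < j].

Lemma xor_tupleK j (a : j.-tuple bool) : involutive (xor_tuple a).
Proof. by move=> b; apply: eq_from_tnth => i; rewrite !tnth_mktuple addKb. Qed.

(** The string with bytes [a] and [b] at positions [u] and [v] and zeros elsewhere. Xoring with it
    permutes the random strings and shifts exactly these two bytes. *)
Definition byte_mask u v a b : T.-tuple bool :=
  [tuple if (i %/ 8 == u)%N then nth false a (i %% 8)
         else (i %/ 8 == v)%N && nth false b (i %% 8) | i < T].

Lemma byte_xor w m v : (8 * v.+1 <= T)%N ->
  byte (xor_tuple m w) v = xor_tuple (byte m v) (byte w v).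
Proof.
move=> vT; apply: eq_from_tnth => i; rewrite !tnth_mktuple.
have iT : (8 * v + i < T)%N by have := ltn_ord i; lia.
rewrite -[(8 * v + i)%N]/(nat_of_ord (Ordinal iT)) -!tnth_nth.
by rewrite !tnth_mktuple.
Qed.

Lemma byte_mask_l u v a b : (8 * u.+1 <= T)%N -> byte (byte_mask u v a b) u = a.
Proof.
move=> uT; apply: eq_from_tnth => i; rewrite tnth_mktuple.
have i8 := ltn_ord i; have iT : (8 * u + i < T)%N by lia.
rewrite -[(8 * u + i)%N]/(nat_of_ord (Ordinal iT)) -tnth_nth tnth_mktuple /=.
have -> : ((8 * u + i) %/ 8 = u)%N by lia.
have -> : ((8 * u + i) %% 8 = i)%N by lia.
by rewrite eqxx -tnth_nth.
Qed.

Lemma byte_mask_r u v a b : u != v -> (8 * v.+1 <= T)%N ->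
  byte (byte_mask u v a b) v = b.
Proof.
move=> uv vT; apply: eq_from_tnth => i; rewrite tnth_mktuple.
have i8 := ltn_ord i; have iT : (8 * v + i < T)%N by lia.
rewrite -[(8 * v + i)%N]/(nat_of_ord (Ordinal iT)) -tnth_nth tnth_mktuple /=.
have -> : ((8 * v + i) %/ 8 = v)%N by lia.
have -> : ((8 * v + i) %% 8 = i)%N by lia.
by rewrite eqxx eq_sym (negPf uv) -tnth_nth.
Qed.

(* Averaging over all masks at the positions of the two bytes makes the pair of
   bytes uniform without changing the sum over [w]. *)
Lemma sum_two_bytes (V : nmodType) (f : 8.-tuple bool -> 8.-tuple bool -> V) u v :
  u != v -> (8 * u.+1 <= T)%N -> (8 * v.+1 <= T)%N ->
  (\sum_w f (byte w u) (byte w v)) *+ #|{: 8.-tuple bool}| *+ #|{: 8.-tuple bool}| =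
  (\sum_a \sum_b f a b) *+ #|{: T.-tuple bool}|.
Proof.
move=> uv uT vT; rewrite -!sumr_const.
transitivity (\sum_a \sum_b \sum_w f (xor_tuple (byte w u) a) (xor_tuple (byte w v) b)).
  apply: eq_bigr => a _; apply: eq_bigr => b _.
  rewrite (reindex_inj (inv_inj (xor_tupleK (byte_mask u v a b)))).
  apply: eq_bigr => w _; rewrite !byte_xor // byte_mask_l // byte_mask_r //.
  have xorC j (c d : j.-tuple bool) : xor_tuple c d = xor_tuple d c.
    by apply: eq_from_tnth => i; rewrite !tnth_mktuple addbC.
  by rewrite (xorC _ a) (xorC _ b).
under eq_bigr => a _ do rewrite exchange_big.
rewrite exchange_big; apply: eq_bigr => w _.
rewrite [RHS](reindex_inj (inv_inj (xor_tupleK (byte w u)))); apply: eq_bigr => a _.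
by rewrite [RHS](reindex_inj (inv_inj (xor_tupleK (byte w v)))).
Qed.

Definition rand_label w v : nat := label (bits_val (byte w v)).

(** Pairwise independence of the labels, written without division. No independence of three or more
    labels is ever used. *)
Lemma sum_two_labels (V : nmodType) (f : nat -> nat -> V) u v :
  u != v -> (8 * u.+1 <= T)%N -> (8 * v.+1 <= T)%N ->
  (\sum_w f (rand_label w u) (rand_label w v)) *+ 2 ^ (8 + 8) =
  (\sum_(a <- label_table) \sum_(b <- label_table) f a b) *+ 2 ^ T.
Proof.
move=> uv uT vT.
have := sum_two_bytes (fun a b => f (label (bits_val a)) (label (bits_val b))) uv uT vT.
rewrite !card_tuple card_bool -mulrnA -expnD => ->; congr (_ *+ _).
have tabE (g : nat -> V) : \sum_(l <- label_table) g l = \sum_(i < 2 ^ 8) g (label i).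
  by rewrite (big_nth 0%N) size_label_table big_mkord.
rewrite tabE -(sum_bits_val 8 (fun i => \sum_(b <- label_table) f (label i) b)).
by apply: eq_bigr => a _; rewrite tabE -(sum_bits_val 8 (fun i => f _ (label i))).
Qed.

(** The labels enter only through the integer [80 + b - a], which lies between 1 and 159. So
    [80 * z] may be replaced by the largest integer [d < 160] strictly below it, and the finite
    count applies to [d]. *)
Lemma cut_probability (F : realFieldType) (z : F) u v : 0 <= z ->
  u != v -> (8 * u.+1 <= T)%N -> (8 * v.+1 <= T)%N ->
  \sum_w ((80 + rand_label w v)%:R < 80 * z + (rand_label w u)%:R :> F)%:R
    <= 1123 / 2048 * z * 2 ^+ T.
Proof.
move=> z0 uv uT vT.
have := sum_two_labels (fun a b : nat => ((80 + b)%:R < 80 * z + a%:R :> F)%:R : F) uv uT vT.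
set S := (\sum_w _) => SE.
suff : 5 * \sum_(a <- label_table) \sum_(b <- label_table)
      (((80 + b)%:R < 80 * z + a%:R :> F)%:R : F) <= 2246 * (80 * z).
  have : (0 : F) < 2 ^+ T by rewrite exprn_gt0.
  move: SE; rewrite -[S *+ _]mulr_natr -[RHS]mulr_natr !natrX.
  have -> : (2 : F) ^+ (8 + 8) = 256 * 256 by rewrite exprD; ring.
  move: (2 ^+ T) (\sum_(a <- _) _) => P X SE P0 hX.
  have {}SE : S = X * P / (256 * 256) by rewrite -SE; field.
  have : X * P <= 2246 * (80 * z) / 5 * P by apply: ler_wpM2r; [exact: ltW|lra].
  rewrite SE => hP; apply: le_trans (_ : 2246 * (80 * z) / 5 * P / (256 * 256) <= _).
    by rewrite ler_pM2r // invr_gt0 mulr_gt0.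
  by rewrite (_ : _ / (256 * 256) = 1123 / 2048 * z * P) //; field.
(* Without such a [d], that is for [z = 0], no pair of labels leads to a cut: [80 + b - a] would
   itself be one. *)
have [ex|/forallNP nex] := pselect (exists d, (d < 160)%N && (d%:R < 80 * z)); last first.
  rewrite [X in 5 * X](_ : _ = 0).
    by rewrite mulr0; apply: mulr_ge0; [exact: ler0n|apply: mulr_ge0 z0; exact: ler0n].
  apply: big1_seq => a /andP[_ aT]; apply: big1_seq => b /andP[_ bT].
  case: ltP => // h; have := nex (80 + b - a)%N; case; apply/andP.
  have la : (a < 80)%N by exact: label_table_lt.
  have lb : (b < 80)%N by exact: label_table_lt.
  by split; [lia|rewrite natrB ?ltrBlDr //; lia].
have ub d : (d < 160)%N && (d%:R < 80 * z) -> (d <= 159)%N by case/andP; lia.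
case: (ex_maxnP ex ub) => d /andP[d160 dz] dmax.
have := label_pair_count d160.
rewrite -(ler_nat F) !natrM => hd.
apply: le_trans (_ : 2246 * d%:R <= _); last first.
  by apply: ler_wpM2l; [exact: ler0n|exact: ltW].
apply: le_trans hd; apply: ler_wpM2l; first exact: ler0n.
rewrite natr_sum big_seq [leRHS]big_seq; apply: ler_sum => a aT.
rewrite natr_sum big_seq [leRHS]big_seq; apply: ler_sum => b bT.
case: ltP => // h; rewrite (_ : (80 + b <= d + a)%N = true) //.
have la : (a < 80)%N by exact: label_table_lt.
have lb : (b < 80)%N by exact: label_table_lt.
have : (80 + b - a <= d)%N.
  by apply: dmax; apply/andP; split; [lia|rewrite natrB ?ltrBlDr //; lia].
lia.
Qed.

End Bytes.

(** * Rounding a feasible LP solution *)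

(** The labels at the two ends of an arc are independent only if the ends differ; acyclicity
    excludes loops. *)
Lemma arc_neq (F : realFieldType) (G : dag F) u v : (u, v) \in arcs G -> u != v.
Proof.
move=> uv; apply/eqP => e; move: uv; rewrite -e => uu.
by have := @arcs_acyclic _ G [:: u]; rewrite /= /adj /= uu => /(_ isT).
Qed.

Lemma set_cost_ge0 (F : realFieldType) (G : dag F) (S : {set edge (nverts G)}) :
  S \subset arcs G -> 0 <= set_cost S.
Proof. by move=> /fintype.subsetP sub; apply: sumr_ge0 => e /sub; exact: cost_ge0. Qed.

Lemma lp_cost_ge0 (F : realFieldType) (G : dag F) k (x : edge (nverts G) -> F) :
  lp_feasible k x -> 0 <= lp_cost x.
Proof.
by case=> _ x0; apply: sumr_ge0 => e eA; apply: mulr_ge0; [exact: cost_ge0|exact: x0].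
Qed.

Section Rounding.
Variables (F : realFieldType) (G : dag F) (k T : nat) (x : edge (nverts G) -> F).
Hypothesis x_feasible : lp_feasible k x.

(** The cutting rule with labels measured in units of 1/80. *)
Definition cut_set (w : T.-tuple bool) : {set edge (nverts G)} :=
  [set e in arcs G | (80 + rand_label w e.2)%:R
     < 80 * (k.+1%:R * x e) + (rand_label w e.1)%:R :> F].

(* On an uncut path, [(k+1) x_e] is at most 1 plus the increase of the label along
   [e]; the total increase is less than 1. *)
Lemma cut_set_solution w : ded_solution k (cut_set w).
Proof.
apply/andP; split; first by apply/fintype.subsetP => e; rewrite inE => /andP[].
apply/forallP => v; apply/forallP => p; apply/negP => /andP[pp up].
have key v' p' : path (adj (arcs G :\: cut_set w)) v' p' ->
    80 * (k.+1%:R * \sum_(e <- path_edges v' p') x e) + (rand_label w v')%:R <=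
    80 * (size p')%:R + (rand_label w (last v' p'))%:R.
  elim: p' v' => [|u p' IH] v'; first by rewrite /path_edges big_nil !mulr0 !add0r lexx.
  rewrite [path _ _ _]/= => /andP[vu /IH].
  rewrite -[path_edges v' _]/((v', u) :: path_edges u p') big_cons [last _ _]/=.
  move: vu; rewrite /adj /= !inE => /andP[nc vA]; move: nc.
  rewrite vA /= -leNgt natrD => h1.
  by rewrite -[(size p').+1%:R]natr1 !mulrDr; move: h1; lra.
have pA : dipath (arcs G) v p.
  rewrite /dipath up andbT; apply: sub_path pp => a b.
  by rewrite /adj /= !inE => /andP[].
have [/(_ v p (size_tuple p) pA) f1 _] := x_feasible.
(* Since labels lie between 0 and 79 and the path has length at least 1, this would give 80 (k + 1)
   <= 80 k + 79. *)
have := key _ _ pp; rewrite size_tuple.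
have : (rand_label w (last v p))%:R <= 79 :> F by rewrite ler_nat -ltnS label_lt.
have : 0 <= (rand_label w v)%:R :> F by exact: ler0n.
have : k.+1%:R <= k.+1%:R * \sum_(e <- path_edges v p) x e.
  by rewrite ler_peMr // ler0n.
have : k.+1%:R = k%:R + 1 :> F by rewrite natr1.
by lra.
Qed.

(** Linearity of expectation over the arcs; the hypothesis on [T] provides a byte for each
    vertex. *)
Lemma expected_cut_cost : (8 * nverts G <= T)%N ->
  \sum_w set_cost (cut_set w) <= 1123 / 2048 * k.+1%:R * lp_cost x * 2 ^+ T.
Proof.
move=> nT.
have costE w : set_cost (cut_set w) = \sum_(e in arcs G) cost e *
   ((80 + rand_label w e.2)%:R < 80 * (k.+1%:R * x e) + (rand_label w e.1)%:R :> F)%:R.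
  rewrite /set_cost big_mkcond [RHS]big_mkcond /=; apply: eq_bigr => e _.
  by rewrite inE; case: (e \in arcs G) => //=; case: ltP; rewrite ?mulr1 ?mulr0.
under eq_bigr => w _ do rewrite costE.
rewrite exchange_big /= /lp_cost mulr_sumr mulr_suml; apply: ler_sum => -[u v] eA.
rewrite -mulr_sumr.
apply: le_trans (_ : cost (u, v) * (1123 / 2048 * (k.+1%:R * x (u, v)) * 2 ^+ T) <= _).
  apply: ler_wpM2l; first exact: cost_ge0.
  apply: cut_probability.
  - by apply: mulr_ge0; [exact: ler0n|have [_] := x_feasible; apply].
  - exact: arc_neq eA.
  - by apply: leq_trans nT; rewrite leq_mul2l /=.
  - by apply: leq_trans nT; rewrite leq_mul2l /=.
by rewrite le_eqVlt; apply/orP; left; apply/eqP; ring.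
Qed.

(** For a given [x] the gap between 1123/2048 and 0.549 is simply given away; the combined algorithm
    spends it on solving the LP inexactly. *)
Lemma ratio_slack : 1123 / 2048 * k.+1%:R * lp_cost x <= approx_ratio F k * lp_cost x.
Proof.
apply: ler_wpM2r; first exact: lp_cost_ge0 x_feasible.
by apply: ler_wpM2r; [exact: ler0n|lra].
Qed.

End Rounding.

(** The distribution is the image of the uniform one on [8 * nverts G] bits under [cut_set]. No
    computability is involved, so that any ordered field will do, the reals in particular. *)
Lemma rounding_distribution (F : realFieldType) (G : dag F) k (x : edge (nverts G) -> F) :
  lp_feasible k x ->
  exists mu : {set edge (nverts G)} -> F,
    [/\ is_distr mu, forall S, mu S != 0 -> ded_solution k S
      & \sum_S mu S * set_cost S <= approx_ratio F k * lp_cost x].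
Proof.
move=> xf; set T := (8 * nverts G)%N.
have P0 : 0 < 2 ^+ T :> F by rewrite exprn_gt0.
have muE (g : {set edge (nverts G)} -> F) :
    \sum_S (\sum_(w : T.-tuple bool) (cut_set k x w == S)%:R) / 2 ^+ T * g S =
    (\sum_(w : T.-tuple bool) g (cut_set k x w)) / 2 ^+ T.
  rewrite mulr_suml; under eq_bigr => S _ do rewrite mulrAC mulr_suml mulr_suml.
  rewrite exchange_big; apply: eq_bigr => w _; rewrite -mulr_suml; congr (_ / _).
  rewrite (bigD1 (cut_set k x w)) //= eqxx mul1r big1 ?addr0 // => S /negPf.
  by rewrite eq_sym => ->; rewrite mul0r.
exists (fun S => (\sum_(w : T.-tuple bool) (cut_set k x w == S)%:R) / 2 ^+ T); split.
- split=> [S|]; first by apply: divr_ge0; [apply: sumr_ge0 => w _; exact: ler0n|exact: ltW].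
  have := muE (fun=> 1); under eq_bigr => S _ do rewrite mulr1.
  move=> ->; rewrite sumr_const card_tuple card_bool natrX divff //.
- move=> S; rewrite mulf_eq0 negb_or => /andP[nz _]; apply/negPn/negP => nS.
  move/negP: nz; apply; rewrite big1 // => w _.
  by case: eqP => // e; move: nS; rewrite -e cut_set_solution.
- rewrite muE ler_pdivrMr //; apply: le_trans (expected_cut_cost xf (leqnn _)) _.
  by apply: ler_wpM2r; [exact: ltW|exact: ratio_slack].
Qed.

(** * The two optima and the integrality gap *)

Lemma ded_opt_le (F : realFieldType) (G : dag F) k (S : {set edge (nverts G)}) :
  ded_solution k S -> ded_opt G k <= set_cost S.
Proof. by move=> sS; rewrite /ded_opt (bigD1 S) //= ge_min lexx. Qed.

Lemma arcs_solution (F : realFieldType) (G : dag F) k : (0 < k)%N ->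
  ded_solution k (arcs G).
Proof.
move=> k0; rewrite /ded_solution subxx; apply/forallP => v; apply/forallP => p.
apply/negP => /andP[]; rewrite finset.setDv.
case: k k0 p => // k _ [[|u p] //= _] /andP[].
by rewrite /adj /= inE.
Qed.

Lemma ded_opt_attained (F : realFieldType) (G : dag F) k : (0 < k)%N ->
  exists2 S : {set edge (nverts G)}, ded_solution k S & ded_opt G k = set_cost S.
Proof.
move=> k0; rewrite /ded_opt.
elim/big_ind: _ => [|a b [S s1 ->] [S' s2 ->]|S sS]; last by exists S.
  by exists (arcs G) => //; exact: arcs_solution.
by rewrite /Num.min; case: ifP => _; [exists S|exists S'].
Qed.

Lemma ded_opt_ge0 (F : realFieldType) (G : dag F) k : (0 < k)%N -> 0 <= ded_opt G k.
Proof.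
by move=> /(@ded_opt_attained _ G)[S /andP[sub _] ->]; exact: set_cost_ge0.
Qed.

(** Makes the set of LP costs non-empty, so that a lower bound of this set is also one of its
    infimum. *)
Lemma lp_feasible1 (F : realFieldType) (G : dag F) k : (0 < k)%N ->
  lp_feasible (G := G) k (fun=> 1).
Proof.
move=> k0; split=> [v p sp _|e _]; last exact: ler01.
by move: k0; rewrite -sp; case: p sp => // u p _ _; rewrite big_cons lerDl sumr_ge0.
Qed.

Lemma integrality_gap_le (R : realType) k : (0 < k)%N ->
  (integrality_gap R k <= (approx_ratio R k)%:E)%E.
Proof.
move=> k0; apply: ge_ereal_sup => _ [G _ <-].
(* Needed for the instances whose two optima vanish, which count as ratio 1; it holds because 0.549
   * 2 > 1. *)
have ratio1 : 1 <= approx_ratio R k.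
  have : 2 <= k.+1%:R :> R by rewrite ler_nat.
  by rewrite /approx_ratio; lra.
have r0 : 0 < approx_ratio R k by apply: lt_le_trans ratio1.
(* The cheapest solution costs at most the average over a distribution of solutions. Comparing with
   every feasible [x] separately avoids showing that the LP optimum is attained. *)
have le_x x : lp_feasible (G := G) k x -> ded_opt G k / approx_ratio R k <= lp_cost x.
  move=> xf; rewrite ler_pdivrMr // mulrC.
  have [mu [[mu0 mu1] sol cst]] := rounding_distribution xf.
  apply: le_trans cst; rewrite -[ded_opt G k]mul1r -mu1 mulr_suml; apply: ler_sum => S _.
  have [->|/sol sS] := eqVneq (mu S) 0; first by rewrite !mul0r.
  by apply: ler_wpM2l => //; exact: ded_opt_le.
have le_lp : ded_opt G k / approx_ratio R k <= lp_opt G k.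
  apply: lb_le_inf; first by exists (lp_cost (G := G) (fun=> 1)); exists (fun=> 1) => //; exact: lp_feasible1.
  by move=> _ [x xf <-]; exact: le_x.
have o0 := @ded_opt_ge0 R G k k0.
rewrite /gap_ratio; case: eqP => [l0|/eqP l0].
  move: le_lp; rewrite l0 ler_pdivrMr // mul0r => o1.
  by rewrite (_ : ded_opt G k == 0) ?lee_fin // eq_le o1 o0.
have lp0 : 0 < lp_opt G k.
  by rewrite lt_neqAle eq_sym l0 /=; apply: le_trans le_lp; apply: divr_ge0 => //; exact: ltW.
by rewrite lee_fin ler_pdivrMr // mulrC -ler_pdivrMr.
Qed.

(** * The rounding program *)

(** A scalar variable is cell 0 of an array of its own. Arrays 0 to 4 are input and 5 is output; 6
    holds the label table, 7 the labels of the vertices, 8 the byte being read, and 20 and 21 are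
    loop counters. *)
Definition Var a := Get a (Cst 0).
Definition SetVar a e := Assign a (Cst 0) e.
Definition EAdd := Bin OpAdd.
Definition ESub := Bin OpSub.
Definition EMul := Bin OpMul.
Definition EDiv := Bin OpDiv.
Definition Nv := Get 0 (Cst 0).
Definition Kv := Get 0 (Cst 1).
Definition Idx e1 e2 := EAdd (EMul e1 Nv) e2.

Lemma address1 : address 1 = 1%N. Proof. exact: (address_nat 1). Qed.

Lemma updateE s a i q : update s a i q a i = q.
Proof. by rewrite /update !eqxx. Qed.

Lemma update_neq s a i q b j : (b != a) || (j != i) -> update s a i q b j = s b j.
Proof. by rewrite /update -negb_and => /negbTE ->. Qed.

Lemma eq_flat n u v u' v' : (v < n)%N -> (v' < n)%N ->
  (u * n + v == u' * n + v')%N = (u == u') && (v == v').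
Proof.
move=> vn vn'; apply/eqP/andP => [e|[/eqP -> /eqP ->] //].
have n0 : (0 < n)%N by lia.
have := congr1 (divn^~ n) e; rewrite !divnMDl // !divn_small // !addn0 => eu.
by rewrite eu eqxx; split=> //; move: e; rewrite eu => /addnI ->.
Qed.

Lemma runs_le L c m m' s Q : runs L c m s Q -> (m <= m')%N -> runs L c m' s Q.
Proof. by move=> H mm'; apply: runsW H mm' _. Qed.

(** Unrolled into one assignment per entry: the table belongs to the program text. *)
Definition fill_table (l : seq nat) : cmd :=
  foldr (fun i c => Seq (Assign 6 (Cst i%:R) (Cst (label i)%:R)) c) Skip l.

Lemma writes_fill_table l : {subset writes (fill_table l) <= [:: 6%N]}.
Proof. by elim: l => // i l IH b; rewrite /= inE => /orP[/eqP ->|/IH]. Qed.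

Lemma runs_fill_table L l s : (7 <= L)%N ->
  runs L (fill_table l) (2 * size l + 1) s
    (fun s' => forall i, s' 6 i = if i \in l then (label i)%:R else s 6 i).
Proof.
move=> L7; elim: l s => [|i l IH] s; first exact: runs_skip.
have -> : (2 * size (i :: l) + 1 = 1 + (2 * size l + 1) + 1)%N by rewrite /=; lia.
apply: runs_seq; apply: runs_assign.
  apply: fits_nat; apply: leq_trans (label_lt i) _.
  by apply: leq_trans (_ : 2 ^ 7 <= _)%N; rewrite // leq_exp2l.
apply: runsW (IH _) (leqnn _) _ => s' _ _ h j.
rewrite h [eval_expr s _]/= [X in update _ _ _ X]/= address_nat inE.
case: eqP => [->|/eqP ji]; first by rewrite updateE /=; case: ifP => _; reflexivity.
by rewrite [_ || _]/=; case: ifP => _ //; rewrite update_neq // ji.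
Qed.

Definition draw_labels : cmd :=
  For 20 Nv (Seq (SetVar 8 (Cst 0)) (Seq
    (For 21 (Cst 8%:R) (SetVar 8 (EAdd (EMul (Cst 2%:R) (Var 8))
        (Get 4 (EAdd (EMul (Cst 8%:R) (Var 20)) (Var 21))))))
    (Assign 7 (Var 20) (Get 6 (Var 8))))).

(** Horner's scheme, most significant bit first, in agreement with [bits_val]. Bytes are below 256,
    hence [8 <= L]. *)
Lemma runs_draw_labels L T (w : T.-tuple bool) n s : (8 <= L)%N -> (n <= L)%N ->
  s 0%N 0%N = n%:R -> (forall i, s 4 i = (nth false w i)%:R) ->
  (forall i, (i < 256)%N -> s 6 i = (label i)%:R) ->
  runs L draw_labels (n * 43 + 3) s
    (fun s' => forall v, (v < n)%N -> s' 7 v = (rand_label w v)%:R).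
Proof.
move=> L8 nL sn s4 s6.
apply: (@runs_for _ _ _ _ n 40 _ (fun i s' => forall v, (v < i)%N -> s' 7 v = (rand_label w v)%:R)).
- by [].
- by [].
- by rewrite /= address0.
- by [].
- by [].
move=> v s1 vn ag s1v _ h7.
apply: (@runs_le _ _ (1 + (8 * (1 + 3) + 3 + 1 + 1) + 1)); last by [].
apply: runs_seq; apply: runs_assign; first exact: fits0.
rewrite [address _]/= address0 [X in update _ _ _ X]/=.
apply: runs_seq.
pose I i (s' : store) := s' 8 0%N = (bits_val (take i (byte w v)))%:R /\
  (forall u, (u < v)%N -> s' 7 u = (rand_label w u)%:R).
apply: runsW (@runs_for _ _ _ _ 8 1 _ I _ _ _ _ _ _) (leqnn _) _ => //.
- by split; [rewrite take0|exact: h7].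
- move=> i s2 i8 ag2 s2i _ [h8 h7'].
  have bE : 2%:R * s2 8 0%N + s2 4 (8 * v + i)%N = (bits_val (take i.+1 (byte w v)))%:R.
    rewrite (take_nth false) ?size_tuple // bits_val_rcons h8 natrD natrM.
    have -> : nth false (byte w v) i = nth false w (8 * v + i).
      by rewrite -[i]/(nat_of_ord (Ordinal i8)) -tnth_nth tnth_mktuple.
    by rewrite ag2 // update_neq // ag // s4.
  have eE : eval_expr s2 (EAdd (EMul (Cst 2%:R) (Var 8))
        (Get 4 (EAdd (EMul (Cst 8%:R) (Var 20)) (Var 21)))) = (bits_val (take i.+1 (byte w v)))%:R.
    rewrite /= !address0 s2i (ag2 20%N isT 0%N) update_neq // s1v -natrM -natrD address_nat.
    exact: bE.
  apply: runs_assign; rewrite eE.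
    apply: fits_nat; apply: leq_trans (bits_val_lt _) _; rewrite leq_exp2l //.
    by apply: leq_trans L8; rewrite size_take size_tuple; case: ifP => //; lia.
  by rewrite [eval_expr _ (Cst 0)]/= address0; split.
move=> s2 ag2 _ [h8 h7'].
have bv : (bits_val (byte w v) < 256)%N by have := bits_val_lt (byte w v); rewrite size_tuple.
have eE : eval_expr s2 (Get 6 (Var 8)) = (rand_label w v)%:R.
  rewrite /= address0 h8 take_oversize ?size_tuple // address_nat.
  by rewrite (ag2 6%N isT) update_neq // ag // s6.
have aE : address (eval_expr s2 (Var 20)) = v.
  by rewrite /= address0 (ag2 20%N isT 0%N) update_neq // s1v address_nat.
apply: runs_assign; rewrite eE.
  apply: fits_nat; apply: leq_trans (label_lt _) _.
  by apply: leq_trans (_ : 2 ^ 7 <= _)%N; rewrite // leq_exp2l // ltnW.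
move=> u; rewrite aE ltnS leq_eqVlt update_neq //; case: eqP => [->|/eqP uv] /=.
  by move=> _; rewrite updateE.
by move=> ul; rewrite update_neq ?uv // h7'.
Qed.

Definition cut_arcs (a : nat) : cmd :=
  For 20 Nv (For 21 Nv
    (If (Get 1 (Idx (Var 20) (Var 21)))
      (If (ESub (EAdd (EMul (Cst 80%:R) (EMul (EAdd Kv (Cst 1)) (Get a (Idx (Var 20) (Var 21)))))
                    (Get 7 (Var 20)))
               (EAdd (Cst 80%:R) (Get 7 (Var 21))))
        (Assign 5 (Idx (Var 20) (Var 21)) (Cst 1)) Skip) Skip)).

Definition holds_graph (s : store) (G : dag rat) (k : nat) :=
  [/\ s 0%N 0%N = (nverts G)%:R, s 0%N 1%N = k%:R &
      forall u v : 'I_(nverts G), s 1%N (u * nverts G + v)%N = ((u, v) \in arcs G)%:R].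

Definition holds_arcs (s : store) a (G : dag rat) (x : edge (nverts G) -> rat) :=
  forall u v : 'I_(nverts G), (u, v) \in arcs G -> s a (u * nverts G + v)%N = x (u, v).

Lemma runs_cut_arcs L T (w : T.-tuple bool) (G : dag rat) k (x : edge (nverts G) -> rat) a s :
  (a != 5) && (a != 20) && (a != 21) ->
  (nverts G <= L)%N -> (0 < L)%N -> holds_graph s G k -> holds_arcs s a x ->
  (forall v, (v < nverts G)%N -> s 7 v = (rand_label w v)%:R) ->
  (forall i, s 5 i = 0) ->
  runs L (cut_arcs a) (nverts G * (nverts G * 6 + 3 + 3) + 3) s
    (fun s' => output _ s' = cut_set k x w).
Proof.
move=> /andP[/andP[a5 a20] a21] nL L0 [sn sk s1] sx s7 s5; set n := nverts G in s1 sx s7 sn nL *.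
pose I i (s' : store) := forall u v : 'I_n,
  s' 5 (u * n + v)%N = ((u < i)%N && ((u, v) \in cut_set k x w))%:R.
apply: runsW (@runs_for _ _ _ _ n (n * 6 + 3) _ I _ _ _ _ _ _) (leqnn _) _ => //.
- by move=> u v; rewrite update_neq // s5.
- move=> i s1' iN ag s1i _ h5.
  pose J j (s' : store) := forall u v : 'I_n,
    s' 5 (u * n + v)%N = (((u < i) || (u == i :> nat) && (v < j))%N
       && ((u, v) \in cut_set k x w))%:R.
  apply: runsW (@runs_for _ _ _ _ n 3 _ J _ _ _ _ _ _) (leqnn _) _ => //.
  + by rewrite /= address0 ag.
  + by move=> u v; rewrite update_neq // h5 ltn0 andbF orbF.
  + move=> j s2 jN ag2 s2j _ hJ.
    have fr b : b \notin [:: 20; 5; 21]%N -> forall r, s2 b r = s b r.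
      move=> bn r; rewrite ag2; last by apply: contra bn; rewrite !inE => /orP[->|->]; rewrite ?orbT.
      by rewrite ag //; apply: contra bn; rewrite /= !inE; do ![case/orP => [->|]]; rewrite ?orbT // => ->; rewrite ?orbT.
    have s20 : s2 20 0%N = i%:R by rewrite ag2.
    have sij : address (eval_expr s2 (Idx (Var 20) (Var 21))) = (i * n + j)%N.
      by rewrite /= !address0 s20 s2j fr // sn -natrM -natrD address_nat.
    set e : edge n := (Ordinal iN, Ordinal jN).
    (* One statement for the three outcomes of the nested tests; [b] tells whether the cell of
       [(i, j)] has been written. *)
    have step (b : bool) (s3 : store) : b = (e \in cut_set k x w) ->
        (forall r, s3 5 r = if b && (r == i * n + j)%N then 1 else s2 5 r) -> J j.+1 s3.
      move=> bE h3 u v; rewrite h3 hJ eq_flat // bE.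
      have eE : (u == i :> nat) && (v == j :> nat) -> (u, v) = e.
        by case/andP => /eqP ui /eqP vj; congr (_, _); apply: val_inj.
      rewrite [(v < j.+1)%N]ltnS [(v <= j)%N]leq_eqVlt.
      case: (eqVneq (v : nat) j) => vj; last by rewrite !andbF /=; reflexivity.
      case: (eqVneq (u : nat) i) => ui; last by rewrite !andbF /=; reflexivity.
      rewrite -(eE _) ?ui ?vj ?eqxx //= ltnn /=.
      by case: (_ \in cut_set _ _ _); rewrite ?ltnn; reflexivity.
    have e1 : eval_expr s2 (Get 1 (Idx (Var 20) (Var 21))) = (e \in arcs G)%:R.
      by rewrite -[LHS]/(s2 1%N (address (eval_expr s2 (Idx (Var 20) (Var 21))))) sij fr // -s1.
    apply: (@runs_if _ _ _ _ 2); rewrite e1; case eA: (e \in arcs G); rewrite ?ltxx ?ler10 // => _.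
    * have fra r : s2 a r = s a r by apply: fr; rewrite !inE (negPf a5) (negPf a20) (negPf a21).
      have e2 : eval_expr s2 (ESub (EAdd (EMul (Cst 80%:R) (EMul (EAdd Kv (Cst 1))
            (Get a (Idx (Var 20) (Var 21))))) (Get 7 (Var 20))) (EAdd (Cst 80%:R) (Get 7 (Var 21)))) =
          80%:R * ((k%:R + 1) * x e) + (rand_label w i)%:R - (80%:R + (rand_label w j)%:R).
        rewrite -[LHS]/(80%:R * ((s2 0%N (address 1) + 1) *
            s2 a (address (eval_expr s2 (Idx (Var 20) (Var 21))))) + s2 7 (address (s2 20 (address 0))) -
            (80%:R + s2 7 (address (s2 21 (address 0))))).
        by rewrite sij fra (fr 0%N) // !(fr 7%N) // address1 !address0 s20 s2j !address_nat sk !s7 // -sx.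
      have eC : (0 < eval_expr s2 (ESub (EAdd (EMul (Cst 80%:R) (EMul (EAdd Kv (Cst 1))
            (Get a (Idx (Var 20) (Var 21))))) (Get 7 (Var 20))) (EAdd (Cst 80%:R) (Get 7 (Var 21))))) =
           (e \in cut_set k x w).
        by rewrite e2 subr_gt0 inE eA /= natr1 -natrD.
      apply: (@runs_if _ _ _ _ 1) => [h|].
      - apply: runs_assign; first exact: (fits_natS (m := 1)).
        rewrite sij; apply: (step true); first by rewrite -eC h.
        by move=> r; rewrite /update /=; reflexivity.
      - rewrite leNgt eC => nC; apply: runs_skip; apply: (step false); first by rewrite (negPf nC).
        by move=> r; reflexivity.
    * apply: runs_le (_ : 1 <= 2)%N => //; apply: runs_skip.
      apply: (step false); first by rewrite inE eA.
      by move=> r; reflexivity.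
  + move=> s2 _ _ hJ u v; rewrite update_neq // hJ (ltn_ord v) andbT orbC -leq_eqVlt ltnS.
    by reflexivity.
- move=> s' _ _ h; apply/setP => -[u v]; rewrite inE h ltn_ord /=.
  by case: (_ \in _); rewrite ?oner_eq0 ?eqxx.
Qed.

(** The parameter is the array that holds [x]: 3 if the LP solution is part of the input, 10 if
    [mw_program] has computed it. *)
Definition round_program (a : nat) : cmd :=
  Seq (fill_table (iota 0 256)) (Seq draw_labels (cut_arcs a)).

Lemma runs_round_program L T (w : T.-tuple bool) (G : dag rat) k
    (x : edge (nverts G) -> rat) a s :
  (a \notin [:: 5; 6; 7; 8; 20; 21]%N) ->
  (nverts G <= L)%N -> (8 <= L)%N -> holds_graph s G k -> holds_arcs s a x ->
  (forall i, s 4 i = (nth false w i)%:R) -> (forall i, s 5 i = 0) ->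
  runs L (round_program a) (1000 * (nverts G).+1 ^ 2) s
    (fun s' => output _ s' = cut_set k x w).
Proof.
move=> ha nL L8 [sn sk s1] sx s4 s5.
apply: (@runsW _ _ (2 * size (iota 0 256) + 1 + (nverts G * 43 + 3 +
    (nverts G * (nverts G * 6 + 3 + 3) + 3) + 1) + 1) _ _ (fun s' => output _ s' = cut_set k x w));
  last 2 first.
- by rewrite size_iota; nia.
- by [].
apply: runs_seq; have hf := runs_fill_table (iota 0 256) (s := s) (ltnW L8).
apply: (runsW hf (leqnn _)) => sa agf _ h6.
have {}agf : agree [:: 6%N] s sa by apply: agreeW agf; exact: writes_fill_table.
apply: runs_seq; apply: runsW (runs_draw_labels (w := w) L8 nL _ _ _) (leqnn _) _.
- by rewrite agf.
- by move=> i; rewrite agf.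
- by move=> i i256; rewrite h6 mem_iota i256.
move=> sb agl _ h7.
have fr b : b \notin [:: 6; 7; 8; 20; 21]%N -> forall r, sb b r = s b r.
  move=> hb r; rewrite agl; last first.
    by apply: contra hb; rewrite /= !inE; do ![case/orP => [->|]]; rewrite ?orbT // => ->; rewrite ?orbT.
  by rewrite agf //; apply: contra hb; rewrite !inE => ->.
apply: runs_cut_arcs => //.
- by move: ha; rewrite !inE !negb_or; do ![case/andP => ?]; move=> ?; rewrite -andbA; apply/and3P.
- exact: leq_trans L8.
- by split=> [||u v]; rewrite fr.
- move=> u v uv; rewrite fr; first exact: sx.
  by apply: contra ha; rewrite !inE => ->; rewrite !orbT.
- by move=> i; rewrite fr.
Qed.

(** * The input store and the algorithm for a given LP solution *)

Lemma nth_allpairs (A B : eqType) (C : Type) (z : C) a0 b0 (f : A -> B -> C) (s : seq A) (t : seq B) i j :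
  (i < size s)%N -> (j < size t)%N ->
  nth z [seq f a b | a <- s, b <- t] (i * size t + j) = f (nth a0 s i) (nth b0 t j).
Proof.
elim: s i => // a s IH [|i] ilt jlt /=; rewrite nth_cat size_map.
  by rewrite jlt (nth_map b0).
by rewrite mulSn -addnA ltnNge leq_addr /= addKn IH.
Qed.

Lemma nth_arc_table (G : dag rat) (f : edge (nverts G) -> rat) (u v : 'I_(nverts G)) :
  nth 0 (arc_table f) (u * nverts G + v) = if (u, v) \in arcs G then f (u, v) else 0.
Proof.
have := @nth_allpairs _ _ _ 0 u v
  (fun u v : 'I_(nverts G) => if (u, v) \in arcs G then f (u, v) else 0)
  (enum 'I_(nverts G)) (enum 'I_(nverts G)) u v.
by rewrite size_enum_ord => ->; rewrite ?ltn_ord // !nth_ord_enum.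
Qed.

Lemma arc_table_ind (G : dag rat) (f : edge (nverts G) -> rat) (P : rat -> Prop) i :
  P 0 -> (forall e, e \in arcs G -> P (f e)) -> P (nth 0 (arc_table f) i).
Proof.
move=> P0 Pf; have [ilt|/(nth_default 0) -> //] := ltnP i (size (arc_table f)).
have := mem_nth 0 ilt; case/allpairsP => -[u v] /= [_ _ ->].
by case: ifP => // /Pf.
Qed.

Section Input.
Variables (G : dag rat) (k : nat) (y : seq rat).

Lemma nverts_le_size : (nverts G <= input_size G k y)%N.
Proof. by rewrite /input_size; apply: leq_trans (_ : nverts G ^ 2 <= _)%N; nia. Qed.

Lemma cost_bits_le e : e \in arcs G -> (rat_bits (cost e) <= input_size G k y)%N.
Proof.
move=> eA; rewrite /input_size (bigD1 e) //=.
by move: (rat_bits _) => b; lia.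
Qed.

Lemma bounded_input (w : seq bool) : bounded (input_size G k y).+1 (input G k y w).
Proof.
have n1 := nverts_le_size; have b01 (b : bool) : fits (input_size G k y).+1 b%:R.
  by apply: fits_natS; case: b.
case=> [|[|[|[|[|a]]]]] i /=.
- case: i => [|[|i]] /=; last by rewrite nth_nil; exact: fits0.
    by apply: fits_natS; exact: ltnW.
  apply: fits_nat; apply: leq_trans (ltn_nat_bits k) _; rewrite leq_exp2l //.
  by rewrite /input_size; lia.
- by apply: (arc_table_ind (P := fits _)) => [|e _]; [exact: fits0|exact: (b01 true)].
- apply: (arc_table_ind (P := fits _)) => [|e eA]; first exact: fits0.
  by apply: fitsW (fits_bits _); apply: leqW; exact: cost_bits_le.
- have [ilt|/(nth_default 0) ->] := ltnP i (size y); last exact: fits0.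
  apply: fitsW (fits_bits _); rewrite /input_size (big_nth 0) big_mkord.
  rewrite (bigD1 (Ordinal ilt)) //=; move: (rat_bits _) => b; lia.
- exact: b01.
- exact: fits0.
Qed.

Lemma input_holds_graph (w : seq bool) : holds_graph (input G k y w) G k.
Proof.
split=> [||u v]; [reflexivity|reflexivity|].
by rewrite /= nth_arc_table; case: ifP => _; reflexivity.
Qed.

Lemma rand_solves_runs prog T L steps B (out : T.-tuple bool -> {set edge (nverts G)}) :
  ((input_size G k y).+1 <= L)%N ->
  (forall w : T.-tuple bool,
     runs L prog steps (input G k y w) (fun s => output _ s = out w)) ->
  (steps * (cmd_charge prog * L.+1) <= T)%N ->
  (forall w, ded_solution k (out w)) ->
  \sum_w set_cost (out w) <= B * 2 ^+ T -> rand_solves prog T G k y B.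
Proof.
move=> mL rn tT sol cst; exists out; split=> //.
  move=> w; have bL : bounded L (input G k y w).
    by move=> a i; apply: fitsW mL _; exact: bounded_input.
  have [s [t [ex tm _ _ o]]] := rn w bL.
  by exists s, t; split=> //; exact: leq_trans tT.
by rewrite ler_pdivrMr // exprn_gt0.
Qed.

End Input.

Lemma input_holds_arcs (G : dag rat) k (x : edge (nverts G) -> rat) (w : seq bool) :
  holds_arcs (input G k (arc_table x) w) 3 x.
Proof. by move=> u v uv; rewrite /= nth_arc_table uv; reflexivity. Qed.

Lemma rounding_algorithm : exists (prog : cmd) (d : nat), forall (G : dag rat) (k : nat)
    (x : edge (nverts G) -> rat), (0 < k)%N -> lp_feasible k x ->
  rand_solves prog (poly_time d (input_size G k (arc_table x)))
    G k (arc_table x) (approx_ratio rat k * lp_cost x).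
Proof.
(* With [m] the input size, (n + 1)^2 <= 4 (m + 1) turns 1000 into 4000, and the word size [m + 8]
   gives the factor 10. The final 8 makes room for eight random bits per vertex. *)
set A := (4000 * (cmd_charge (round_program 3) * 10) + 8)%N.
have [d dP] := polynomial_bound A 2.
exists (round_program 3), d => G k x k0 xf.
set m := input_size _ _ _; set T := poly_time d m.
have n2 : (nverts G ^ 2 <= m)%N by rewrite /m /input_size; lia.
have n1 : (nverts G <= m)%N by exact: nverts_le_size.
have mT : (A * m.+1 ^ 2 <= T)%N := dP m.
apply: (@rand_solves_runs _ _ _ _ _ (m + 8) (1000 * (nverts G).+1 ^ 2) _
  (fun w => cut_set k x w)).
- by rewrite -addn1 leq_add2l.
- move=> w; apply: runs_round_program => //.
  + by apply: leq_trans n1 _; rewrite leq_addr.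
  + exact: leq_addl.
  + exact: input_holds_graph.
  + exact: input_holds_arcs.
- apply: leq_trans mT; rewrite /A; move: (cmd_charge _) => ch.
  have h1 : ((nverts G).+1 ^ 2 <= 4 * m.+1)%N by nia.
  apply: leq_trans (_ : 1000 * (4 * m.+1) * (ch * (10 * m.+1)) <= _)%N.
    by apply: leq_mul; [rewrite leq_mul2l h1 orbT|rewrite leq_mul2l; apply/orP; right; lia].
  by move: (m.+1) => z; nia.
- by move=> w; exact: cut_set_solution.
- apply: le_trans (expected_cut_cost xf _) _.
    apply: leq_trans mT; rewrite /A.
    by apply: leq_trans (_ : 8 * m.+1 ^ 2 <= _)%N; [nia|rewrite leq_mul2r leq_addl orbT].
  by apply: ler_wpM2r; [exact: exprn_ge0|exact: ratio_slack].
Qed.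

(** * The potential of the multiplicative weights method *)

Lemma ln_le_sub1 (R : realType) (x : R) : 0 < x -> ln x <= x - 1.
Proof.
move=> x0; have := @le_ln1Dx R (x - 1); have -> : 1 + (x - 1) = x by ring.
by apply; lra.
Qed.

Lemma ln_ge_frac (R : realType) (z : R) : 0 <= z -> z / (1 + z) <= ln (1 + z).
Proof.
move=> z0; have z1 : 0 < 1 + z by lra.
have -> : z / (1 + z) = 1 - (1 + z)^-1 by field; rewrite gt_eqF.
have zi : 0 < (1 + z)^-1 by rewrite invr_gt0.
by have := ln_le_sub1 zi; rewrite lnV ?posrE //; lra.
Qed.

(** From [ln_ge_frac], since (1 - e) (1 + z) <= (1 - e) (1 + e) <= 1. *)
Lemma ln_ge_mul (R : realType) (e z : R) : 0 <= z <= e -> (1 - e) * z <= ln (1 + z).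
Proof.
case/andP=> z0 ze; apply: le_trans (ln_ge_frac z0).
by rewrite ler_pdivlMr; nra.
Qed.

Section Potential.
Variables (R : realType) (E : finType) (pos C : {set E}) (c : E -> R).
Hypotheses (c_gt0 : forall e, e \in pos -> 0 < c e) (C_pos : C \subset pos).
Hypothesis C_neq0 : C != finset.set0.

Let m : R := #|pos|%:R.
Let opt : R := \sum_(e in C) c e.

Definition volume (y : E -> R) : R := \sum_(e in pos) c e * y e.

(* The first summand bounds the total amount routed in units of [opt], the
   second one the number of steps whatever the magnitudes of the costs. *)
Definition potential (y : E -> R) : R :=
  2100 * m * (ln (volume y) - ln opt - \sum_(e in C) c e / opt * ln (y e))
  + (m * ln (volume y) - \sum_(e in pos) ln (c e * y e)).

Let Csub e : e \in C -> e \in pos. Proof. by move/(fintype.subsetP C_pos). Qed.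

Let opt_gt0 : 0 < opt.
Proof.
case/set0Pn: C_neq0 => e eC; rewrite /opt (bigD1 e) //=.
apply: ltr_wpDr; last exact/c_gt0/Csub.
by apply: sumr_ge0 => e' /andP[e'C _]; apply/ltW/c_gt0/Csub.
Qed.

Let m_ge0 : 0 <= m. Proof. exact: ler0n. Qed.

Lemma volume_ge y e : (forall e, e \in pos -> 0 < y e) -> e \in pos -> c e * y e <= volume y.
Proof.
move=> y0 eP; rewrite /volume (bigD1 e) //= lerDl; apply: sumr_ge0 => e' /andP[e'P _].
by apply: mulr_ge0; apply: ltW; [exact: c_gt0|exact: y0].
Qed.

Lemma volume_gt0 y : (forall e, e \in pos -> 0 < y e) -> 0 < volume y.
Proof.
move=> y0; case/set0Pn: C_neq0 => e /Csub eP; apply: lt_le_trans (volume_ge y0 eP).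
by apply: mulr_gt0; [exact: c_gt0|exact: y0].
Qed.

(** The first summand is Jensen's inequality for the probability weights [c e / opt] on [C], proved
    through ln q <= q - 1 with q = y_e opt / volume; it uses that the part of the volume on [C] is
    at most the whole. In the second one every [c e * y e] is at most the volume. *)
Lemma potential_ge0 y : (forall e, e \in pos -> 0 < y e) -> 0 <= potential y.
Proof.
move=> y0; have V0 := volume_gt0 y0; apply: addr_ge0.
  apply: mulr_ge0; first by apply: mulr_ge0 m_ge0; exact: ler0n.
  rewrite subr_ge0.
  have -> : ln (volume y) - ln opt = \sum_(e in C) c e / opt * ln (volume y / opt).
    by rewrite -!mulr_suml divff ?gt_eqF // mul1r ln_div ?posrE.
  rewrite -subr_ge0 -oppr_le0 opprB -sumrB.
  apply: le_trans (_ : \sum_(e in C) (c e * y e / volume y - c e / opt) <= _).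
    apply: ler_sum => e eC; rewrite -mulrBr -ln_div ?posrE ?divr_gt0 //; last exact/y0/Csub.
    have q0 : 0 < y e / (volume y / opt) by rewrite !divr_gt0 //; exact/y0/Csub.
    have h := ln_le_sub1 q0.
    apply: le_trans (ler_wpM2l _ h) _; first by apply: divr_ge0; apply: ltW => //; exact/c_gt0/Csub.
    by rewrite le_eqVlt; apply/orP; left; apply/eqP; field; rewrite !gt_eqF.
  rewrite sumrB -!mulr_suml divff ?gt_eqF // subr_le0 ler_pdivrMr // mul1r.
  rewrite /volume [leRHS](bigID (mem C)) /=.
  have -> : \sum_(e in pos | e \in C) c e * y e = \sum_(e in C) c e * y e.
    by apply: eq_bigl => e; case eC: (e \in C); rewrite ?andbF // Csub.
  rewrite lerDl; apply: sumr_ge0 => e /andP[eP _].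
  by apply: mulr_ge0; apply: ltW; [exact: c_gt0|exact: y0].
rewrite subr_ge0 /m mulr_natl -sumr_const; apply: ler_sum => e eP.
rewrite ler_ln ?posrE //; first exact: volume_ge.
by apply: mulr_gt0; [exact: c_gt0|exact: y0].
Qed.

(** For weights 1/c every [c e * y e] is 1 and the volume is [m], whatever the costs are. As
    [c e <= opt] on [C], the terms with [opt] only help, and 2101 m ln m is left. *)
Lemma potential_init : potential (fun e => (c e)^-1) <= 2101 * (m * m).
Proof.
have VE : volume (fun e => (c e)^-1) = m.
  rewrite /volume /m -sum1_card natr_sum; apply: eq_bigr => e eP.
  by rewrite divff // gt_eqF // c_gt0.
have m1 : 1 <= m.
  rewrite ler1n card_gt0; apply/set0Pn; case/set0Pn: C_neq0 => e /Csub eP.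
  by exists e.
have lnm : ln m <= m.
  by have := @ln_le_sub1 R m; lra.
rewrite /potential VE [\sum_(e in pos) _]big1; last first.
  by move=> e eP; rewrite divff ?ln1 // gt_eqF // c_gt0.
have S0 : - ln opt - \sum_(e in C) c e / opt * ln (c e)^-1 <= 0.
  have -> : ln opt = \sum_(e in C) c e / opt * ln opt.
    by rewrite -!mulr_suml divff ?gt_eqF // mul1r.
  rewrite -opprD oppr_le0 -big_split /=; apply: sumr_ge0 => e eC.
  have c0 := c_gt0 (Csub eC).
  rewrite /= -mulrDr lnV ?posrE //; apply: mulr_ge0; first by apply: divr_ge0; exact: ltW.
  rewrite subr_ge0 ler_ln ?posrE // /opt (bigD1 e) //= lerDl; apply: sumr_ge0 => e' /andP[e'C _].
  exact/ltW/c_gt0/Csub.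
rewrite subr0 -addrA.
apply: le_trans (_ : 2100 * m * ln m + m * ln m <= _).
  by rewrite lerD2r; apply: ler_wpM2l; [apply: mulr_ge0 m_ge0; exact: ler0n|lra].
by move: (ln m) lnm => l lnm; nra.
Qed.

(** By the choice of [f], the numbers [f / c e] sum to 1/2000 along [P], so each of them is that
    small and ln (1 + f / c) is nearly f / c. With q = f / opt, ln volume grows by at most
    (1000/1001) q because [y] is still too expensive, while the average over [C] grows by at least
    (1999/2000) q because [P] meets [C]. Independently of q, the sum in the second summand grows by
    almost 1/2000. *)
Lemma potential_step (P : {set E}) (y y' : E -> R) (f : R) :
  (forall e, e \in pos -> 0 < y e) -> P \subset pos -> (exists2 e, e \in P & e \in C) ->
  f = 1 / 2000 / \sum_(e in P) (c e)^-1 ->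
  1001 / 1000 * opt * \sum_(e in P) y e <= volume y ->
  (forall e, e \in pos -> y' e = if e \in P then y e * (1 + f / c e) else y e) ->
  potential y' <= potential y - 1 / 2100.
Proof.
move=> y0 Ppos [e0 e0P e0C] fE hyp y'E.
have Psub e : e \in P -> e \in pos by move/(fintype.subsetP Ppos).
have V0 := volume_gt0 y0.
have h0 e : e \in P -> (c e)^-1 <= \sum_(e in P) (c e)^-1.
  move=> eP; rewrite (bigD1 e) //= lerDl; apply: sumr_ge0 => e' /andP[e'P _].
  by rewrite invr_ge0 ltW // c_gt0 // Psub.
have hpos : 0 < \sum_(e in P) (c e)^-1.
  by apply: lt_le_trans (h0 _ e0P); rewrite invr_gt0 c_gt0 // Csub.
have f0 : 0 < f by rewrite fE; apply: divr_gt0 hpos; lra.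
have fc e : e \in P -> 0 <= f / c e <= 1 / 2000.
  move=> eP; apply/andP; split; first by rewrite divr_ge0 ?ltW // c_gt0 // Psub.
  have -> : 1 / 2000 = f * \sum_(e in P) (c e)^-1 by rewrite fE divfK // gt_eqF.
  by apply: ler_wpM2l; [exact: ltW|exact: h0].
have fc1 e : e \in P -> 0 < 1 + f / c e by move=> /fc; lra.
have y'0 e : e \in pos -> 0 < y' e.
  by move=> eP; rewrite y'E //; case: ifP => [/fc1 h|_]; [apply: mulr_gt0|]; rewrite ?y0.
have restr (Q : {set E}) (F : E -> R) : Q \subset pos ->
    \sum_(e in Q) (if e \in P then F e else 0) = \sum_(e in Q :&: P) F e.
  by move=> _; rewrite -big_mkcondr; apply: eq_bigl => e; rewrite inE.
have VE : volume y' = volume y + f * \sum_(e in P) y e.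
  have -> : P = pos :&: P by apply/esym/finset.setIidPr.
  rewrite /volume mulr_sumr -(restr pos (fun e => f * y e)) // -big_split /=.
  apply: eq_bigr => e eP; rewrite y'E //; case: ifP => _; last by rewrite addr0.
  by field; rewrite gt_eqF // c_gt0.
have lnV : ln (volume y') <= ln (volume y) + f / (1001 / 1000 * opt).
  have -> : volume y' = volume y * (1 + f * (\sum_(e in P) y e) / volume y).
    by rewrite VE; field; rewrite gt_eqF.
  have a0 : 0 <= f * (\sum_(e in P) y e) / volume y.
    apply: divr_ge0; last exact: ltW.
    by apply: mulr_ge0; [exact: ltW|apply: sumr_ge0 => e /Psub /y0 /ltW].
  have a1 : f * (\sum_(e in P) y e) / volume y <= f / (1001 / 1000 * opt).
    rewrite ler_pdivrMr // mulrAC ler_pdivlMr; last by move: opt_gt0; lra.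
    move: (\sum_(e in P) y e) hyp => a hyp.
    have -> : f * a * (1001 / 1000 * opt) = f * (1001 / 1000 * opt * a) by ring.
    by apply: ler_wpM2l; [exact: ltW|exact: hyp].
  rewrite lnM ?posrE //; last by lra.
  by rewrite lerD2l; apply: le_trans a1; apply: le_ln1Dx; lra.
have lnC : \sum_(e in C) c e / opt * ln (y e) + 1999 / 2000 * f / opt <=
           \sum_(e in C) c e / opt * ln (y' e).
  have -> : \sum_(e in C) c e / opt * ln (y' e) = \sum_(e in C) c e / opt * ln (y e) +
      \sum_(e in C :&: P) c e / opt * ln (1 + f / c e).
    rewrite -restr // -big_split /=; apply: eq_bigr => e /Csub eC; rewrite y'E //.
    case: ifP => [eP|_]; last by rewrite addr0.
    by rewrite lnM ?posrE ?y0 ?fc1 // mulrDr.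
  rewrite lerD2l (bigD1 e0) ?inE ?e0C //= -[leLHS]addr0; apply: lerD.
    have c0 := c_gt0 (Csub e0C).
    have -> : 1999 / 2000 * f / opt = c e0 / opt * ((1 - 1 / 2000) * (f / c e0)).
      by field; rewrite !gt_eqF.
    by apply: ler_wpM2l; [apply: divr_ge0; exact: ltW|apply: ln_ge_mul; exact: fc].
  apply: sumr_ge0 => e /andP[]; rewrite inE => /andP[eC eP] _.
  apply: mulr_ge0; first by apply: divr_ge0; apply: ltW => //; exact/c_gt0/Csub.
  have /andP[a0 _] := fc _ eP.
  by rewrite ln_ge0 // lerDl.
have lnP : \sum_(e in pos) ln (c e * y e) + 1999 / 2000 / 2000 <=
           \sum_(e in pos) ln (c e * y' e).
  have -> : \sum_(e in pos) ln (c e * y' e) = \sum_(e in pos) ln (c e * y e) +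
      \sum_(e in P) ln (1 + f / c e).
    have -> : \sum_(e in P) ln (1 + f / c e) = \sum_(e in pos :&: P) ln (1 + f / c e).
      by apply: eq_bigl => e; rewrite (finset.setIidPr Ppos).
    rewrite -restr // -big_split /=; apply: eq_bigr => e eP; rewrite y'E //.
    case: ifP => [eP'|_]; last by rewrite addr0.
    by rewrite mulrA lnM ?posrE ?fc1 //; apply: mulr_gt0; [exact: c_gt0|exact: y0].
  rewrite lerD2l; apply: le_trans (_ : \sum_(e in P) (1 - 1 / 2000) * (f / c e) <= _).
    rewrite -mulr_sumr -mulr_sumr fE divfK ?gt_eqF //; lra.
  by apply: ler_sum => e eP; apply: ln_ge_mul; exact: fc.
have q0 : 0 < f / opt by exact: divr_gt0.
have lnV' : ln (volume y') <= ln (volume y) + 1000 / 1001 * (f / opt).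
  apply: le_trans lnV _; rewrite lerD2l le_eqVlt; apply/orP; left; apply/eqP.
  by field; rewrite gt_eqF.
have lnC' : \sum_(e in C) c e / opt * ln (y e) + 1999 / 2000 * (f / opt) <=
           \sum_(e in C) c e / opt * ln (y' e) by rewrite mulrA.
rewrite /potential; move: lnV' lnC' lnP q0 m_ge0.
move: (ln (volume y')) (ln (volume y)) (ln opt) (f / opt) (m) => v' v o q mm.
move: (\sum_(e in C) _ * ln (y' e)) (\sum_(e in C) _ * ln (y e)) => sc' sc.
move: (\sum_(e in pos) ln (c e * y' e)) (\sum_(e in pos) ln (c e * y e)) => sp' sp.
move=> hv hc hp q0 m0.
(* The weight 2100 is chosen so that 2100 (1999/2000 - 1000/1001) > 1000/1001: the first summand
   drops by more than m ln volume grows in the second one, and the drop of 1999/2000/2000 > 1/2100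
   remains. *)
have mv : mm * v' <= mm * (v + 1000 / 1001 * q) by exact: ler_wpM2l.
have mc : mm * (sc + 1999 / 2000 * q) <= mm * sc' by exact: ler_wpM2l.
have mq : 0 <= mm * q by apply: mulr_ge0 => //; exact: ltW.
rewrite !mulrDr !mulrN in mv mc *.
by move: mv mc mq; lra.
Qed.

End Potential.

(** * Shortest walks with [k] arcs *)

Lemma runs_set L s a e v (Q : store -> Prop) :
  eval_expr s e = v -> fits L v -> Q (update s a 0%N v) -> runs L (SetVar a e) 1 s Q.
Proof.
by move=> ev fv q; apply: runs_assign; rewrite ev.
Qed.

Lemma runs_store L s a i j e v (Q : store -> Prop) :
  address (eval_expr s i) = j -> eval_expr s e = v -> fits L v -> Q (update s a j v) ->
  runs L (Assign a i e) 1 s Q.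
Proof. by move=> ij ev fv q; apply: runs_assign; rewrite ?ij ev. Qed.

Definition NN := EMul Nv Nv.

Lemma eval_NN s n : s 0%N 0%N = n%:R -> eval_expr s NN = (n * n)%:R.
Proof. by move=> h; rewrite /= address0 h natrM. Qed.

Definition dp_cell := Idx (EAdd (Var 32) (Cst 1)) (Var 33).
Definition dp_candidate u := EAdd (Get 14 (Idx (Var 33) u)) (Get 15 (Idx (Var 32) u)).
Definition shortest_walks : cmd :=
  For 32 Kv (For 33 Nv (Seq (Assign 15 dp_cell (dp_candidate (Cst 0)))
    (Seq (Assign 16 dp_cell (Cst 0))
      (For 34 Nv (If (ESub (Get 15 dp_cell) (dp_candidate (Var 34)))
        (Seq (Assign 15 dp_cell (dp_candidate (Var 34))) (Assign 16 dp_cell (Var 34))) Skip))))).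

(* Cell [j * n + v] of array 15 holds the length of a shortest walk with [j] arcs from [v],
   and the same cell of array 16 the second vertex of such a walk. *)
Definition dp_row (n : nat) (wt d p : nat -> rat) (B j v : nat) :=
  [/\ fits (j.+1 * B) (d (j.+1 * n + v)%N),
      exists2 u, (u < n)%N & p (j.+1 * n + v)%N = u%:R /\
        d (j.+1 * n + v)%N = wt (v * n + u)%N + d (j * n + u)%N
    & forall u, (u < n)%N -> d (j.+1 * n + v)%N <= wt (v * n + u)%N + d (j * n + u)%N].

(** The table is filled in row-major order, so that one cell number [cur] describes the progress of
    both outer loops. *)
Definition dp_upto n wt B (s : store) cur :=
  (forall v, (v < n)%N -> s 15 v = 0) /\
  (forall j v, (v < n)%N -> (j.+1 * n + v < cur)%N -> dp_row n wt (s 15) (s 16) B j v).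

Lemma dp_upto_stable n wt B (s s' : store) cur : (n <= cur)%N ->
  (forall r, (r < cur)%N -> s' 15 r = s 15 r /\ s' 16 r = s 16 r) ->
  dp_upto n wt B s cur -> dp_upto n wt B s' cur.
Proof.
move=> nc h [h0 hr]; split=> [v vn|j v vn jv].
  by have [-> _] := h v (leq_trans vn nc); exact: h0.
have [f1 [u un [pu du]] le] := hr _ _ vn jv; have [e1 e2] := h _ jv.
have lt u' : (u' < n)%N -> (j * n + u' < cur)%N by move=> ?; lia.
split; rewrite ?e1 //.
  by exists u => //; rewrite e2 (h _ (lt _ un)).1.
by move=> u' un'; rewrite (h _ (lt _ un')).1; exact: le.
Qed.

Lemma dp_upto_level n wt B s J V u : dp_upto n wt B s (J.+1 * n + V) -> (u < n)%N ->
  fits (J * B) (s 15 (J * n + u)%N).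
Proof.
case=> h0 hr un; case: J hr => [|J] hr; first by rewrite mul0n add0n h0 //; exact: fits0.
by have [] := hr J u un; first lia.
Qed.

(** Row 0 is never written, so its initial zeros serve all later calls. The other rows are computed
    afresh, every cell starting from the candidate with second vertex 0. A length in row [j] is a
    sum of [j] arc lengths and takes [j * B] bits. *)
Lemma runs_shortest_walks L n k B wt s : (0 < n)%N -> (n <= L)%N -> (k <= L)%N ->
  ((k + 1) * B <= L)%N ->
  s 0%N 0%N = n%:R -> s 0%N 1%N = k%:R -> (forall v, (v < n)%N -> s 15 v = 0) ->
  (forall i, (i < n * n)%N -> s 14 i = wt i /\ fits B (wt i)) ->
  runs L shortest_walks (k * (n * (n * 7 + 10) + 3 + 3) + 3) s
    (fun s' => dp_upto n wt B s' (k.+1 * n)).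
Proof.
move=> n0 nL kL BL sn sk s15 sw.
have swE u v : (u < n)%N -> (v < n)%N -> s 14 (v * n + u)%N = wt (v * n + u)%N /\ fits B (wt (v * n + u)%N).
  by move=> un vn; apply: sw; nia.
apply: (@runs_for _ _ _ _ k (n * (n * 7 + 10) + 3) _ (fun J s' => dp_upto n wt B s' (J.+1 * n))).
- by [].
- by [].
- by rewrite /= address1.
- by [].
- split=> [v vn|j v vn]; first by rewrite update_neq // s15.
  by rewrite mul1n; lia.
move=> J s1 Jk ag1 s1J _ hJ.
have lvlL j : (j <= k)%N -> (j.+1 * B <= L)%N by move=> jk; apply: leq_trans BL; rewrite leq_mul2r; lia.
apply: runsW (@runs_for _ _ _ _ n (n * 7 + 7) _
  (fun V s' => dp_upto n wt B s' (J.+1 * n + V)) _ _ _ _ _ _) _ _ => //.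
- by rewrite /= address0 ag1.
- by rewrite addn0; apply: dp_upto_stable hJ => [|r _]; [nia|rewrite !update_neq].
- move=> V s2 Vn ag2 s2V _ hV.
  set cur := (J.+1 * n + V)%N.
  have cn : (n <= cur)%N by rewrite /cur; nia.
  pose good (s' : store) := [/\ s' 0%N 0%N = n%:R, s' 32 0%N = J%:R, s' 33 0%N = V%:R &
    forall i, s' 14 i = s 14 i].
  have g2 : good s2.
    by split=> [||//|i]; rewrite ag2 // ?ag1.
  have good_upd s' a i q : good s' -> a \notin [:: 0; 32; 33; 14]%N -> good (update s' a i q).
    move=> [q1 q2 q3 q4]; rewrite !inE !negb_or => /and4P[a0 a1 a2 a3].
    by split=> [|||r]; rewrite update_neq // eq_sym ?a0 ?a1 ?a2 ?a3.
  have good_cell s' : good s' -> address (eval_expr s' dp_cell) = cur.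
    move=> [q1 q2 q3 q4]; rewrite /= !address0 q1 q2 q3 -(natrD _ _ 1) -natrM -natrD address_nat.
    by rewrite /cur addn1.
  have good_cand s' eu u : good s' -> eval_expr s' eu = u%:R -> (u < n)%N ->
      eval_expr s' (dp_candidate eu) = wt (V * n + u)%N + s' 15 (J * n + u)%N.
    move=> [q1 q2 q3 q4] eE un; rewrite /= !address0 q1 q2 q3 eE -!natrM -!natrD !address_nat.
    by rewrite q4 (swE _ _ un Vn).1.
  have cand_fits s' u : dp_upto n wt B s' cur -> (u < n)%N ->
      fits (J.+1 * B) (wt (V * n + u)%N + s' 15 (J * n + u)%N).
    move=> hu un; rewrite mulSn; apply: fits_add; first exact: (swE _ _ un Vn).2.
    exact: dp_upto_level hu un.
  have upd_stable s' a i q : (cur <= i)%N -> dp_upto n wt B s' cur -> dp_upto n wt B (update s' a i q) cur.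
    move=> ci; apply: dp_upto_stable => // r rc.
    by split; rewrite update_neq // (ltn_eqF (leq_trans rc ci)) orbT.
  have below u : (u < n)%N -> (J * n + u < cur)%N by rewrite /cur; lia.
  pose I U (s' : store) := [/\ good s', dp_upto n wt B s' cur,
    fits (J.+1 * B) (s' 15 cur),
    exists2 u, (u < n)%N & s' 16 cur = u%:R /\ s' 15 cur = wt (V * n + u)%N + s' 15 (J * n + u)%N
    & forall u, (u < U)%N -> s' 15 cur <= wt (V * n + u)%N + s' 15 (J * n + u)%N].
  apply: (@runs_le _ _ (1 + (1 + (n * (4 + 3) + 3) + 1) + 1)); last by lia.
  apply: runs_seq; apply: (@runs_store _ _ _ _ cur _ (wt (V * n + 0)%N + s2 15 (J * n + 0)%N)).
  + exact: good_cell.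
  + exact: good_cand.
  + by apply: fitsW (cand_fits _ 0%N hV n0); apply: lvlL; exact: ltnW.
  set s3 := update _ _ _ _; have g3 : good s3 by exact: good_upd.
  have h3 : dp_upto n wt B s3 cur by exact: upd_stable.
  have e3 : s3 15 cur = wt (V * n + 0)%N + s3 15 (J * n + 0)%N.
    by rewrite [in LHS]/s3 updateE /s3 update_neq // (ltn_eqF (below _ n0)) orbT.
  apply: runs_seq; apply: (@runs_store _ _ _ _ cur _ 0).
  + exact: good_cell.
  + by reflexivity.
  + exact: fits0.
  set s4 := update _ _ _ _; have g4 : good s4 by exact: good_upd.
  have h4 : dp_upto n wt B s4 cur by exact: upd_stable.
  have e4 r : s4 15 r = s3 15 r by rewrite /s4 update_neq.
  have p4 : s4 16 cur = 0 by rewrite /s4 updateE.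
  apply: runsW (@runs_for _ _ _ _ n 4 _ I _ _ _ _ _ _) (leqnn _) _.
  + by [].
  + by [].
  + by have [q1 _ _ _] := g4; rewrite /= address0.
  + by [].
  + split.
    * exact: good_upd.
    * by apply: dp_upto_stable h4 => // r _; rewrite !update_neq.
    * by rewrite update_neq // e4 e3; exact: cand_fits.
    * by exists 0%N => //; rewrite !update_neq // p4 !e4 e3; split; reflexivity.
    * by move=> u; rewrite ltn0.
  + move=> U s5 Un ag5 s5U _ [g5 h5 f5 [u un [pu du]] le5].
    have eU : eval_expr s5 (Var 34) = U%:R by rewrite /= address0.
    have cE := good_cand _ _ _ g5 eU Un.
    have I_upd s' q : I U.+1 s' -> I U.+1 (update s' 34 0%N q).
      move=> [q1 q2 q3 [z zn [z1 z2]] q5]; split.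
      + exact: good_upd.
      + by apply: dp_upto_stable q2 => // r _; rewrite !update_neq.
      + exact: q3.
      + by exists z.
      + exact: q5.
    apply: (@runs_if _ _ _ _ 3).
      rewrite -[eval_expr s5 _]/(s5 15 (address (eval_expr s5 dp_cell)) - eval_expr s5 (dp_candidate (Var 34))).
      rewrite good_cell // cE subr_gt0 => lt5.
      apply: (@runs_le _ _ (1 + 1 + 1)) => //; apply: runs_seq.
      apply: (@runs_store _ _ _ _ cur _ (wt (V * n + U)%N + s5 15 (J * n + U)%N)) => //.
      * exact: good_cell.
      * by apply: fitsW (cand_fits _ _ h5 Un); apply: lvlL; exact: ltnW.
      set s6 := update _ _ _ _; have g6 : good s6 by exact: good_upd.
      have h6 : dp_upto n wt B s6 cur by exact: upd_stable.
      have e6 w : (w < n)%N -> s6 15 (J * n + w)%N = s5 15 (J * n + w)%N.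
        by move=> wn; rewrite /s6 update_neq // (ltn_eqF (below _ wn)) orbT.
      have e6c : s6 15 cur = wt (V * n + U)%N + s6 15 (J * n + U)%N.
        by rewrite e6 // /s6 updateE.
      apply: (@runs_store _ _ _ _ cur _ U%:R).
      * exact: good_cell.
      * by rewrite /= address0 /s6 update_neq.
      * by apply: fits_natS; lia.
      have e7 r : update s6 16 cur U%:R 15 r = s6 15 r by rewrite update_neq.
      apply: I_upd; split.
      * exact: good_upd.
      * exact: upd_stable.
      * by rewrite update_neq // e6c; exact: cand_fits.
      * by exists U => //; rewrite updateE !e7; split.
      * move=> w; rewrite ltnS leq_eqVlt !e7 => /orP[/eqP -> |wU].
          by rewrite e6c lexx.
        have wn : (w < n)%N by exact: ltn_trans Un.
        rewrite e6c !e6 //; apply: le_trans (le5 _ wU); exact: ltW.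
    rewrite -[eval_expr s5 _]/(s5 15 (address (eval_expr s5 dp_cell)) - eval_expr s5 (dp_candidate (Var 34))).
    rewrite good_cell // cE subr_le0 => ge5.
    apply: (@runs_le _ _ 1) => //; apply: runs_skip; apply: I_upd; split=> //.
      by exists u.
    by move=> w; rewrite ltnS leq_eqVlt => /orP[/eqP ->|/le5].
  + move=> s5 _ _ [g5 h5 f5 ex5 le5].
    have hS : dp_upto n wt B s5 cur.+1.
      case: h5 => h50 h5r; split=> // j v vn; rewrite ltnS leq_eqVlt => /orP[|]; last exact: h5r.
      by rewrite eq_flat // => /andP[/eqP [->] /eqP ->]; split.
    by rewrite addnS; apply: dp_upto_stable hS => [|r _]; [exact: leqW|rewrite !update_neq].
- lia.
- move=> s2 _ _ h2.
  have -> : (J.+2 * n = J.+1 * n + n)%N by rewrite mulSn addnC.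
  by apply: dp_upto_stable h2 => [|r _]; [lia|rewrite !update_neq].
Qed.

(** * Arcs as cell numbers *)

Definition flat (n : nat) (e : edge n) : nat := (e.1 * n + e.2)%N.

Lemma flat_lt n (e : edge n) : (flat e < n * n)%N.
Proof. by case: e => u v; rewrite /flat /=; have := ltn_ord u; have := ltn_ord v; nia. Qed.

Lemma flat_inj n : injective (@flat n).
Proof.
move=> [u v] [u' v'] /eqP; rewrite /flat /= eq_flat // => /andP[/eqP e1 /eqP e2].
by congr (_, _); apply: val_inj.
Qed.

Lemma flat_surj n i : (i < n * n)%N -> exists e : edge n, flat e = i.
Proof.
move=> h; have n0 : (0 < n)%N by nia.
have h1 : (i %/ n < n)%N by rewrite ltn_divLR.
exists (Ordinal h1, Ordinal (ltn_pmod i n0)).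
by rewrite /flat /= -divn_eq.
Qed.

Lemma sum_flat (V : nmodType) n (F : nat -> V) :
  \sum_(0 <= i < n * n) F i = \sum_(e : edge n) F (flat e).
Proof.
rewrite big_nat_mul big_mkord.
rewrite -(pair_bigA _ (fun u v : 'I_n => F (u * n + v)%N)) /=; apply: eq_bigr => u _.
rewrite -{1}[(u * n)%N]add0n big_addn mulSn addnK big_mkord.
by apply: eq_bigr => v _; rewrite addnC.
Qed.

Lemma fits_sum i b (F : nat -> rat) : (forall j, (j < i)%N -> fits b (F j)) ->
  fits (i * b) (\sum_(0 <= j < i) F j).
Proof.
elim: i => [|i IH] h; first by rewrite big_geq //; exact: fits0.
rewrite big_nat_recr //= mulSn addnC; apply: fits_add; last exact: h.
by apply: IH => j ji; apply: h; exact: ltnW.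
Qed.

Lemma fits_flatP n (b : nat) (F : nat -> rat) :
  (forall e : edge n, fits b (F (flat e))) -> forall i, (i < n * n)%N -> fits b (F i).
Proof. by move=> h i /flat_surj[e <-]. Qed.

(** * One step of the multiplicative weights program *)

(** Arrays of the LP solver: 10 best solution so far, 11 weights, 12 inverse costs, 13 indicator of
    positive cost, 14 lengths, 15 and 16 shortest walks, 17 indicator of the current walk. Scalars:
    35 start of the walk, 36 volume, 37 total weight, 38 the huge length, 39 length of the walk, 40
    sum of inverse costs on it, 41 best ratio, 42 current vertex, 44 the factor [f]. *)
Definition sum_weights : cmd :=
  Seq (SetVar 36 (Cst 0)) (Seq (SetVar 37 (Cst 0))
    (For 31 NN (Seq (SetVar 36 (EAdd (Var 36) (EMul (Get 2 (Var 31)) (Get 11 (Var 31)))))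
                    (SetVar 37 (EAdd (Var 37) (Get 11 (Var 31))))))).

Lemma runs_sum_weights L n B s : s 0%N 0%N = n%:R -> (n * n <= L)%N ->
  (n * n * (B + B) <= L)%N ->
  (forall i, (i < n * n)%N -> fits B (s 2 i)) -> (forall i, (i < n * n)%N -> fits B (s 11 i)) ->
  runs L sum_weights (n * n * 6 + 7) s (fun s' =>
    s' 36 0%N = \sum_(0 <= i < n * n) s 2 i * s 11 i /\
    s' 37 0%N = \sum_(0 <= i < n * n) s 11 i).
Proof.
move=> sn nL BL f2 f11; set N := (n * n)%N.
apply: (@runs_le _ _ (1 + (1 + (N * (3 + 3) + 3) + 1) + 1)); last by lia.
apply: runs_seq; apply: (@runs_set _ _ _ _ 0); [reflexivity|exact: fits0|].
apply: runs_seq; apply: (@runs_set _ _ _ _ 0); [reflexivity|exact: fits0|].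
apply: (@runs_for _ _ _ _ N 3 _ (fun i s' =>
    s' 36 0%N = \sum_(0 <= j < i) s 2 j * s 11 j /\ s' 37 0%N = \sum_(0 <= j < i) s 11 j)).
- by [].
- by [].
- by apply: eval_NN; rewrite !update_neq.
- by [].
- by rewrite !big_geq.
move=> i s1 iN ag si _ [h36 h37].
have fr b j : b \notin [:: 31; 36; 37]%N -> s1 b j = s b j.
  rewrite !inE !negb_or => /and3P[b1 b2 b3].
  rewrite ag ?update_neq ?b2 ?b3 //.
  by rewrite /= !inE !negb_or b1 b2 b3.
have part F b : (N * b <= L)%N -> (forall j, (j < N)%N -> fits b (F j)) ->
    fits L (\sum_(0 <= j < i.+1) F j).
  move=> bL hF; apply: (@fitsW (i.+1 * b)); first by apply: leq_trans bL; rewrite leq_mul2r iN orbT.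
  by apply: fits_sum => j ji; apply: hF; exact: leq_trans iN.
apply: (@runs_le _ _ (1 + 1 + 1)) => //; apply: runs_seq.
apply: (@runs_set _ _ _ _ (\sum_(0 <= j < i.+1) s 2 j * s 11 j)).
- rewrite /= !address0 si !address_nat h36 !fr // big_nat_recr //=.
- by apply: (part _ (B + B)) => // j jN; apply: fits_mul; [exact: f2|exact: f11].
apply: (@runs_set _ _ _ _ (\sum_(0 <= j < i.+1) s 11 j)).
- by rewrite /= !address0 !update_neq // si !address_nat h37 !fr // big_nat_recr.
- apply: (part _ B) => //; apply: leq_trans BL; rewrite leq_mul2l; lia.
by split; reflexivity.
Qed.

Definition set_lengths : cmd :=
  Seq (SetVar 38 (EAdd (Cst 1) (EMul Nv (Var 37))))
    (For 31 NN (Assign 14 (Var 31)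
       (EAdd (Get 11 (Var 31)) (EMul (ESub (Cst 1) (Get 13 (Var 31))) (Var 38))))).

Lemma runs_set_lengths L n s (M : rat) : s 0%N 0%N = n%:R -> (n * n <= L)%N ->
  1 + n%:R * s 37 0%N = M -> fits L M ->
  (forall i, (i < n * n)%N -> fits L (s 11 i + (1 - s 13 i) * M)) ->
  runs L set_lengths (n * n * 4 + 5) s (fun s' => s' 38 0%N = M /\
    forall i, (i < n * n)%N -> s' 14 i = s 11 i + (1 - s 13 i) * M).
Proof.
move=> sn nL ME fM f14.
apply: (@runs_le _ _ (1 + (n * n * (1 + 3) + 3) + 1)); last by lia.
apply: runs_seq; apply: (@runs_set _ _ _ _ M); [by rewrite /= !address0 sn|exact: fM|].
apply: (@runs_for _ _ _ _ (n * n) 1 _ (fun i s' => s' 38 0%N = M /\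
    forall j, (j < i)%N -> s' 14 j = s 11 j + (1 - s 13 j) * M)).
- by [].
- by [].
- by apply: eval_NN; rewrite !update_neq.
- by [].
- by split=> //; rewrite update_neq // updateE.
move=> i s1 iN ag si _ [h38 h14].
apply: (@runs_store _ _ _ _ i _ (s 11 i + (1 - s 13 i) * M)).
- by rewrite /= address0 si address_nat.
- by rewrite /= !address0 si !address_nat h38 !ag // !update_neq.
- exact: f14.
rewrite !update_neq //; split=> // j; rewrite update_neq // ltnS leq_eqVlt.
case: eqP => [-> _|/eqP ji /= jlt]; first by rewrite updateE.
by rewrite update_neq ?ji ?orbT // h14.
Qed.

Definition best_start : cmd :=
  Seq (SetVar 35 (Cst 0)) (For 45 Nv
    (If (ESub (Get 15 (Idx Kv (Var 35))) (Get 15 (Idx Kv (Var 45)))) (SetVar 35 (Var 45)) Skip)).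

Lemma runs_best_start L n k s : s 0%N 0%N = n%:R -> s 0%N 1%N = k%:R ->
  (0 < n)%N -> (n <= L)%N ->
  runs L best_start (n * 5 + 5) s (fun s' => exists2 b : 'I_n, s' 35 0%N = b%:R &
     forall v, (v < n)%N -> s 15 (k * n + b)%N <= s 15 (k * n + v)%N).
Proof.
move=> sn sk n0 nL.
apply: (@runs_le _ _ (1 + (n * (2 + 3) + 3) + 1)); last by lia.
apply: runs_seq; apply: (@runs_set _ _ _ _ 0); [reflexivity|exact: fits0|].
apply: (@runs_for _ _ _ _ n 2 _ (fun i s' => exists2 b : 'I_n, s' 35 0%N = b%:R &
     forall v, (v < i)%N -> s 15 (k * n + b)%N <= s 15 (k * n + v)%N)).
- by [].
- by [].
- by rewrite /= address0 update_neq.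
- by [].
- by exists (Ordinal n0) => //; rewrite update_neq // updateE.
move=> i s1 iN ag si _ [b h35 le].
have fr a j : a \notin [:: 35; 45]%N -> s1 a j = s a j.
  rewrite !inE !negb_or => /andP[b1 b2]; rewrite ag ?update_neq ?b1 //.
  by rewrite /= !inE !negb_or b1 b2.
have eE : eval_expr s1 (ESub (Get 15 (Idx Kv (Var 35))) (Get 15 (Idx Kv (Var 45)))) =
    s 15 (k * n + b)%N - s 15 (k * n + i)%N.
  by rewrite /= address1 !address0 si h35 !(fr 0%N) // sn sk -natrM -!natrD !address_nat !fr.
apply: (@runs_if _ _ _ _ 1); rewrite eE ?subr_gt0 ?subr_le0 => h.
  apply: (@runs_set _ _ _ _ i%:R); [by rewrite /= address0|by apply: fits_natS; lia|].
  exists (Ordinal iN); first by rewrite update_neq // updateE.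
  move=> v; rewrite ltnS leq_eqVlt => /orP[/eqP -> //|/le h2].
  exact: le_trans (ltW h) h2.
apply: runs_skip; exists b; first by rewrite update_neq.
by move=> v; rewrite ltnS leq_eqVlt => /orP[/eqP -> //|/le].
Qed.

Definition trace_cell := Idx (ESub Kv (Var 43)) (Var 42).
Definition trace_walk : cmd :=
  Seq (SetVar 42 (Var 35)) (For 43 Kv
    (Seq (Assign 17 (Idx (Var 42) (Get 16 trace_cell)) (Cst 1))
         (SetVar 42 (Get 16 trace_cell)))).

Lemma path_edges_rcons n (v : 'I_n) p u :
  path_edges v (rcons p u) = rcons (path_edges v p) (last v p, u).
Proof.
elim: p v => [|w p IH] v //=.
by rewrite -[path_edges v (w :: rcons p u)]/((v, w) :: path_edges w (rcons p u)) IH.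
Qed.

Lemma runs_trace_walk L n k B wt s (b : 'I_n) : (0 < L)%N -> (n <= L)%N -> (k <= L)%N ->
  s 0%N 0%N = n%:R -> s 0%N 1%N = k%:R -> s 35 0%N = b%:R ->
  (forall e : edge n, s 17 (flat e) = 0) ->
  dp_upto n wt B s (k.+1 * n) ->
  runs L trace_walk (k * 6 + 5) s (fun s' => exists p : seq 'I_n,
    [/\ size p = k, \sum_(e <- path_edges b p) wt (flat e) = s 15 (k * n + b)%N &
        forall e : edge n, s' 17 (flat e) = (e \in path_edges b p)%:R]).
Proof.
move=> L0 nL kL sn sk sb s17 [d0 dr].
apply: (@runs_le _ _ (1 + (k * (3 + 3) + 3) + 1)); last by lia.
apply: runs_seq; apply: (@runs_set _ _ _ _ b%:R); first by rewrite /= address0.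
  by apply: fits_natS; have := ltn_ord b; lia.
(* The length traced so far plus the table entry for the [k - i] arcs to come stays equal to the
   entry of the start; row 0 contributes nothing in the end. *)
apply: runsW (@runs_for _ _ _ _ k 3 _ (fun i s' => exists p : seq 'I_n,
    [/\ size p = i, s' 42 0%N = (last b p : nat)%:R,
        \sum_(e <- path_edges b p) wt (flat e) + s 15 ((k - i) * n + last b p)%N =
          s 15 (k * n + b)%N &
        forall e : edge n, s' 17 (flat e) = (e \in path_edges b p)%:R]) _ _ _ _ _ _) (leqnn _) _.
- by [].
- by [].
- by rewrite /= address1 update_neq.
- by [].
- by exists [::]; split=> //; rewrite big_nil add0r subn0.
- move=> i s1 ik ag si _ [p [sp s42 sm s17']].
  set v := last b p in s42 sm.
  have fr a j : a \notin [:: 42; 43; 17]%N -> s1 a j = s a j.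
    rewrite !inE !negb_or => /and3P[b1 b2 b3]; rewrite ag ?update_neq ?b1 //.
    by rewrite /= !inE !negb_or b1 b2 b3.
  have jE : ((k - i.+1).+1 = k - i)%N by lia.
  have [] := dr (k - i.+1)%N v (ltn_ord v).
    by rewrite jE; have := ltn_ord v; nia.
  rewrite jE => _ [u un [pu du]] _.
  have cE s' : s' 0%N 0%N = n%:R -> s' 0%N 1%N = k%:R -> s' 43 0%N = i%:R -> s' 42 0%N = v%:R ->
      (forall j, s' 16 j = s 16 j) -> eval_expr s' (Get 16 trace_cell) = u%:R.
    move=> q1 q2 q3 q4 q5; rewrite /= address1 !address0 q1 q2 q3 q4 -natrB; last exact: ltnW.
    by rewrite -natrM -natrD address_nat q5 pu.
  apply: (@runs_le _ _ (1 + 1 + 1)) => //; apply: runs_seq.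
  apply: (@runs_store _ _ _ _ (flat (v, Ordinal un)) _ 1); [|reflexivity|exact: (fits_natS (m := 1))|].
    rewrite -[eval_expr _ _]/(s1 42 (address 0) * s1 0%N (address 0) + eval_expr s1 (Get 16 trace_cell)).
    rewrite cE // => [|||j]; try by rewrite fr.
    by rewrite address0 s42 fr // sn -natrM -natrD address_nat.
  apply: (@runs_set _ _ _ _ u%:R); [|by apply: fits_natS; lia|].
    by apply: cE => [||||j]; rewrite update_neq // fr.
  exists (rcons p (Ordinal un)); split.
  + by rewrite size_rcons sp.
  + by rewrite update_neq // updateE last_rcons.
  + rewrite path_edges_rcons -cats1 big_cat big_seq1 last_rcons -sm du /flat /=.
    by rewrite -/v -addrA.
  + move=> e; rewrite path_edges_rcons mem_rcons inE -/v.
    rewrite update_neq // update_neq //.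
    have [->|ne] := eqVneq e (v, Ordinal un); first by rewrite updateE; reflexivity.
    by rewrite update_neq ?s17' // (inj_eq (@flat_inj n)) ne orbT.
move=> s' _ _ [p [sp _ sm h]]; exists p; split=> //.
by rewrite -sm subnn mul0n add0n d0 // addr0.
Qed.

Lemma notin_sub (X Y : seq nat) a : a \notin Y -> all (fun b => b \in Y) X -> a \notin X.
Proof. by move=> aY /allP XY; apply: contra aY; exact: XY. Qed.

Definition keep_best : cmd :=
  If (ESub (EDiv (Var 39) (Var 36)) (Var 41))
    (Seq (SetVar 41 (EDiv (Var 39) (Var 36)))
      (For 31 NN (Assign 10 (Var 31)
         (EAdd (EDiv (Get 11 (Var 31)) (Var 39)) (ESub (Cst 1) (Get 13 (Var 31))))))) Skip.

Lemma runs_keep_best L n s q : s 0%N 0%N = n%:R -> (n * n <= L)%N ->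
  s 39 0%N / s 36 0%N = q -> fits L q ->
  (forall i, (i < n * n)%N -> fits L (s 11 i / s 39 0%N + (1 - s 13 i))) ->
  runs L keep_best (n * n * 4 + 6) s (fun s' =>
    if s 41 0%N < q then s' 41 0%N = q /\
      forall i, (i < n * n)%N -> s' 10 i = s 11 i / s 39 0%N + (1 - s 13 i)
    else s' 41 0%N = s 41 0%N /\ forall i, s' 10 i = s 10 i).
Proof.
move=> sn nL qE fq fx.
have eE : eval_expr s (EDiv (Var 39) (Var 36)) = q by rewrite /= address0.
apply: (@runs_le _ _ ((1 + (n * n * (1 + 3) + 3) + 1) + 1)); last by lia.
apply: runs_if; rewrite -[eval_expr s _]/(eval_expr s (EDiv (Var 39) (Var 36)) - s 41 (address 0));
  rewrite eE address0 ?subr_gt0 ?subr_le0 => h; last first.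
  apply: (@runs_le _ _ 1); last by lia.
  by apply: runs_skip; rewrite ltNge h.
rewrite h; apply: runs_seq; apply: (@runs_set _ _ _ _ q) => //.
apply: (@runs_for _ _ _ _ (n * n) 1 _ (fun i s' => s' 41 0%N = q /\
    forall j, (j < i)%N -> s' 10 j = s 11 j / s 39 0%N + (1 - s 13 j))).
- by [].
- by [].
- by apply: eval_NN; rewrite !update_neq.
- by [].
- by split; [reflexivity|].
move=> i s1 iN ag si _ [h41 h10].
apply: (@runs_store _ _ _ _ i _ (s 11 i / s 39 0%N + (1 - s 13 i))).
- by rewrite /= address0 si address_nat.
- by rewrite /= !address0 si !address_nat !ag // !update_neq.
- exact: fx.
rewrite !update_neq //; split=> // j; rewrite update_neq // ltnS leq_eqVlt.
case: eqP => [-> _|/eqP ji /= jlt]; first by rewrite updateE.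
by rewrite update_neq ?ji ?orbT // h10.
Qed.

Definition bump_term := EMul (Get 17 (Var 31)) (Get 12 (Var 31)).
(** The second loop also clears array 17, so that the next walk finds it empty. *)
Definition bump_weights (rate : rat) : cmd :=
  Seq (SetVar 40 (Cst 0)) (Seq (For 31 NN (SetVar 40 (EAdd (Var 40) bump_term)))
    (Seq (SetVar 44 (EDiv (Cst rate) (Var 40)))
      (For 31 NN (Seq (Assign 11 (Var 31)
          (EMul (Get 11 (Var 31)) (EAdd (Cst 1) (EMul (Var 44) bump_term))))
        (Assign 17 (Var 31) (Cst 0)))))).

Lemma runs_bump_weights L n b s rate h f : s 0%N 0%N = n%:R -> (n * n <= L)%N ->
  (n * n * b <= L)%N -> (forall i, (i < n * n)%N -> fits b (s 17 i * s 12 i)) ->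
  h = \sum_(0 <= i < n * n) s 17 i * s 12 i -> f = rate / h -> fits L f ->
  (forall i, (i < n * n)%N -> fits L (s 11 i * (1 + f * (s 17 i * s 12 i)))) ->
  runs L (bump_weights rate) (n * n * 10 + 11) s (fun s' => forall i, (i < n * n)%N ->
    s' 11 i = s 11 i * (1 + f * (s 17 i * s 12 i)) /\ s' 17 i = 0).
Proof.
move=> sn nL bL fb hE fE ff fy; set N := (n * n)%N.
apply: (@runs_le _ _ (1 + (N * (1 + 3) + 3 + (1 + (N * (3 + 3) + 3) + 1) + 1) + 1)); last by lia.
apply: runs_seq; apply: (@runs_set _ _ _ _ 0); [reflexivity|exact: fits0|].
apply: runs_seq.
apply: runsW (@runs_for _ _ _ _ N 1 _ (fun i s' =>
    s' 40 0%N = \sum_(0 <= j < i) s 17 j * s 12 j) _ _ _ _ _ _) (leqnn _) _.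
- by [].
- by [].
- by apply: eval_NN; rewrite !update_neq.
- by [].
- by rewrite big_geq.
- move=> i s1 iN ag si _ h40.
  apply: (@runs_set _ _ _ _ (\sum_(0 <= j < i.+1) s 17 j * s 12 j)).
  + rewrite /= !address0 si !address_nat h40 (ag 17%N isT) (ag 12%N isT).
    by rewrite big_nat_recr; [reflexivity|exact: leq0n].
  + apply: (@fitsW (i.+1 * b)); first by apply: leq_trans bL; rewrite leq_mul2r iN orbT.
    by apply: fits_sum => j ji; apply: fb; exact: leq_trans iN.
  by reflexivity.
move=> s1 ag _ h40.
have fr a j : a \notin [:: 31; 40]%N -> s1 a j = s a j.
  rewrite !inE !negb_or => /andP[b1 b2]; rewrite ag ?update_neq ?b2 //.
  by rewrite /= !inE !negb_or b1 b2.
apply: runs_seq; apply: (@runs_set _ _ _ _ f) => //.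
  by rewrite /= address0 h40 -hE -fE.
(* The update is in place, so the invariant must also say that the cells from [i] on still hold the
   old values. *)
apply: runsW (@runs_for _ _ _ _ N 3 _ (fun i s' =>
    (forall j, (j < i)%N -> s' 11 j = s 11 j * (1 + f * (s 17 j * s 12 j)) /\ s' 17 j = 0) /\
    (forall j, (i <= j)%N -> s' 11 j = s 11 j /\ s' 17 j = s 17 j)) _ _ _ _ _ _) (leqnn _) _.
- by [].
- by [].
- by apply: eval_NN; rewrite !update_neq // fr.
- by [].
- by split=> // j _; rewrite !update_neq // !fr.
- move=> i s2 iN ag2 si _ [hlt hge].
  have [e11 e17] := hge i (leqnn _).
  apply: (@runs_le _ _ (1 + 1 + 1)) => //; apply: runs_seq.
  apply: (@runs_store _ _ _ _ i _ (s 11 i * (1 + f * (s 17 i * s 12 i)))).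
  + by rewrite /= address0 si address_nat.
  + rewrite /= !address0 si !address_nat e11 e17 (ag2 44%N) // updateE (ag2 12%N) //.
    by rewrite update_neq // fr.
  + exact: fy.
  apply: (@runs_store _ _ _ _ i _ 0); [|reflexivity|exact: fits0|].
    by rewrite /= address0 update_neq // si address_nat.
  split=> j.
    rewrite ltnS leq_eqVlt => /orP[/eqP ->|ji].
      by rewrite /update /= !eqxx; split; reflexivity.
    have [q1 q2] := hlt _ ji.
    by rewrite !update_neq ?(ltn_eqF ji) ?orbT.
  move=> ij; have [q1 q2] := hge _ (ltnW ij).
  by rewrite !update_neq ?(gtn_eqF ij) ?orbT.
by move=> s2 _ _ [h1 _].
Qed.

(* Locked, to keep conversion from computing with rational literals. *)
Definition mw_rate : rat := locked (1 / 2000%:R).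

Lemma fits_mw_rate : fits 12 mw_rate.
Proof.
have f1 : fits 1 (1 : rat) by exact: (fits_natS (m := 1)).
have f2 : fits 11 (2000%:R : rat) by apply: fits_nat.
by rewrite /mw_rate -lock; exact: fits_div f1 f2.
Qed.

Section Step.
Variables (n k : nat) (c ic : edge n -> rat) (p : edge n -> bool).

(** Plays the role of infinity: it exceeds the weight of any walk with at most [n] arcs, yet it is a
    rational of controlled size. *)
Definition big_length (y : edge n -> rat) : rat := 1 + n%:R * \sum_e y e.
Definition arc_length (y : edge n -> rat) (e : edge n) : rat :=
  y e + (1 - (p e)%:R) * big_length y.
Definition walk_length y (b : 'I_n) q : rat := \sum_(e <- path_edges b q) arc_length y e.

(* [r] is the best value of (shortest length) / volume found so far, and [x] the
   corresponding LP solution. *)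
Definition mw_step (y x : edge n -> rat) (r : rat) (y' x' : edge n -> rat) (r' : rat) :=
  exists b q, let alpha := walk_length y b q in
    [/\ size q = k, forall b' q', size q' = k -> alpha <= walk_length y b' q' &
        if alpha < big_length y then
          (forall e, y' e = y e *
             (1 + mw_rate / (\sum_e' (e' \in path_edges b q)%:R * ic e') *
                  ((e \in path_edges b q)%:R * ic e))) /\
          (if r < alpha / \sum_e c e * y e then
             r' = alpha / (\sum_e c e * y e) /\ x' =1 (fun e => y e / alpha + (1 - (p e)%:R))
           else r' = r /\ x' =1 x)
        else [/\ y' =1 y, x' =1 x & r' = r]].

Definition lp_const (s : store) :=
  [/\ s 0%N 0%N = n%:R, s 0%N 1%N = k%:R, forall e, s 2 (flat e) = c e,
      forall e, s 12 (flat e) = ic e & forall e, s 13 (flat e) = (p e)%:R].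

Definition lp_vars (y x : edge n -> rat) (r : rat) (s : store) :=
  [/\ forall e, s 11 (flat e) = y e, forall e, s 10 (flat e) = x e, s 41 0%N = r,
      forall e : edge n, s 17 (flat e) = 0 & forall v, (v < n)%N -> s 15 v = 0].

Definition mw_iteration : cmd :=
  Seq sum_weights (Seq set_lengths (Seq shortest_walks (Seq best_start
    (Seq (SetVar 39 (Get 15 (Idx Kv (Var 35))))
      (If (ESub (Var 38) (Var 39)) (Seq trace_walk (Seq keep_best (bump_weights mw_rate))) Skip))))).

Lemma dp_upto_le wt B s (b : 'I_n) (q : seq 'I_n) : dp_upto n wt B s (k.+1 * n) -> (size q <= k)%N ->
  s 15 (size q * n + b)%N <= \sum_(e <- path_edges b q) wt (flat e).
Proof.
move=> [h0 hr]; elim: q b => [|u q IH] b qk.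
  by rewrite mul0n add0n h0 // big_nil lexx.
rewrite -[path_edges b _]/((b, u) :: path_edges u q) big_cons [size _]/=.
have [] := hr (size q) b (ltn_ord b).
  by have := ltn_ord b; move: qk; rewrite /=; nia.
move=> _ _ /(_ u (ltn_ord u)) h; apply: le_trans h _.
by rewrite /flat /= lerD2l; apply: IH; exact: ltnW.
Qed.

Definition length_bits B := (B + (1 + 1 + (1 + (n + n * n * B))))%N.
(** Bits gained by a weight in one step: 1 for the constant 1, 12 for the rate, [n * n * (1 + S)]
    for the sum of inverse costs on the walk, [1 + S] for the inverse cost of the arc. It does not
    involve the present size of the weights, so growth over many steps is linear and not
    exponential. *)
Definition weight_growth S := (1 + (12 + n * n * (1 + S) + (1 + S)))%N.

Lemma runs_mw_iteration L S B s y x r : (k < n)%N -> (S <= B)%N ->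
  (n * length_bits B + n * n * (B + B) + B + n + n * n + 30 + n * n * (1 + S) + S <= L)%N ->
  lp_const s -> lp_vars y x r s ->
  (forall e, fits S (c e)) -> (forall e, fits S (ic e)) -> (forall e, fits B (y e)) ->
  runs L mw_iteration (n * n * n * 100 + 100) s (fun s' => exists y' x' r',
    [/\ lp_vars y' x' r' s', mw_step y x r y' x' r' &
        forall e, fits (B + weight_growth S) (y' e)]).
Proof.
move=> kn SB hL [sn sk s2 s12 s13] [s11 s10 s41 s17 s15] fc fic fy.
have n0 : (0 < n)%N by lia.
set Bw := length_bits B in hL.
have nBw : (Bw <= n * Bw)%N by rewrite leq_pmull.
have kBw : ((k + 1) * Bw <= n * Bw)%N by rewrite leq_mul2r; apply/orP; right; lia.
have hM : (1 + (n + n * n * B) <= Bw)%N by rewrite /Bw /length_bits; lia.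
have f01 (a : bool) : fits 1 (a%:R : rat) by apply: fits_natS; case: a.
have DE : \sum_(0 <= i < n * n) s 2 i * s 11 i = \sum_e c e * y e.
  by rewrite sum_flat; apply: eq_bigr => e _; rewrite s2 s11.
have YE : \sum_(0 <= i < n * n) s 11 i = \sum_e y e.
  by rewrite sum_flat; apply: eq_bigr => e _; rewrite s11.
have f11 i : (i < n * n)%N -> fits B (s 11 i) by apply: fits_flatP => e; rewrite s11.
have f2 i : (i < n * n)%N -> fits B (s 2 i).
  by apply: fits_flatP => e; rewrite s2; apply: fitsW SB _.
have fD : fits (n * n * (B + B)) (\sum_e c e * y e).
  by rewrite -DE; apply: fits_sum => i iN; apply: fits_mul; [exact: f2|exact: f11].
have fM : fits (1 + (n + n * n * B)) (big_length y).
  apply: fits_add; first exact: (f01 true).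
  by apply: fits_mul; [exact: fits_natS|rewrite -YE; exact: fits_sum].
have flen e : fits Bw (arc_length y e).
  apply: fits_add; first exact: fy.
  by apply: fits_mul fM; apply: fits_sub; [exact: (f01 true)|exact: f01].
apply: (@runs_le _ _ ((n * n * 6 + 7) + ((n * n * 4 + 5) + ((k * (n * (n * 7 + 10) + 3 + 3) + 3) +
   ((n * 5 + 5) + (1 + (((k * 6 + 5) + ((n * n * 4 + 6) + (n * n * 10 + 11) + 1) + 1) + 1) + 1) + 1) + 1) + 1) + 1)); last first.
  have h1 : (k * (n * (n * 7 + 10) + 3 + 3) <= n * (n * (n * 7 + 10) + 6))%N.
    by rewrite -addnA leq_mul2r (ltnW kn) orbT.
  have h2 : (n <= n * n)%N by rewrite leq_pmull.
  have h3 : (n * n <= n * n * n)%N by rewrite leq_pmulr.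
  by lia.
apply: runs_seq.
apply: runsW (runs_sum_weights sn _ _ f2 f11) (leqnn _) _; [lia|lia|].
rewrite DE YE => s1 ag1 _ [s1D s1Y].
apply: runs_seq.
apply: runsW (@runs_set_lengths _ n _ (big_length y) _ _ _ _ _) (leqnn _) _.
- by rewrite ag1.
- by lia.
- by rewrite s1Y.
- by apply: fitsW fM; lia.
- move=> i iN; apply: (@fitsW Bw); first lia.
  by case/flat_surj: iN => e <-; rewrite !ag1 // s11 s13; exact: flen.
move=> s2' ag2 _ [sM s14].
have {}s14 e : s2' 14 (flat e) = arc_length y e.
  by rewrite s14 ?flat_lt // !ag1 // s11 s13.
apply: runs_seq.
pose wt i := s2' 14 i.
apply: runsW (@runs_shortest_walks _ n k Bw wt _ _ _ _ _ _ _ _ _) (leqnn _) _ => //.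
- by lia.
- by lia.
- by lia.
- by rewrite ag2 // ag1.
- by rewrite ag2 // ag1.
- by move=> v vn; rewrite ag2 // ag1 // s15.
- by move=> i /flat_surj[e <-]; split=> //; rewrite /wt s14.
move=> s3 ag3 _ dp3.
have fr3 a i : a \notin [:: 36; 37; 31; 38; 14; 32; 33; 34; 15; 16]%N -> s3 a i = s a i.
  move=> ha; rewrite ag3; last by apply: (notin_sub ha).
  rewrite ag2; last by apply: (notin_sub ha).
  by rewrite ag1 //; apply: (notin_sub ha).
apply: runs_seq.
apply: runsW (@runs_best_start _ n k _ _ _ _ _) (leqnn _) _ => //.
- by rewrite fr3.
- by rewrite fr3.
- by lia.
move=> s4 ag4 _ [b s4b bmin].
have fr4 a i : a \notin [:: 35; 45]%N -> s4 a i = s3 a i.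
  by move=> ha; apply: ag4; apply: (notin_sub ha).
set alpha := s3 15 (k * n + b)%N in bmin.
have falpha : fits (k * Bw) alpha.
  have := @dp_upto_level n wt Bw s3 k 0 b; rewrite addn0; exact.
apply: runs_seq; apply: (@runs_set _ _ _ _ alpha).
- rewrite /= address1 !address0 s4b !(fr4 0%N) // !(fr3 0%N) // sn sk -natrM -natrD address_nat.
  by rewrite (fr4 15%N).
- by apply: fitsW falpha; lia.
set s5 := update _ _ _ _.
have fr5 a i : a != 39%N -> s5 a i = s4 a i by move=> ha; rewrite /s5 update_neq // ha.
have dp5 : dp_upto n wt Bw s5 (k.+1 * n).
  by apply: dp_upto_stable dp3 => [|i _]; [nia|rewrite !fr5 // !fr4].
have amin b' q' : size q' = k -> alpha <= walk_length y b' q'.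
  move=> sq; apply: le_trans (bmin b' (ltn_ord b')) _.
  have := @dp_upto_le wt Bw s3 b' q' dp3; rewrite sq => /(_ (leqnn _)) h; apply: le_trans h _.
  by rewrite /walk_length; apply: ler_sum => e _; rewrite /wt s14.
have s5M : s5 38 0%N = big_length y by rewrite fr5 // fr4 // ag3.
have s5a : s5 39 0%N = alpha by reflexivity.
have fr5' a i : a \notin [:: 35; 45; 39; 36; 37; 31; 38; 14; 32; 33; 34; 15; 16]%N -> s5 a i = s a i.
  move=> ha; rewrite fr5; last by apply: contra ha => /eqP ->.
  rewrite fr4; last by apply: (notin_sub ha).
  by rewrite fr3 //; apply: (notin_sub ha).
have s5_15 v : (v < n)%N -> s5 15 v = 0 by have [+ _] := dp5; apply.
have alphaE q : \sum_(e <- path_edges b q) wt (flat e) = walk_length y b q.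
  by apply: eq_bigr => e _; rewrite /wt s14.
(* If no walk is short enough the program does not trace one, so the walk demanded by [mw_step] is
   read off the table here. *)
have ex_walk : exists q : seq 'I_n, size q = k /\ walk_length y b q = alpha.
  have main j (v : 'I_n) : (j <= k)%N -> exists q : seq 'I_n, size q = j /\
      \sum_(e <- path_edges v q) wt (flat e) = s3 15 (j * n + v)%N.
    elim: j v => [|j IH] v jk.
      by exists [::]; split=> //; have [d0 _] := dp3; rewrite mul0n add0n d0 // big_nil.
    have [_ hr] := dp3; have [] := hr j v (ltn_ord v).
      by have := ltn_ord v; nia.
    move=> _ [u un [_ du]] _; have [q [sq qE]] := IH (Ordinal un) (ltnW jk).
    exists (Ordinal un :: q); split; first by rewrite /= sq.
    rewrite -[path_edges v _]/((v, Ordinal un) :: path_edges (Ordinal un) q) big_cons qE du.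
    by reflexivity.
  by have [q [sq qE]] := main k b (leqnn _); exists q; split=> //; rewrite -alphaE.
apply: runs_if; rewrite -[eval_expr s5 _]/(s5 38 (address 0) - s5 39 (address 0)) address0 s5M s5a
   ?subr_gt0 ?subr_le0 => h; last first.
  apply: (@runs_le _ _ 1); last by lia.
  have [q [sq qE]] := ex_walk.
  apply: runs_skip; exists y, x, r; split.
  - by split=> [e|e||e|//]; rewrite fr5'.
  - exists b, q => /=; rewrite qE; split=> //.
    by rewrite ltNge h.
  - by move=> e; apply: fitsW (fy e); rewrite leq_addr.
apply: runs_seq.
apply: runsW (@runs_trace_walk _ n k Bw wt _ b _ _ _ _ _ _ _ dp5) (leqnn _) _.
- by lia.
- by lia.
- by lia.
- by rewrite fr5'.
- by rewrite fr5'.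
- by rewrite fr5 // s4b.
- by move=> e; rewrite fr5'.
move=> s6 ag6 _ [q [sq qE s6m]].
have {}qE : walk_length y b q = alpha by rewrite -alphaE qE fr5 // fr4.
have fr6 a i : a \notin [:: 42; 43; 17]%N -> s6 a i = s5 a i.
  by move=> ha; apply: ag6; apply: (notin_sub ha).
have s6D : s6 36 0%N = \sum_e c e * y e.
  by rewrite fr6 // fr5 // fr4 // ag3 // ag2.
have s6a : s6 39 0%N = alpha by rewrite fr6.
apply: runs_seq.
apply: runsW (@runs_keep_best _ n _ (alpha / \sum_e c e * y e) _ _ _ _ _) (leqnn _) _.
- by rewrite fr6 // fr5'.
- by lia.
- by rewrite s6a s6D.
- by apply: fitsW (fits_div falpha fD); lia.
- move=> i /flat_surj[e <-]; rewrite s6a !fr6 // !fr5' // s11 s13.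
  apply: (@fitsW (B + k * Bw + (1 + 1))); first lia.
  apply: fits_add; first exact: fits_div.
  by apply: fits_sub; [exact: (f01 true)|exact: f01].
move=> s7 ag7 _ h7.
have fr7 a i : a \notin [:: 41; 31; 10]%N -> s7 a i = s6 a i.
  by move=> ha; apply: ag7; apply: (notin_sub ha).
have s7t e : s7 17 (flat e) * s7 12 (flat e) = (e \in path_edges b q)%:R * ic e.
  by rewrite !fr7 // s6m fr6 // fr5' // s12.
have s7y e : s7 11 (flat e) = y e by rewrite fr7 // fr6 // fr5'.
have s7n : s7 0%N 0%N = n%:R by rewrite fr7 // fr6 // fr5'.
pose H := \sum_e' ((e' \in path_edges b q)%:R * ic e').
have ft i : (i < n * n)%N -> fits (1 + S) (s7 17 i * s7 12 i).
  by case/flat_surj => e <-; rewrite s7t; apply: fits_mul.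
have HE : H = \sum_(0 <= i < n * n) s7 17 i * s7 12 i.
  by rewrite sum_flat; apply: eq_bigr => e _; rewrite s7t.
have fH : fits (n * n * (1 + S)) H by rewrite HE; exact: fits_sum.
have frate := fits_mw_rate.
have ff : fits (12 + n * n * (1 + S)) (mw_rate / H) by exact: fits_div.
have fy' e : fits (B + weight_growth S)
    (y e * (1 + mw_rate / H * ((e \in path_edges b q)%:R * ic e))).
  apply: fits_mul; first exact: fy.
  apply: fits_add; first exact: (f01 true).
  by apply: fits_mul; [exact: ff|apply: fits_mul].
apply: runsW (@runs_bump_weights _ n (1 + S) _ mw_rate H (mw_rate / H) _ _ _ ft HE erefl _ _) (leqnn _) _.
- exact: s7n.
- by lia.
- by lia.
- by apply: fitsW ff; lia.
- move=> i /flat_surj[e <-]; rewrite s7t s7y; apply: fitsW (fy' e).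
  by rewrite /weight_growth; lia.
move=> s8 ag8 _ h8; clear HE.
have fr8 a i : a \notin [:: 40; 31; 44; 11; 17]%N -> s8 a i = s7 a i.
  by move=> ha; apply: ag8; apply: (notin_sub ha).
exists (fun e => y e * (1 + mw_rate / H * ((e \in path_edges b q)%:R * ic e))).
exists (fun e => s7 10 (flat e)), (s7 41 0%N); split; last exact: fy'.
- split.
  + move=> e; have [-> _] := h8 _ (flat_lt e); rewrite s7t s7y; reflexivity.
  + move=> e; exact: (fr8 10%N _ isT).
  + exact: (fr8 41%N _ isT).
  + move=> e; exact: (h8 _ (flat_lt e)).2.
  + move=> v vn; rewrite (fr8 15%N _ isT) (fr7 15%N _ isT) (fr6 15%N _ isT); exact: s5_15.
exists b, q; rewrite /= qE; split; [exact: sq|exact: amin|].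
rewrite h; split; first by move=> e; reflexivity.
clear h8 ff fy' frate fH ft; move: h7; rewrite s6a (fr6 41%N _ isT) (fr5' 41%N _ isT) s41.
case: ifP => _ [-> hx]; (split; first reflexivity) => e.
  rewrite hx ?flat_lt // (fr6 11%N _ isT) (fr6 13%N _ isT) (fr5' 11%N _ isT) (fr5' 13%N _ isT).
  rewrite s11 s13; reflexivity.
rewrite hx (fr6 10%N _ isT) (fr5' 10%N _ isT); exact: s10.
Qed.

End Step.

(** * The multiplicative weights method on a dag *)

Lemma path_edges_all n (E : {set edge n}) v p :
  path (adj E) v p = all (fun e => e \in E) (path_edges v p).
Proof.
elim: p v => // u p IH v.
by rewrite -[path_edges v _]/((v, u) :: path_edges u p) [path _ _ _]/= IH.
Qed.

Lemma size_path_edges n (v : 'I_n) p : size (path_edges v p) = size p.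
Proof. by rewrite size_zip /= (minn_idPr _). Qed.

(** A repeated vertex would close a cycle. Hence shortest walks, which dynamic programming can find,
    are as good as paths once they stay on arcs. *)
Lemma dag_path_uniq (F : realFieldType) (G : dag F) v p :
  path (adj (arcs G)) v p -> uniq (v :: p).
Proof.
elim: p v => // u p IH v vup; have /andP[_ /IH up] := vup.
rewrite cons_uniq up andbT; apply/negP => vp.
case/splitPr: vp vup => p1 p2; rewrite cat_path /= => /and3P[h1 h2 _].
have := @arcs_acyclic _ G (v :: p1); rewrite /= rcons_path h1 h2 => /(_ isT).
by [].
Qed.

Lemma dag_path_edges_uniq (F : realFieldType) (G : dag F) v p :
  path (adj (arcs G)) v p -> uniq (path_edges v p).
Proof. by move=> /dag_path_uniq; exact: zip_uniql. Qed.

Lemma ratr_frac (R : realType) (a b : nat) : ratr (a%:R / b%:R) = a%:R / b%:R :> R.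
Proof. by rewrite fmorph_div /= !ratr_nat. Qed.

Lemma mw_rate_ge0 : 0 <= mw_rate.
Proof. by rewrite /mw_rate -lock; apply: divr_ge0; [exact: ler01|exact: ler0n]. Qed.

Lemma ratr_mw_rate (R : realType) : ratr mw_rate = 1 / 2000 :> R.
Proof. rewrite /mw_rate -lock; exact: (ratr_frac R 1 2000). Qed.

Definition mw_slack : rat := locked (1001%:R / 1000%:R).

Lemma mw_slack_gt0 : 0 < mw_slack.
Proof. by rewrite /mw_slack -lock; apply: divr_gt0; exact: ltr0Sn. Qed.

Lemma ratr_mw_slack (R : realType) : ratr mw_slack = 1001 / 1000 :> R.
Proof. rewrite /mw_slack -lock; exact: (ratr_frac R 1001 1000). Qed.

Section MultiplicativeWeights.
Variables (G : dag rat) (k : nat).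
Hypothesis k_lt : (k < nverts G)%N.
Notation n := (nverts G).

Definition arc_cost (e : edge n) : rat := if e \in arcs G then cost e else 0.
(** Only these pairs carry weights. Arcs of cost zero get LP value 1 for free, and pairs that are
    not arcs are treated alike. *)
Definition costly : {set edge n} := [set e | 0 < arc_cost e].
Notation pos := (fun e => e \in costly).

Lemma costly_arc e : e \in costly -> e \in arcs G.
Proof. by rewrite inE /arc_cost; case: ifP => //; rewrite ltxx. Qed.

Lemma arc_cost_ge0 e : 0 <= arc_cost e.
Proof. by rewrite /arc_cost; case: ifP => [/cost_ge0|]. Qed.

Lemma arc_cost0 e : e \notin costly -> arc_cost e = 0.
Proof. by rewrite inE -leNgt => h; apply/eqP; rewrite eq_le h arc_cost_ge0. Qed.

Lemma costly_path v p : all pos (path_edges v p) -> path (adj (arcs G)) v p.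
Proof.
by rewrite path_edges_all => /allP h; apply/allP => e /h; exact: costly_arc.
Qed.

Definition weights_ok (y : edge n -> rat) :=
  (forall e, e \in costly -> 0 < y e) /\ (forall e, e \notin costly -> y e = 0).

Section Weights.
Variable y : edge n -> rat.
Hypothesis y_ok : weights_ok y.

Lemma weights_ge0 e : 0 <= y e.
Proof. by have [h1 h2] := y_ok; case: (boolP (e \in costly)) => [/h1/ltW|/h2 ->]. Qed.

Lemma sum_weights_ge0 : 0 <= \sum_e y e.
Proof. by apply: sumr_ge0 => e _; exact: weights_ge0. Qed.

Lemma big_length_gt0 : 0 < big_length y.
Proof. by rewrite /big_length ltr_pwDl // mulr_ge0 ?ler0n ?sum_weights_ge0. Qed.

Lemma arc_length_pos e : e \in costly -> arc_length pos y e = y e.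
Proof. by move=> ep; rewrite /arc_length ep subrr mul0r addr0. Qed.

Lemma arc_length_npos e : e \notin costly -> arc_length pos y e = big_length y.
Proof.
by move=> ep; rewrite /arc_length (negPf ep) subr0 mul1r y_ok.2 // add0r.
Qed.

Lemma arc_length_ge0 e : 0 <= arc_length pos y e.
Proof.
case: (boolP (e \in costly)) => ep.
  by rewrite arc_length_pos ?weights_ge0.
by rewrite arc_length_npos // ltW // big_length_gt0.
Qed.

(** A single pair outside [costly] already has length [big_length], and no length is negative. *)
Lemma short_walk_costly b q : walk_length pos y b q < big_length y ->
  all pos (path_edges b q).
Proof.
move=> h; apply/allP => e eq; apply/negPn/negP => ne; move: h; rewrite ltNge => /negP; apply.
rewrite /walk_length (big_rem e) //= arc_length_npos // lerDl.
by apply: sumr_ge0 => e' _; exact: arc_length_ge0.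
Qed.

Lemma costly_walk_length b q : all pos (path_edges b q) ->
  walk_length pos y b q = \sum_(e <- path_edges b q) y e.
Proof.
move=> /allP h; rewrite /walk_length big_seq [RHS]big_seq.
by apply: eq_bigr => e /h ep; exact: arc_length_pos.
Qed.

(** Each arc weighs at most the total weight, and the 1 in [big_length] makes the inequality strict.
    With [short_walk_costly], comparing the shortest length to [big_length] decides whether a walk
    with [k] costly arcs exists. *)
Lemma costly_walk_short b q : (size q < n)%N -> all pos (path_edges b q) ->
  walk_length pos y b q < big_length y.
Proof.
move=> sq h; rewrite costly_walk_length //.
apply: le_lt_trans (_ : n%:R * \sum_e y e < _); last by rewrite /big_length ltrDr.
apply: le_trans (_ : \sum_(e <- path_edges b q) \sum_e' y e' <= _).
  apply: ler_sum => e _; rewrite (bigD1 e) //= lerDl; apply: sumr_ge0 => e' _.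
  exact: weights_ge0.
rewrite big_const_seq count_predT size_path_edges -Monoid.iteropE -[leLHS]/(_ *+ _).
by rewrite -[leLHS]mulr_natl; apply: ler_wpM2r; [exact: sum_weights_ge0|rewrite ler_nat ltnW].
Qed.

End Weights.

Lemma all_nposP v p : all pos (path_edges v p) \/ exists2 e, e \in path_edges v p & e \notin costly.
Proof.
case: (boolP (all _ _)) => h; [by left|right].
by case/allPn: h => e e1 e2; exists e.
Qed.

(** A path through an arc outside [costly] has length at least 1 from this arc alone, so only costly
    paths constrain [z]. *)
Lemma free_solution_feasible (z : edge n -> rat) : (forall e, 0 <= z e) ->
  (forall v p, size p = k -> all pos (path_edges v p) -> 1 <= \sum_(e <- path_edges v p) z e) ->
  lp_feasible k (fun e => z e + (1 - (e \in costly)%:R)).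
Proof.
move=> z0 hz; have x0 e : 0 <= z e + (1 - (e \in costly)%:R).
  by apply: addr_ge0 => //; case: (e \in costly); rewrite ?subrr ?subr0.
split=> [v p sp _|e _] //.
case: (all_nposP v p) => [h|[e e1 e2]].
  apply: le_trans (hz _ _ sp h) _; apply: ler_sum => e _; rewrite lerDl.
  by case: (e \in costly); rewrite ?subrr ?subr0.
rewrite (big_rem e) //= (negPf e2) subr0.
apply: le_trans (_ : z e + 1 <= _); first by rewrite lerDr.
by rewrite lerDl; apply: sumr_ge0.
Qed.

Lemma free_solution_cost (z : edge n -> rat) :
  lp_cost (G := G) (fun e => z e + (1 - (e \in costly)%:R)) = \sum_e arc_cost e * z e.
Proof.
rewrite /lp_cost big_mkcond; apply: eq_bigr => e _.
have [eA|eA] := boolP (e \in arcs G); last by rewrite /arc_cost (negPf eA) mul0r.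
have -> : cost e = arc_cost e by rewrite /arc_cost eA.
case: (boolP (e \in costly)) => ep; first by rewrite subrr addr0.
by rewrite arc_cost0 // !mul0r.
Qed.

Notation step := (mw_step k arc_cost (fun e => (arc_cost e)^-1) pos).

Lemma mw_step_weights y x r y' x' r' : weights_ok y -> step y x r y' x' r' -> weights_ok y'.
Proof.
move=> yk [b [q [_ _]]]; case: ifP => [_ [hy _]|_ [hy _ _]].
  split=> e ep; rewrite hy; last by rewrite yk.2 // mul0r.
  apply: mulr_gt0; first exact: yk.1.
  apply: ltr_pwDl => //; apply: mulr_ge0; last first.
    by apply: mulr_ge0; rewrite ?ler0n ?invr_ge0 ?arc_cost_ge0.
  apply: divr_ge0; first exact: mw_rate_ge0.
  by apply: sumr_ge0 => e' _; apply: mulr_ge0; rewrite ?ler0n ?invr_ge0 ?arc_cost_ge0.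
by split=> e ep; rewrite hy; [exact: yk.1|exact: yk.2].
Qed.

(** Covers graphs in which every walk with [k] steps leaves [costly]: the initial solution, of cost
    zero, is then never replaced. *)
Lemma mw_step_idle y x r y' x' r' : weights_ok y ->
  (forall b q, size q = k -> ~~ all pos (path_edges b q)) ->
  step y x r y' x' r' -> x' =1 x.
Proof.
move=> yk none [b [q [sq _]]]; case: ifP => [lt _|_ [_ hx _] //].
by have := none b q sq; rewrite (short_walk_costly yk lt).
Qed.

(** [ded_solution] speaks of simple paths only; a costly walk is one by acyclicity. *)
Lemma solution_meets S b q : ded_solution k S -> size q = k ->
  all pos (path_edges b q) -> exists2 e, e \in path_edges b q & e \in S :&: costly.
Proof.
move=> /andP[_ /forallP hS] sq ap.
have /forallP/(_ (tcast sq (in_tuple q))) := hS b.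
rewrite val_tcast /= /dipath (dag_path_uniq (costly_path ap)) andbT path_edges_all.
case/allPn => e e1 e2; exists e => //; rewrite inE (allP ap _ e1) andbT.
by apply: contraNT e2 => eS; rewrite inE eS costly_arc // (allP ap).
Qed.

Section Progress.
Variables (R : realType) (S : {set edge n}).
Hypothesis S_sol : ded_solution k S.
Hypothesis costly_walk : exists (b : 'I_n) q, size q = k /\ all pos (path_edges b q).

(** The integral solution that serves as a benchmark. Its arcs of cost zero are dropped because the
    potential needs positive costs; the rest still meets every costly walk. *)
Let C := S :&: costly.
Let opt : rat := \sum_(e in C) arc_cost e.
Let cR (e : edge n) : R := ratr (arc_cost e).
Let pot (y : edge n -> rat) : R := potential costly C cR (fun e => ratr (y e)).

Let cR_gt0 e : e \in costly -> 0 < cR e.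
Proof. by rewrite inE => h; rewrite /cR ltr0q. Qed.

Let C_sub : C \subset costly. Proof. exact: subsetIr. Qed.

Let C_neq0 : C != finset.set0.
Proof.
have [b [q [sq ap]]] := costly_walk; have [e _ eC] := solution_meets S_sol sq ap.
by apply/set0Pn; exists e.
Qed.

Lemma opt_gt0 : 0 < opt.
Proof.
have /set0Pn[e eC] := C_neq0.
have e0 : 0 < arc_cost e by have := fintype.subsetP C_sub _ eC; rewrite inE.
rewrite /opt (bigD1 e) //=; apply: ltr_wpDr => //.
by apply: sumr_ge0 => e' _; exact: arc_cost_ge0.
Qed.

Lemma opt_le : opt <= set_cost S.
Proof.
have /andP[/fintype.subsetP sub _] := S_sol.
rewrite /opt /set_cost [leRHS](bigID (fun e => e \in costly)) /=.
apply: le_trans (_ : \sum_(e in S | e \in costly) cost e <= _).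
  rewrite le_eqVlt; apply/orP; left; apply/eqP; apply: eq_big => e; first by rewrite inE.
  by rewrite inE => /andP[eS _]; rewrite /arc_cost sub.
by rewrite lerDl; apply: sumr_ge0 => e /andP[eS _]; apply: cost_ge0; exact: sub.
Qed.

(** Once a solution has been saved, [r] is the reciprocal of its cost; [r = 0] means that none has
    been. Either the saved solution is within the slack of [opt], or each of the [t] steps has paid
    1/2100 of potential. *)
Definition mw_invariant (t : nat) (y x : edge n -> rat) (r : rat) :=
  [/\ weights_ok y,
      (t = 0%N /\ r = 0) \/ [/\ 0 < r, lp_feasible k x & lp_cost x = r^-1] &
      (mw_slack * opt)^-1 <= r \/ pot y <= 2101 * (#|costly|%:R * #|costly|%:R) - t%:R / 2100].

Lemma mw_invariant_init x : mw_invariant 0 (fun e => (arc_cost e)^-1) x 0.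
Proof.
split; [|by left|right].
  split=> e; first by rewrite inE invr_gt0.
  by move/arc_cost0 ->; rewrite invr0.
rewrite mul0r subr0.
have := potential_init cR_gt0 C_sub C_neq0.
have -> : (fun e => (cR e)^-1) = (fun e => ratr (arc_cost e)^-1); last by [].
by apply/funext => e; rewrite fmorphV.
Qed.

Lemma mw_invariant_step t y x r y' x' r' :
  mw_invariant t y x r -> step y x r y' x' r' -> mw_invariant t.+1 y' x' r'.
Proof.
move=> [yk hx hp] st; have yk' := mw_step_weights yk st.
have [b [q [sq qmin]]] := st; set alpha := walk_length _ _ _ _ in qmin *.
have [b0 [q0 [sq0 ap0]]] := costly_walk.
have lt_ab : alpha < big_length y.
  apply: le_lt_trans (qmin _ _ sq0) _; apply: (costly_walk_short yk _ ap0).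
  by rewrite sq0.
rewrite lt_ab; set D := \sum_e arc_cost e * y e => -[hy hr].
have ap := short_walk_costly yk lt_ab.
have pp := costly_path ap; have uq := dag_path_edges_uniq pp.
have alphaE : alpha = \sum_(e <- path_edges b q) y e by exact: costly_walk_length.
have [e0 e0q e0C] := solution_meets S_sol sq ap.
have a0 : 0 < alpha.
  rewrite alphaE (big_rem e0) //=; apply: ltr_wpDr; last exact/yk.1/(allP ap).
  by apply: sumr_ge0 => e _; exact: weights_ge0.
have D0 : 0 < D.
  have e0p := allP ap _ e0q; have e0c : 0 < arc_cost e0 by move: e0p; rewrite inE.
  rewrite /D (bigD1 e0) //=; apply: ltr_wpDr; last by apply: mulr_gt0 => //; exact: yk.1.
  by apply: sumr_ge0 => e _; apply: mulr_ge0; [exact: arc_cost_ge0|exact: weights_ge0].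
have r_ge0 : 0 <= r by case: hx => [[_ ->] //|[/ltW]].
have rr' : r <= r' /\ alpha / D <= r'.
  by move: hr; case: ltP => [h [-> _]|h [-> _]]; split=> //; exact: ltW.
split=> //.
  right; move: hr; case: ltP => h [-> hx'].
    have xE : x' = (fun e => y e / alpha + (1 - (e \in costly)%:R)) by apply/funext.
    rewrite xE; split; first exact: divr_gt0.
      apply: free_solution_feasible => [e|v p sp app].
        by apply: divr_ge0; [exact: weights_ge0|exact: ltW].
      rewrite -mulr_suml ler_pdivlMr // mul1r -costly_walk_length //.
      exact: qmin.
    rewrite free_solution_cost invf_div /D mulr_suml.
    by apply: eq_bigr => e _; rewrite mulrA.
  have r0 : 0 < r by apply: lt_le_trans h; exact: divr_gt0.
  case: hx => [[_ e]|[_ fx cx]]; first by rewrite e ltxx in r0.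
  by have -> : x' = x by apply/funext.
case: hp => [hp|hp]; first by left; exact: le_trans hp rr'.1.
(* Rescaling the current weights gives cost [D / alpha]. If this is cheap enough the best ratio
   records it for good; otherwise [potential_step] applies. *)
have [h|h] := leP (mw_slack * opt)^-1 (alpha / D).
  by left; exact: le_trans h rr'.2.
right; pose P := [set e in path_edges b q].
have sumP (F : edge n -> R) : \sum_(e in P) F e = \sum_(e <- path_edges b q) F e.
  by rewrite big_uniq //; apply: eq_bigl => e; rewrite inE.
have sumP' : \sum_e' (e' \in path_edges b q)%:R * (arc_cost e')^-1 =
    \sum_(e <- path_edges b q) (arc_cost e)^-1.
  rewrite [RHS]big_uniq //= [RHS]big_mkcond /=; apply: eq_bigr => e _.
  by case: (e \in path_edges b q); rewrite ?mul1r ?mul0r.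
have inv c : ratr c^-1 = (ratr c)^-1 :> R by exact: fmorphV.
pose f : rat := mw_rate / \sum_(e <- path_edges b q) (arc_cost e)^-1.
have ps : pot y' <= pot y - 1 / 2100.
  apply: (@potential_step R _ costly C cR cR_gt0 C_sub C_neq0 P _ _ (ratr f)).
  - by move=> e ep; rewrite ltr0q yk.1.
  - by apply/fintype.subsetP => e; rewrite inE => /(allP ap).
  - exists e0; [rewrite inE; exact: e0q|exact: e0C].
  - rewrite sumP /f fmorph_div /= ratr_mw_rate rmorph_sum /=.
    by congr (_ / _); apply: eq_bigr => e _; rewrite inv.
  - have h' : mw_slack * opt * alpha <= D.
      have o0 : 0 < mw_slack * opt by apply: mulr_gt0 opt_gt0; exact: mw_slack_gt0.
      by move: (ltW h); rewrite -[X in _ <= X]div1r ler_pdivlMr // mulrC mulrA ler_pdivrMr // mul1r.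
    move: h'; rewrite -(ler_rat R) rmorphM rmorphM /= ratr_mw_slack.
    rewrite rmorph_sum /= /volume alphaE rmorph_sum /= sumP /D rmorph_sum /=.
    congr (_ <= _); rewrite big_mkcond [LHS](bigID (fun e => e \in costly)) /=.
    rewrite [X in _ + X]big1 ?addr0 => [|e ep]; last by rewrite arc_cost0 // mul0r rmorph0.
    by apply: eq_bigr => e _; rewrite rmorphM.
  - move=> e ep; rewrite hy sumP' -/f rmorphM rmorphD rmorph1 !rmorphM /= !inv ratr_nat inE.
    case: (e \in path_edges b q); rewrite ?mulr1n ?mulr0n ?mul1r; first by reflexivity.
    by rewrite mul0r mulr0 addr0 mulr1.
apply: le_trans ps _; apply: le_trans (lerB hp (lexx _)) _.
by rewrite -[t.+1%:R]natr1; move: (#|costly|%:R * #|costly|%:R) (t%:R) => u v; lra.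
Qed.

(** After that many steps the second alternative would make the potential negative, since at most
    n^2 pairs are costly. *)
Lemma mw_invariant_final t y x r : mw_invariant t y x r ->
  2100 * 2101 * (n * n * (n * n))%:R < t%:R :> R ->
  lp_feasible k x /\ lp_cost x <= mw_slack * set_cost S.
Proof.
move=> [yk hx hp] tbig.
have pot0 : 0 <= pot y.
  by apply: potential_ge0 => // e ep; rewrite ltr0q yk.1.
have mn : (#|costly| <= n * n)%N.
  by apply: leq_trans (max_card _) _; rewrite card_prod card_ord.
case: hx => [[t0 _]|[r0 fx cx]].
  have : 0 <= 2100 * 2101 * (n * n * (n * n))%:R :> R.
    by apply: mulr_ge0; [apply: mulr_ge0; exact: ler0n|exact: ler0n].
  by rewrite leNgt; move: tbig; rewrite t0 => ->.
split; first exact: fx.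
rewrite cx.
have {}hp : (mw_slack * opt)^-1 <= r.
  case: hp => // hp; exfalso.
  have h1 : 2100 * 2101 * (#|costly|%:R * #|costly|%:R) < t%:R :> R.
    apply: le_lt_trans tbig; apply: ler_wpM2l; first by apply: mulr_ge0; exact: ler0n.
    by rewrite -natrM ler_nat; exact: leq_mul.
  by move: pot0 hp h1; move: (pot y) (#|costly|%:R * #|costly|%:R) (t%:R) => a b c; lra.
have o0 : 0 < mw_slack * opt by apply: mulr_gt0 opt_gt0; exact: mw_slack_gt0.
apply: le_trans (_ : mw_slack * opt <= _).
  by rewrite -[leRHS]invrK lef_pV2 ?posrE ?invr_gt0.
by apply: ler_wpM2l; [exact/ltW/mw_slack_gt0|exact: opt_le].
Qed.

End Progress.

End MultiplicativeWeights.

(** * The approximation algorithm *)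

Section PolynomialSize.
Variables (I : Type) (sz : I -> nat).

(** Closure under sums and products replaces explicit estimates of the time and bit bounds. *)
Definition poly_in (f : I -> nat) := exists A D, forall i, (f i <= A * (sz i).+1 ^ D)%N.

Lemma poly_in_const a : poly_in (fun=> a).
Proof. by exists a, 0%N => i; rewrite expn0 muln1. Qed.

Lemma poly_in_size : poly_in sz.
Proof. by exists 1%N, 1%N => i; rewrite mul1n expn1. Qed.

Lemma poly_in_le f g : (forall i, (f i <= g i)%N) -> poly_in g -> poly_in f.
Proof. by move=> fg [A [D h]]; exists A, D => i; exact: leq_trans (fg i) (h i). Qed.

Lemma poly_in_mul f g : poly_in f -> poly_in g -> poly_in (fun i => f i * g i)%N.
Proof.
move=> [A [D h]] [A' [D' h']]; exists (A * A')%N, (D + D')%N => i.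
by rewrite expnD mulnACA; exact: leq_mul.
Qed.

Lemma poly_in_add f g : poly_in f -> poly_in g -> poly_in (fun i => f i + g i)%N.
Proof.
move=> [A [D h]] [A' [D' h']]; exists (A + A')%N, (D + D')%N => i.
rewrite mulnDl; apply: leq_add.
  by apply: leq_trans (h i) _; rewrite leq_mul2l leq_pexp2l ?leq_addr ?orbT.
by apply: leq_trans (h' i) _; rewrite leq_mul2l leq_pexp2l ?leq_addl ?orbT.
Qed.

Lemma poly_in_time f : poly_in f -> exists d, forall i, (f i <= poly_time d (sz i))%N.
Proof.
move=> [A [D h]]; have [d hd] := polynomial_bound A D.
by exists d => i; exact: leq_trans (h i) (hd _).
Qed.

End PolynomialSize.

(** * Computations that ignore the random bits *)

Definition set_bits (s : store) (g : nat -> rat) : store :=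
  fun a => if a == 4%N then g else s a.

Fixpoint cmd_reads (c : cmd) : seq nat :=
  match c with
  | Skip => [::]
  | Assign _ i e => reads i ++ reads e
  | Seq c1 c2 => cmd_reads c1 ++ cmd_reads c2
  | If e c1 c2 => reads e ++ cmd_reads c1 ++ cmd_reads c2
  | While e c => reads e ++ cmd_reads c
  end.

Lemma eval_set_bits s g e : 4%N \notin reads e -> eval_expr (set_bits s g) e = eval_expr s e.
Proof.
elim: e => [q|a i IH|o e1 IH1 e2 IH2] //=.
  by rewrite inE negb_or => /andP[a4 /IH ->]; rewrite /set_bits eq_sym (negPf a4).
by rewrite mem_cat negb_or => /andP[/IH1 -> /IH2 ->].
Qed.

Lemma eval_cost_set_bits s g e : 4%N \notin reads e -> eval_cost (set_bits s g) e = eval_cost s e.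
Proof.
elim: e => [q|a i IH|o e1 IH1 e2 IH2] h //; move: (h).
  rewrite [reads _]/= inE negb_or => /andP[_ /IH hi].
  by rewrite -[LHS]/(rat_bits (eval_expr (set_bits s g) (Get a i)) + eval_cost (set_bits s g) i)%N eval_set_bits // hi.
rewrite [reads _]/= mem_cat negb_or => /andP[/IH1 h1 /IH2 h2].
by rewrite -[LHS]/(rat_bits (eval_expr (set_bits s g) (Bin o e1 e2)) +
  (eval_cost (set_bits s g) e1 + eval_cost (set_bits s g) e2))%N eval_set_bits // h1 h2.
Qed.

Lemma set_bits_update s g a i q : a != 4%N -> set_bits (update s a i q) g = update (set_bits s g) a i q.
Proof.
move=> a4; apply/funext => b; apply/funext => j; rewrite /set_bits /update.
by case: eqP => // ->; rewrite eq_sym (negPf a4).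
Qed.

(* The computation of a program that ignores array 4, which holds the random bits, does not
   depend on the contents of this array. *)
Lemma exec_set_bits c s s' t g : exec c s s' t -> 4%N \notin cmd_reads c -> 4%N \notin writes c ->
  exec c (set_bits s g) (set_bits s' g) t.
Proof.
elim=> {c s s' t} [s|s a i e|c1 c2 s1 s2 s3 t1 t2 _ IH1 _ IH2|e c1 c2 s s' t _ IH|e c s h|
  e c s1 s2 s3 t1 t2 h _ IH1 _ IH2] /=.
- by move=> _ _; exact: exec_skip.
- rewrite mem_cat negb_or inE => /andP[hi he]; rewrite eq_sym => a4.
  rewrite set_bits_update // -(eval_set_bits s g hi) -(eval_set_bits s g he).
  rewrite -(eval_cost_set_bits s g hi) -(eval_cost_set_bits s g he); exact: exec_assign.
- rewrite !mem_cat !negb_or => /andP[r1 r2] /andP[w1 w2].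
  exact: exec_seq (IH1 r1 w1) (IH2 r2 w2).
- rewrite !mem_cat !negb_or => /and3P[r0 r1 r2] /andP[w1 w2].
  rewrite -(eval_cost_set_bits s g r0); apply: exec_if.
  by rewrite eval_set_bits //; move: IH; case: ifP => _ IH; exact: IH.
- rewrite mem_cat negb_or => /andP[r0 _] _; rewrite -(eval_cost_set_bits s g r0).
  by apply: exec_while_stop; rewrite eval_set_bits.
- rewrite mem_cat negb_or => /andP[r0 r1] w1; rewrite -(eval_cost_set_bits s1 g r0).
  apply: exec_while_step (IH1 r1 w1) (IH2 _ w1); first by rewrite eval_set_bits.
  by rewrite /= mem_cat negb_or r0.
Qed.

(** [runs] only asserts a final store for each initial store separately. The expectation is taken
    for one fixed LP solution, so the solver must end in the same store for all random strings, up
    to the bits themselves. *)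
Lemma runs_set_bits L c m s (Q : store -> Prop) :
  4%N \notin cmd_reads c -> 4%N \notin writes c -> bounded L s -> runs L c m s Q ->
  exists s', [/\ agree (writes c) s s', Q s' &
    forall g, (forall i, fits L (g i)) -> runs L c m (set_bits s g) (fun s'' => s'' = set_bits s' g)].
Proof.
move=> r4 w4 bs H; have [s' [t [ex tm bs' ag q]]] := H bs.
exists s'; split=> // g fg _; exists (set_bits s' g), t; split=> //.
- exact: exec_set_bits.
- by move=> a i; rewrite /set_bits; case: ifP.
- by move=> a aw i; rewrite /set_bits; case: ifP => // _; exact: ag.
Qed.

(** * The LP solver and its time and bit bounds *)

Definition mw_init : cmd :=
  For 31 NN (If (Get 2 (Var 31))
    (Seq (Assign 11 (Var 31) (EDiv (Cst 1) (Get 2 (Var 31))))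
      (Seq (Assign 12 (Var 31) (EDiv (Cst 1) (Get 2 (Var 31))))
        (Assign 13 (Var 31) (Cst 1))))
    (Assign 10 (Var 31) (Cst 1))).

Lemma runs_mw_init L n (s : store) : s 0%N 0%N = n%:R -> (n * n <= L)%N -> (0 < L)%N ->
  (forall i, (i < n * n)%N -> 0 <= s 2 i /\ fits L (s 2 i)^-1) ->
  (forall i, [/\ s 10 i = 0, s 11 i = 0, s 12 i = 0 & s 13 i = 0]) ->
  runs L mw_init (n * n * 9 + 3) s (fun s' => forall i, (i < n * n)%N ->
    [/\ s' 10 i = 1 - (0 < s 2 i)%R%:R, s' 11 i = (s 2 i)^-1, s' 12 i = (s 2 i)^-1 &
        s' 13 i = (0 < s 2 i)%R%:R]).
Proof.
move=> sn nL L0 f2 z.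
pose I i (s' : store) := (forall j, (j < i)%N ->
    [/\ s' 10 j = 1 - (0 < s 2 j)%R%:R, s' 11 j = (s 2 j)^-1, s' 12 j = (s 2 j)^-1 &
        s' 13 j = (0 < s 2 j)%R%:R]) /\
  (forall j, (i <= j)%N -> [/\ s' 10 j = 0, s' 11 j = 0, s' 12 j = 0 & s' 13 j = 0]).
apply: runsW (@runs_for _ _ _ _ (n * n) 6 _ I _ _ _ _ _ _) (leqnn _) _.
- by [].
- by [].
- exact: eval_NN.
- by [].
- split=> // j _; exact: z.
- move=> i s1 iN ag si _ [hlt hge].
  have [z10 z11 z12 z13] := hge i (leqnn _).
  have [c0 fc] := f2 i iN.
  have c2 : s1 2 i = s 2 i by rewrite ag.
  have ev : address (eval_expr s1 (Var 31)) = i by rewrite /= address0 si address_nat.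
  have step (s2 : store) : (forall a j, j != i -> (a \in [:: 10; 11; 12; 13]%N) -> s2 a j = s1 a j) ->
      [/\ s2 10 i = 1 - (0 < s 2 i)%R%:R, s2 11 i = (s 2 i)^-1, s2 12 i = (s 2 i)^-1 &
        s2 13 i = (0 < s 2 i)%R%:R] -> I i.+1 (update s2 31 0%N i.+1%:R).
    move=> h1 h2; split=> j.
      rewrite ltnS leq_eqVlt => /orP[/eqP -> //|ji].
      have [q1 q2 q3 q4] := hlt j ji.
      by split; rewrite update_neq // h1 ?(ltn_eqF ji).
    move=> ij; have [q1 q2 q3 q4] := hge j (ltnW ij).
    by split; rewrite update_neq // h1 ?(gtn_eqF ij).
  have e2 : eval_expr s1 (Get 2 (Var 31)) = s 2 i.
    by rewrite -[LHS]/(s1 2 (address (eval_expr s1 (Var 31)))) ev c2.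
  apply: (@runs_if _ _ _ _ 5); rewrite e2 => h.
    have ediv s2 : s2 31 0%N = i%:R -> s2 2 i = s 2 i ->
        eval_expr s2 (EDiv (Cst 1) (Get 2 (Var 31))) = (s 2 i)^-1.
      by move=> q1 q2; rewrite /= address0 q1 address_nat q2 div1r.
    have eadr s2 : s2 31 0%N = i%:R -> address (eval_expr s2 (Var 31)) = i.
      by move=> q1; rewrite /= address0 q1 address_nat.
    apply: (@runs_le _ _ (1 + (1 + 1 + 1) + 1)) => //; apply: runs_seq.
    apply: (@runs_store _ _ _ _ i _ (s 2 i)^-1) => //; first exact: ediv.
    apply: runs_seq; apply: (@runs_store _ _ _ _ i _ (s 2 i)^-1) => //; first exact: ediv.
    apply: (@runs_store _ _ _ _ i _ 1).
    - exact: eadr.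
    - by reflexivity.
    - exact: (fits_natS (m := 1)).
    apply: step => [a j ji _|].
      by rewrite !update_neq // ji orbT.
    by rewrite /update /= !eqxx h z10 subrr; split; reflexivity.
  apply: (@runs_le _ _ 1) => //.
  have c00 : s 2 i = 0 by apply/eqP; rewrite eq_le h c0.
  apply: (@runs_store _ _ _ _ i _ 1) => //; first exact: (fits_natS (m := 1)).
  apply: step => [a j ji _|]; first by rewrite !update_neq // ji orbT.
  rewrite /update /= !eqxx z11 z12 z13 c00 ltxx subr0 invr0; split; reflexivity.
by move=> s' _ _ [].
Qed.

(** Anything above 2100 * 2101 will do: the potential starts at no more than 2101 n^4 and loses
    1/2100 per round. *)
Definition mw_factor : nat := locked (2200 * 2200)%N.

Definition mw_rounds (n : nat) : nat := (mw_factor * (n * n * (n * n)))%N.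

Lemma mw_rounds_large (R : realType) n : (0 < n)%N ->
  2100 * 2101 * (n * n * (n * n))%:R < (mw_rounds n)%:R :> R.
Proof.
move=> n0; rewrite /mw_rounds (natrM _ mw_factor) ltr_pM2r; last by rewrite ltr0n !muln_gt0 n0.
by rewrite /mw_factor -lock natrM; lra.
Qed.

Definition mw_program : cmd :=
  Seq mw_init (For 30 (EMul (Cst mw_factor%:R) (EMul NN NN)) mw_iteration).

(** If [k >= nverts G] no path has [k] arcs, and the empty set in the untouched output array is a
    solution. *)
Definition approx_program : cmd :=
  If (ESub Nv Kv) (Seq mw_program (round_program 10)) Skip.

Section Bounds.
Variables (G : dag rat) (k : nat).
Notation n := (nverts G).
Let S := (input_size G k [::]).+1.

(** The initial weights, inverse costs, fit in [S] bits, and every round adds the same amount. *)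
Definition final_bits : nat := (S + mw_rounds n * weight_growth n S)%N.
Definition mw_bits : nat :=
  (n * length_bits n final_bits + n * n * (final_bits + final_bits) + final_bits + n + n * n + 30
   + n * n * (1 + S) + S + mw_rounds n)%N.
Definition mw_steps : nat := (n * n * 9 + 3 + (mw_rounds n * (n * n * n * 100 + 100 + 3) + 3) + 1)%N.

Lemma size_le_mw_bits : (S <= mw_bits)%N.
Proof. by rewrite /mw_bits; lia. Qed.

Lemma nverts_le_mw_bits : (n <= mw_bits)%N.
Proof. by rewrite /mw_bits; lia. Qed.

Lemma mw_bits_ge8 : (8 <= mw_bits)%N.
Proof. by rewrite /mw_bits; lia. Qed.

Lemma fits_arc_cost e : fits S (arc_cost (G := G) e).
Proof.
rewrite /arc_cost; case: ifP => eA; last exact: fits0.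
by apply: fitsW (fits_bits _); apply: leqW; exact: cost_bits_le.
Qed.

Lemma fits_inv b q : fits b q -> fits b q^-1.
Proof. by rewrite /fits => h; exact: leq_trans (heightV _) h. Qed.

(** The invariant [P] is arbitrary, which separates the execution of the program from the analysis
    of the method. It is instantiated with the potential argument, and with the trivial case in
    which no costly walk exists. *)
Lemma runs_mw_program (w : seq bool) (P : nat -> (edge n -> rat) -> (edge n -> rat) -> rat -> Prop) :
  (k < n)%N ->
  P 0%N (fun e => (arc_cost e)^-1) (fun e => 1 - (e \in costly G)%:R) 0 ->
  (forall t y x r y' x' r', P t y x r ->
     mw_step k (@arc_cost G) (fun e => (arc_cost e)^-1) (fun e => e \in costly G) y x r y' x' r' ->
     P t.+1 y' x' r') ->
  runs mw_bits mw_program mw_steps (input G k [::] w) (fun s' => exists y x r,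
    P (mw_rounds n) y x r /\ forall e, s' 10 (flat e) = x e).
Proof.
move=> kn P0 PS; set s := input _ _ _ _.
have L_ge m : (m <= n * length_bits n final_bits + n * n * (final_bits + final_bits) + final_bits + n + n * n + 30
   + n * n * (1 + S) + S)%N -> (m <= mw_bits)%N by move=> h; apply: leq_trans h (leq_addr _ _).
have sn : s 0%N 0%N = n%:R by reflexivity.
have sk : s 0%N 1%N = k%:R by reflexivity.
have s2 (e : edge n) : s 2 (flat e) = arc_cost e.
  case: e => u v; rewrite /arc_cost -nth_arc_table; reflexivity.
apply: runs_seq.
apply: runsW (@runs_mw_init _ n _ _ _ _ _ _) (leqnn _) _ => //.
- by apply: L_ge; lia.
- by apply: L_ge; lia.
- move=> i /flat_surj[e <-]; rewrite s2; split; first exact: arc_cost_ge0.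
  by apply: fits_inv; apply: fitsW (fits_arc_cost e); apply: L_ge; lia.
move=> s1 ag1 _ h1.
have c1 : lp_const k (@arc_cost G) (fun e => (arc_cost e)^-1) (fun e => e \in costly G) s1.
  split.
  - by rewrite ag1.
  - by rewrite ag1.
  - by move=> e; rewrite ag1.
  - by move=> e; have [_ _ -> _] := h1 _ (flat_lt e); rewrite s2.
  - by move=> e; have [_ _ _ ->] := h1 _ (flat_lt e); rewrite s2 inE.
pose J t (s' : store) := exists y x r, [/\ lp_vars y x r s', P t y x r &
  forall e, fits (S + t * weight_growth n S) (y e)].
apply: runsW (@runs_for _ _ _ _ (mw_rounds n) (n * n * n * 100 + 100) _ J _ _ _ _ _ _) (leqnn _) _.
- by [].
- by [].
- have [q1 _ _ _ _] := c1.
  rewrite -[LHS]/(mw_factor%:R * (eval_expr s1 NN * eval_expr s1 NN)) (eval_NN q1).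
  by rewrite -!natrM.
- by rewrite /mw_bits leq_addl.
- exists (fun e => (arc_cost e)^-1), (fun e => 1 - (e \in costly G)%:R), 0; split.
  + split.
    * by move=> e; rewrite update_neq //; have [_ -> _ _] := h1 _ (flat_lt e); rewrite s2.
    * by move=> e; rewrite update_neq //; have [-> _ _ _] := h1 _ (flat_lt e); rewrite s2 inE.
    * by rewrite update_neq // ag1.
    * by move=> e; rewrite update_neq // ag1.
    * by move=> v _; rewrite update_neq // ag1.
  + exact: P0.
  + by move=> e; rewrite mul0n addn0; apply: fits_inv; exact: fits_arc_cost.
- move=> t s2' tK ag2 _ _ [y [x [r [vr Pt fy]]]].
  have c2 : lp_const k (@arc_cost G) (fun e => (arc_cost e)^-1) (fun e => e \in costly G) s2'.
    have [q1 q2 q3 q4 q5] := c1; split.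
    - by rewrite ag2.
    - by rewrite ag2.
    - by move=> e; rewrite ag2.
    - by move=> e; rewrite ag2.
    - by move=> e; rewrite ag2.
  set B := (S + t * weight_growth n S)%N in fy.
  have BF : (B <= final_bits)%N.
    by rewrite /B /final_bits leq_add2l leq_mul2r (ltnW tK) orbT.
  apply: runsW (runs_mw_iteration (S := S) kn _ _ c2 vr _ _ fy) (leqnn _) _.
  + by rewrite /B leq_addr.
  + apply: L_ge; rewrite !leq_add2r; apply: leq_add; last exact: BF.
    apply: leq_add; last by rewrite leq_mul2l leq_add ?orbT.
    rewrite leq_mul2l; apply/orP; right; rewrite /length_bits.
    apply: leq_add; first exact: BF.
    by rewrite !leq_add2l leq_mul2l BF orbT.
  + by move=> e; exact: fits_arc_cost.
  + by move=> e; apply: fits_inv; exact: fits_arc_cost.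
  move=> s3 _ _ [y' [x' [r' [vr' st fy']]]].
  exists y', x', r'; split.
  + have [q1 q2 q3 q4 q5] := vr'; split.
    * by move=> e; rewrite update_neq.
    * by move=> e; rewrite update_neq.
    * by rewrite update_neq.
    * by move=> e; rewrite update_neq.
    * by move=> v vn; rewrite update_neq // q5.
  + exact: PS Pt st.
  + move=> e; apply: fitsW (fy' e); rewrite /B; lia.
move=> s' _ _ [y [x [r [[_ q2 _ _ _] Pt _]]]].
by exists y, x, r.
Qed.

End Bounds.

Lemma lp_approximation (R : realType) (G : dag rat) k : (0 < k)%N -> (k < nverts G)%N ->
  exists (x : edge (nverts G) -> rat) (s' : store), [/\ lp_feasible k x, lp_cost x <= mw_slack * ded_opt G k,
    agree (writes mw_program) (input G k [::] [::]) s',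
    forall e, s' 10 (flat e) = x e &
    forall g, (forall i, fits (mw_bits G k) (g i)) ->
      runs (mw_bits G k) mw_program (mw_steps G) (set_bits (input G k [::] [::]) g)
        (fun s'' => s'' = set_bits s' g)].
Proof.
move=> k0 kn; have [Sol solS ->] := @ded_opt_attained _ G k k0.
have bs : bounded (mw_bits G k) (input G k [::] [::]).
  move=> a i; apply: fitsW (@bounded_input G k [::] [::] a i).
  exact: size_le_mw_bits.
(* A costly walk is what makes the benchmark set non-empty and its cost positive, without which the
   potential is meaningless. *)
have [cw|ncw] := pselect (exists (b : 'I_(nverts G)) q,
    size q = k /\ all (fun e => e \in costly G) (path_edges b q)).
  have [s' [ag [y [x [r [inv s10]]]] tr]] := @runs_set_bits _ mw_program _ _ _ isT isT bs
    (@runs_mw_program G k [::] (mw_invariant k R Sol) kn (mw_invariant_init R solS cw _)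
       (fun t y x r y' x' r' => @mw_invariant_step G k kn R Sol solS cw t y x r y' x' r')).
  have [fx cx] := mw_invariant_final solS cw inv (mw_rounds_large R (leq_ltn_trans (leq0n _) kn)).
  by exists x, s'; split.
pose P (t : nat) (y x : edge (nverts G) -> rat) (r : rat) :=
  weights_ok y /\ x =1 (fun e => 1 - (e \in costly G)%:R).
have none b q : size q = k -> ~~ all (fun e => e \in costly G) (path_edges b q).
  by move=> sq; apply/negP => ap; apply: ncw; exists b, q.
have P0 : P 0%N (fun e => (arc_cost e)^-1) (fun e => 1 - (e \in costly G)%:R) 0.
  split=> //; split=> e; first by rewrite inE invr_gt0.
  by move/arc_cost0 ->; rewrite invr0.
have PS t y x r y' x' r' : P t y x r ->
     mw_step k (@arc_cost G) (fun e => (arc_cost e)^-1) (fun e => e \in costly G) y x r y' x' r' ->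
     P t.+1 y' x' r'.
  move=> [yk xE] st; split; first exact: mw_step_weights st.
  by move=> e; rewrite (mw_step_idle yk none st).
have [s' [ag [y [x [r [[yk xE] s10]]]] tr]] := @runs_set_bits _ mw_program _ _ _ isT isT bs (@runs_mw_program G k [::] P kn P0 PS).
have {}xE : x = (fun e => 0 + (1 - (e \in costly G)%:R)).
  by apply/funext => e; rewrite xE add0r.
exists x, s'; split=> //; rewrite xE.
  apply: free_solution_feasible => // v p sp ap; exfalso.
  by have := none v p sp; rewrite ap.
rewrite (free_solution_cost (fun=> 0)) big1 => [|e _]; last by rewrite mulr0.
apply: mulr_ge0; first exact/ltW/mw_slack_gt0.
by have /andP[sub _] := solS; exact: set_cost_ge0.
Qed.

(** The place where the two losses meet: 1123/2048 * 1.001 is about 0.5489. *)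
Lemma ratio_product (F : realFieldType) (z o : F) : 0 <= z * o ->
  1123 / 2048 * z * (1001 / 1000 * o) <= 549 / 1000 * z * o.
Proof. by lra. Qed.

Lemma mw_ratio k (o c : rat) : 0 <= o -> c <= mw_slack * o ->
  1123 / 2048 * k.+1%:R * c <= approx_ratio rat k * o.
Proof.
move=> o0 h; apply: le_trans (_ : 1123 / 2048 * k.+1%:R * (mw_slack * o) <= _).
  by apply: ler_wpM2l h; apply: mulr_ge0; [apply: divr_ge0; exact: ler0n|exact: ler0n].
have k0 : 0 <= k.+1%:R * o :> rat by apply: mulr_ge0 => //; exact: ler0n.
rewrite /approx_ratio /mw_slack -lock; exact: ratio_product.
Qed.

Lemma approximation_algorithm (R : realType) :
  exists (prog : cmd) (d : nat), forall (G : dag rat) (k : nat), (0 < k)%N ->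
    rand_solves prog (poly_time d (input_size G k [::])) G k [::]
      (approx_ratio rat k * ded_opt G k).
Proof.
pose I := (dag rat * nat)%type.
pose sz (i : I) := input_size i.1 i.2 [::].
pose steps (i : I) := (mw_steps i.1 + 1000 * ((nverts i.1).+1 * (nverts i.1).+1) + 1 + 1)%N.
(* One polynomial has to cover the running time and eight random bits per vertex, hence the sum of
   both. *)
pose bound (i : I) := (steps i * (cmd_charge approx_program * (mw_bits i.1 i.2).+1)
  + 8 * nverts i.1)%N.
have pS : poly_in sz (fun i => (sz i).+1) by exists 1%N, 1%N => i; rewrite mul1n expn1.
have pn : poly_in sz (fun i => nverts i.1).
  by apply: poly_in_le (poly_in_size sz) => -[G k]; exact: nverts_le_size.
have padd := @poly_in_add I sz; have pmul := @poly_in_mul I sz; have pc := poly_in_const sz.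
have pn1 : poly_in sz (fun i => (nverts i.1).+1).
  by apply: poly_in_le (padd _ _ pn (pc 1%N)) => i; rewrite addn1.
have pK : poly_in sz (fun i => mw_rounds (nverts i.1)).
  by apply: (pmul _ _ (pc _)); apply: (pmul); apply: (pmul).
have pg : poly_in sz (fun i => weight_growth (nverts i.1) (sz i).+1).
  by do ![apply: (padd) | apply: (pmul) | exact: pc | exact: pn | exact: pS].
have pf : poly_in sz (fun i => final_bits i.1 i.2).
  by apply: (padd _ _ pS); apply: (pmul).
have pL : poly_in sz (fun i => mw_bits i.1 i.2).
  by do ![exact: pK | exact: pf | exact: pS | exact: pn | exact: pc | apply: (padd) | apply: (pmul)].
have pL1 : poly_in sz (fun i => (mw_bits i.1 i.2).+1).
  by apply: poly_in_le (padd _ _ pL (pc 1%N)) => i; rewrite addn1.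
have pm : poly_in sz (fun i => mw_steps i.1).
  exact: (padd _ _ (padd _ _ (padd _ _ (pmul _ _ (pmul _ _ pn pn) (pc 9%N)) (pc 3%N))
    (padd _ _ (pmul _ _ pK (padd _ _ (padd _ _ (pmul _ _ (pmul _ _ (pmul _ _ pn pn) pn)
      (pc 100%N)) (pc 100%N)) (pc 3%N))) (pc 3%N))) (pc 1%N)).
have pst : poly_in sz steps.
  exact: (padd _ _ (padd _ _ (padd _ _ pm (pmul _ _ (pc 1000%N) (pmul _ _ pn1 pn1))) (pc 1%N)) (pc 1%N)).
have pb : poly_in sz bound.
  exact: (padd _ _ (pmul _ _ pst (pmul _ _ (pc _) pL1)) (pmul _ _ (pc 8%N) pn)).
have [d hd] := poly_in_time pb.
exists approx_program, d => G k k0.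
set T := poly_time d _.
have hb : (steps (G, k) * (cmd_charge approx_program * (mw_bits G k).+1) + 8 * nverts G <= T)%N.
  exact: hd (G, k).
have tT : (steps (G, k) * (cmd_charge approx_program * (mw_bits G k).+1) <= T)%N.
  exact: leq_trans (leq_addr _ _) hb.
have nT : (8 * nverts G <= T)%N by exact: leq_trans (leq_addl _ _) hb.
have SL : ((input_size G k [::]).+1 <= mw_bits G k)%N by exact: size_le_mw_bits.
have nL : (nverts G <= mw_bits G k)%N by exact: nverts_le_mw_bits.
have guardE w : eval_expr (input G k [::] w) (ESub Nv Kv) = (nverts G)%:R - k%:R.
  rewrite -[LHS]/(input G k [::] w 0%N (address 0) - input G k [::] w 0%N (address 1)).
  by rewrite address0 address1; reflexivity.
have [kn|nk] := ltnP k (nverts G); last first.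
  apply: (rand_solves_runs (out := fun=> finset.set0) SL _ tT).
  - move=> w; apply: (@runs_le _ _ (1 + 1)); last by rewrite /steps; lia.
    apply: runs_if; rewrite guardE ?subr_gt0 ?ltr_nat ?ltnNge ?nk // => _.
    apply: runs_skip; apply/setP => e; rewrite !inE; apply/negbTE; rewrite negbK.
    by apply/eqP; reflexivity.
  (* A path with [k >= n] arcs would have more than [n] distinct vertices. *)
  - move=> w; rewrite /ded_solution finset.sub0set; apply/forallP => v; apply/forallP => p.
    apply/negP => /andP[_ up]; have := card_uniqP up; rewrite /= size_tuple => cu.
    by have := max_card (mem (v :: p)); rewrite cu card_ord; lia.
  - rewrite big1 => [|w _]; last by rewrite /set_cost big_set0.
    apply: mulr_ge0; last by apply: exprn_ge0.
    by apply: mulr_ge0; [apply: mulr_ge0; [apply: divr_ge0; exact: ler0n|exact: ler0n]|exact: ded_opt_ge0].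
have [x [s' [fx cx ag s10 tr]]] := lp_approximation R k0 kn.
apply: (rand_solves_runs (out := fun w => cut_set k x w) SL _ tT).
- move=> w.
  have inE' : input G k [::] w = set_bits (input G k [::] [::]) (fun i => (nth false w i)%:R).
    by apply/funext => -[|[|[|[|[|a]]]]].
  apply: (@runs_le _ _ ((mw_steps G + 1000 * (nverts G).+1 ^ 2 + 1) + 1)); last first.
    by rewrite /steps -mulnn.
  apply: runs_if; rewrite guardE ?subr_gt0 ?subr_le0 ?ler_nat ?ltr_nat; last by rewrite leqNgt kn.
  move=> _; rewrite inE'; apply: runs_seq.
  apply: runsW (tr _ _) (leqnn _) _.
    by move=> i; apply: fits_natS; apply: leq_trans (leq_b1 _) _; exact: leq_trans SL.
  move=> s2 _ _ ->; apply: runs_round_program => //.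
  + exact: mw_bits_ge8.
  + have [q1 q2 q3] := input_holds_graph G k [::] [::].
    by split=> [||u v]; rewrite /set_bits /= ag.
  + by move=> u v _; rewrite /set_bits /= -s10.
  + by move=> i; rewrite /set_bits /= ag.
- by move=> w; exact: cut_set_solution.
- apply: le_trans (expected_cut_cost fx nT) _; apply: ler_wpM2r; first exact: exprn_ge0.
  by apply: mw_ratio cx; exact: ded_opt_ge0.
Qed.

Theorem theorem1p1 (R : realType) :
  [/\
    exists (prog : cmd) (d : nat), forall (G : dag rat) (k : nat), (0 < k)%N ->
      rand_solves prog (poly_time d (input_size G k [::])) G k [::]
        (approx_ratio rat k * ded_opt G k),
    exists (prog : cmd) (d : nat), forall (G : dag rat) (k : nat)
        (x : edge (nverts G) -> rat), (0 < k)%N -> lp_feasible k x ->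
      rand_solves prog (poly_time d (input_size G k (arc_table x)))
        G k (arc_table x) (approx_ratio rat k * lp_cost x),
    forall (G : dag R) (k : nat) (x : edge (nverts G) -> R), (0 < k)%N ->
      lp_feasible k x ->
      exists mu : {set edge (nverts G)} -> R,
        [/\ is_distr mu,
            forall S, mu S != 0 -> ded_solution k S
          & \sum_S mu S * set_cost S <= approx_ratio R k * lp_cost x]
    & forall k : nat, (0 < k)%N -> (integrality_gap R k <= (approx_ratio R k)%:E)%E].
Proof.
split; first exact: approximation_algorithm R.
- exact: rounding_algorithm.
- by move=> G k x _; exact: rounding_distribution.
- exact: integrality_gap_le.
Qed.
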